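(* Let $D$ be a digraph of order $p\geq 5$ such that $d(x)=id(x)+od(x)\geq p-1$ for every vertex $x$, and $\min\{id(x),od(x)\}\geq p/2-1$ for every vertex $x$. Put $n:=\lfloor p/2\rfloor$. Then either $D$ contains a directed cycle of length $p-1$, or $D\in \mathcal{H}(n,n)\cup\mathcal{B}(n,n)\cup\{[(K_n\cup K_n)+K_1]^*,\,H_{2n},\,H'_{2n},\,Q_5^*\}$ (up to isomorphism).
   Context: Digraphs are finite, without loops and without multiple arcs, but may contain both arcs $xy$ and $yx$. For a vertex $x$, $O(x)$ and $I(x)$ are its out- and in-neighbourhoods, $od(x)=|O(x)|$, $id(x)=|I(x)|$, $d(x)=od(x)+id(x)$. Cycles are directed and simple. For an undirected graph $G$, $G^*$ denotes the symmetric digraph obtained by replacing each edge $xy$ by the two arcs $xy,yx$. $K_m$ is the complete graph, $K_{a,b}$ the complete bipartite graph, $Q_5$ the undirected 5-cycle; $G_1\cup G_2$ is disjoint union and $G_1+G_2$ is the join. $K_m^*$ is the complete symmetric digraph on $m$ vertices. $\mathcal{B}(n,n)$: the set of digraphs of order $2n\geq 6$ obtained from $K^*_{n,n}$ by deleting $k$ pairwise vertex-disjoint arcs, where $0\leq k\leq n$. $\mathcal{H}(n,n)$: the set of digraphs $D$ of order $2n$ with $V(D)=F\cup B$, $|F|=|B|=n$, $D[F]$ and $D[B]$ both equal to $K_n^*$, no arc from a vertex of $B$ to a vertex of $F$, every vertex of $F$ has an out-neighbour in $B$ and every vertex of $B$ has an in-neighbour in $F$. $H_{2n}$ ($n\geq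 2$): the digraph of order $2n$ with vertex set $F\cup B\cup\{x,y\}$, where $H_{2n}[F\cup\{x\}]$ and $H_{2n}[B\cup\{y\}]$ are both $K_n^*$, there is no arc between $F$ and $B$, $O(x)=F\cup\{y\}$, $I(y)=B\cup\{x\}$, and $I(x)=O(y)=F\cup B$. $H'_{2n}$ is obtained from $H_{2n}$ by adding the arc $yx$. *)

(* Defs.v *)
From mathcomp Require Import all_boot.

Set Implicit Arguments.
Unset Strict Implicit.
Unset Printing Implicit Defensive.

(* A digraph is an irreflexive relation on a finite type: no
   loops, no multiple arcs, both arcs xy and yx allowed. *)
Record digraph := Digraph {
  vertex :> finType;
  arc : rel vertex;
  arc_irr : irreflexive arc }.

Record graph := Graph {
  gvertex :> finType;
  edge : rel gvertex;
  edge_sym : symmetric edge;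
  edge_irr : irreflexive edge }.

Definition outn (D : digraph) (x : D) : {set D} := [set y | arc x y].
Definition inn (D : digraph) (x : D) : {set D} := [set y | arc y x].
Definition outdeg (D : digraph) (x : D) : nat := #|outn x|.
Definition indeg (D : digraph) (x : D) : nat := #|inn x|.
Definition deg (D : digraph) (x : D) : nat := indeg x + outdeg x.

(* For l = 0 the empty sequence would qualify; only l > 0 is meaningful. *)
Definition has_dicycle (D : digraph) (l : nat) : Prop :=
  exists2 c : seq D, size c = l & ucycle (@arc D) c.

Definition diso (D E : digraph) : Prop :=
  exists2 f : D -> E, bijective f & forall x y, arc (f x) (f y) = arc x y.

Section Induced.
Variables (D : digraph) (A : {set D}).
Definition induced_arc : rel {x : D | x \in A} :=
  fun u v => arc (val u) (val v).
Fact induced_irr : irreflexive induced_arc.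
Proof. by move=> u; apply: arc_irr. Qed.
Definition induced : digraph := Digraph induced_irr.
End Induced.

Section AddArc.
Variables (D : digraph) (a b : D).
(* The conjunct u != v keeps the result loopless when a = b. *)
Definition add_arc_rel : rel D :=
  fun u v => arc u v || [&& u == a, v == b & u != v].
Fact add_arc_irr : irreflexive add_arc_rel.
Proof. by move=> u; rewrite /add_arc_rel arc_irr eqxx !andbF. Qed.
Definition add_arc : digraph := Digraph add_arc_irr.
End AddArc.

Section DelArcs.
Variables (D : digraph) (M : {set D * D}).
Definition del_arcs_rel : rel D := fun u v => arc u v && ((u, v) \notin M).
Fact del_arcs_irr : irreflexive del_arcs_rel.
Proof. by move=> u; rewrite /del_arcs_rel arc_irr. Qed.
Definition del_arcs : digraph := Digraph del_arcs_irr.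
End DelArcs.

(* G^* *)
Definition star (G : graph) : digraph := Digraph (@edge_irr G).

Section Complete.
Variable m : nat.
Definition complete_edge : rel 'I_m := fun x y => x != y.
Fact complete_sym : symmetric complete_edge.
Proof. by move=> x y; rewrite /complete_edge eq_sym. Qed.
Fact complete_irr : irreflexive complete_edge.
Proof. by move=> x; rewrite /complete_edge eqxx. Qed.
(* K_m *)
Definition complete : graph := Graph complete_sym complete_irr.
End Complete.

Section CompleteBipartite.
Variables a b : nat.
Definition bipartite_edge : rel ('I_a + 'I_b)%type :=
  fun u v => match u, v with
             | inl _, inr _ | inr _, inl _ => true
             | _, _ => false
             end.
Fact bipartite_sym : symmetric bipartite_edge.
Proof. by move=> [x|x] [y|y]. Qed.
Fact bipartite_irr : irreflexive bipartite_edge.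
Proof. by move=> [x|x]. Qed.
(* K_{a,b} *)
Definition complete_bipartite : graph := Graph bipartite_sym bipartite_irr.
End CompleteBipartite.

Section UnionJoin.
Variables G1 G2 : graph.
Definition sum_edge (across : bool) : rel (G1 + G2)%type :=
  fun u v => match u, v with
             | inl x, inl y => edge x y
             | inr x, inr y => edge x y
             | _, _ => across
             end.
Fact sum_edge_sym across : symmetric (sum_edge across).
Proof. by move=> [x|x] [y|y] //=; apply: edge_sym. Qed.
Fact sum_edge_irr across : irreflexive (sum_edge across).
Proof. by move=> [x|x] /=; apply: edge_irr. Qed.
(* Disjoint union and join, respectively. *)
Definition gunion : graph := Graph (sum_edge_sym false) (sum_edge_irr false).
Definition gjoin : graph := Graph (sum_edge_sym true) (sum_edge_irr true).
End UnionJoin.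

(* Q_5; ordS is the successor modulo 5. *)
Definition Q5_edge : rel 'I_5 := fun i j => (j == ordS i) || (i == ordS j).
Fact Q5_sym : symmetric Q5_edge.
Proof. by move=> i j; rewrite /Q5_edge orbC. Qed.
Fact Q5_irr : irreflexive Q5_edge.
Proof. by move=> [[|[|[|[|[|i]]]]] lti]. Qed.
Definition Q5 : graph := Graph Q5_sym Q5_irr.

(* The families below are closed under isomorphism. *)

Definition in_B (n : nat) (D : digraph) : Prop :=
  let K := star (complete_bipartite n n) in
  6 <= 2 * n /\
  exists M : {set K * K},
    [/\ forall e, e \in M -> arc e.1 e.2,
        forall e e', e \in M -> e' \in M -> e != e' ->
          [disjoint [set e.1; e.2] & [set e'.1; e'.2]],
        #|M| <= n
      & diso D (del_arcs M)].

Definition in_H (n : nat) (D : digraph) : Prop :=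
  #|D| = 2 * n /\
  exists F B : {set D},
    [/\ F :|: B = [set: D] /\ #|F| = n /\ #|B| = n,
        diso (induced F) (star (complete n)) /\
          diso (induced B) (star (complete n)),
        forall b f, b \in B -> f \in F -> ~~ arc b f,
        forall f, f \in F -> exists2 b, b \in B & arc f b
      & forall b, b \in B -> exists2 f, f \in F & arc f b].

(* D is H_{2n}, with the vertices named as in the definition of H_{2n}. *)
Definition H2n_with (n : nat) (D : digraph) (F B : {set D}) (x y : D) : Prop :=
  [/\ #|D| = 2 * n,
      [/\ F :|: B :|: [set x; y] = [set: D], [disjoint F & B],
          [disjoint F :|: B & [set x; y]] & x != y],
      diso (induced (x |: F)) (star (complete n)) /\
        diso (induced (y |: B)) (star (complete n)),
      forall f b, f \in F -> b \in B -> ~~ arc f b && ~~ arc b f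
    & [/\ outn x = y |: F, inn y = x |: B,
          inn x = F :|: B & outn y = F :|: B]].

Definition is_H2n (n : nat) (D : digraph) : Prop :=
  2 <= n /\ exists (F B : {set D}) (x y : D), H2n_with n F B x y.

Definition is_H2n' (n : nat) (D : digraph) : Prop :=
  2 <= n /\ exists (D0 : digraph) (F B : {set D0}) (x y : D0),
    H2n_with n F B x y /\ diso D (add_arc y x).

(* Main.v *)
(* Assume that there is no cycle of length p-1. If D is not strong, the vertices reachable from a
   suitable vertex and the remaining ones are two complete parts of p/2 vertices: D is in H(n,n).
   If D is strong, let C = x_0 .. x_(m-1) be a longest cycle of length at most p-2, so that no cycle
   has a length strictly between m and p, and consider the paths through the complement R of C that
   join two distinct vertices of C.

   - If there is none, one vertex of C separates the rest of C from a part of R, and counting degrees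
     gives [(K_n u K_n) + K_1]^*.
   - If such a path joins two consecutive vertices of C, it uses all of R. When |R| >= 3, sumset
     bounds in Z/m for the in- and out-neighbours on C of the ends of the path leave only Q_5^*.
     When |R| = 2, the two words over Z/m recording the neighbours on C of the two vertices of R
     must alternate, which makes D bipartite.
   - Otherwise choose a path that jumps over the least number g >= 1 of vertices of C. Meyniel's
     degree count for an interior vertex of the path and a skipped vertex is an equality, so R and
     the set of skipped vertices are complete of order g, and D is H_2n or H'_2n. *)
Require Import Defs.
From mathcomp Require Import all_boot.
From mathcomp Require Import zify.
Import Defs.

Set Implicit Arguments.
Unset Strict Implicit.
Unset Printing Implicit Defensive.

(** * Cycles as periodic maps *)

(* Boolean hypotheses slow lia down exponentially: it is given the arithmetic ones only. *)
Ltac arith :=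
  repeat match goal with
  | H : ?P |- _ =>
    lazymatch P with
    | is_true (leq _ _) => fail
    | is_true (andb (leq _ _) (leq _ _)) => fail
    | is_true (negb (leq _ _)) => fail
    | is_true (odd _) => fail
    | is_true (negb (odd _)) => fail
    | odd _ = _ => fail
    | leq _ _ = _ => fail
    | is_true (negb (@eq_op _ ?a _)) =>
      tryif (let A := type of a in unify A nat) then fail else clear H
    | is_true (@eq_op _ ?a _) =>
      tryif (let A := type of a in unify A nat) then fail else clear H
    | @eq _ ?a _ => tryif (let A := type of a in unify A nat) then fail else clear H
    | not (@eq nat _ _) => fail
    | or _ _ => fail
    | nat => fail
    | _ => clear H
    end
  end; lia.

(** The obstacle is that cycles of length p are allowed: lengthening C contradicts its choice only
    as long as some vertex stays uncovered. A path with t inner vertices between consecutive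
    vertices of C gives a cycle of length m + t, so t = |R| is forced and a mere comparison of
    lengths says nothing more; hence the separate treatment of such paths. All counts rest on one
    pairing. For u outside C the arcs x_i -> u and u -> x_(i+1) exclude each other, since m + 1 < p.
    So u has at most m arcs with C, and they form a cyclic word with letter 1 at i for the first arc
    and letter 0 for the second, which the degree condition fills almost completely. Forbidden
    detours through several outside vertices become forbidden differences between the in-neighbours
    of one vertex and the out-neighbours of another: if all differences 1 .. t + 1 are forbidden,
    the second set avoids a sumset, which costs t further places of Z/m. These extra units are what
    the degree conditions cannot afford. *)

Section Cycles.
Variables (T : finType) (e : rel T).

Definition has_cyc (l : nat) : Prop := exists2 c : seq T, size c = l & ucycle e c.

(* A cycle of length m is a map nat -> T that factors through an injection of Z/m. *)
Record cyc (m : nat) (x : nat -> T) : Prop := Cyc {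
  cyc_gt0 : 0 < m;
  cyc_per : forall i, x (i + m) = x i;
  cyc_inj : forall i j, x i = x j -> i = j %[mod m];
  cyc_step : forall i, e (x i) (x i.+1) }.

Definition seg (x : nat -> T) (i l : nat) : seq T := map x (iota i l).

Lemma segS x i l : seg x i l.+1 = x i :: seg x i.+1 l.
Proof. by []. Qed.

Lemma seg_size x i l : size (seg x i l) = l.
Proof. by rewrite size_map size_iota. Qed.

Lemma mem_seg x i l v :
  reflect (exists2 j, i <= j < i + l & v = x j) (v \in seg x i l).
Proof.
apply: (iffP mapP) => [[j]|[j jlt ->]]; first by rewrite mem_iota => jlt ->; exists j.
by exists j; rewrite ?mem_iota.
Qed.

Lemma last_seg x i l : last (x i) (seg x i.+1 l) = x (i + l).
Proof.
by elim: l i => [|l IH] i; rewrite ?addn0 // segS /= IH addSnnS.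
Qed.

Section OneCycle.
Variables (m : nat) (x : nat -> T).
Hypothesis cx : cyc m x.

Lemma cyc_mod i : x (i %% m) = x i.
Proof.
rewrite {2}(divn_eq i m) addnC; elim: (i %/ m) => [|q IH]; first by rewrite mul0n addn0.
by rewrite mulSn addnCA addnC (cyc_per cx).
Qed.

Lemma cyc_eq i j : i = j %[mod m] -> x i = x j.
Proof. by rewrite -(cyc_mod i) -(cyc_mod j) => ->. Qed.

Lemma cyc_lt_eq i j : x i = x j -> i <= j -> j < i + m -> i = j.
Proof.
move=> /(cyc_inj cx) eq_mod lij ltj; apply/eqP; rewrite eqn_leq lij /=.
have : (j - i) %% m = 0 by apply/eqP; rewrite -/(m %| _) -eqn_mod_dvd // eq_mod.
by rewrite modn_small; lia.
Qed.

Lemma path_seg i l : path e (x i) (seg x i.+1 l).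
Proof. by elim: l i => [|l IH] i //; rewrite segS /= (cyc_step cx) IH. Qed.

Lemma uniq_seg i l : l <= m -> uniq (seg x i l).
Proof.
move=> llm; rewrite map_inj_in_uniq ?iota_uniq // => a b.
rewrite !mem_iota => /andP[a1 a2] /andP[b1 b2] eqx.
case: (leqP a b) => [lab|lba]; first by apply: cyc_lt_eq => //; lia.
by apply/esym; apply: cyc_lt_eq => //; lia.
Qed.

Lemma cyc_shift s : cyc m (fun i => x (s + i)).
Proof.
split=> [|i|i j|i]; first exact: cyc_gt0 cx.
- by rewrite addnA (cyc_per cx).
- by move/(cyc_inj cx)/eqP; rewrite eqn_modDl => /eqP.
- by rewrite addnS (cyc_step cx).
Qed.

Definition cset : {set T} := [set v in seg x 0 m].

Lemma in_cset i : x i \in cset.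
Proof.
rewrite inE -cyc_mod; apply/mem_seg; exists (i %% m) => //.
by rewrite add0n ltn_mod (cyc_gt0 cx).
Qed.

Lemma csetP v s : reflect (exists2 i, s <= i < s + m & v = x i) (v \in cset).
Proof.
apply: (iffP idP) => [|[i _ ->]]; last exact: in_cset.
rewrite inE => /mem_seg[i /andP[_ lti] ->]; rewrite add0n in lti.
have m0 := cyc_gt0 cx.
exists (s + (i + m - s %% m) %% m); first by rewrite leq_addr ltn_add2l ltn_mod.
apply: cyc_eq; rewrite modnDmr -modnDml addnBA; last by have := ltn_pmod s m0; lia.
by rewrite addKn modnDr.
Qed.

Lemma card_cset : #|cset| = m.
Proof. by rewrite cardsE; move/card_uniqP: (uniq_seg 0 (leqnn m)) => ->; rewrite seg_size. Qed.

Lemma sum_cset (F : T -> nat) s : \sum_(v in cset) F v = \sum_(0 <= i < m) F (x (s + i)).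
Proof.
have eqs : cset =i seg x s m.
  move=> v; apply/(csetP _ s)/mem_seg => [[i ? ->]|[i ? ->]]; by exists i.
rewrite (eq_bigl _ _ eqs) -(big_uniq _ (uniq_seg s (leqnn m))) /seg big_map.
by rewrite -{1}(addn0 s) iotaDl big_map /index_iota subn0.
Qed.

Lemma seg_cat i a b : seg x i a ++ seg x (i + a) b = seg x i (a + b).
Proof. by rewrite /seg -map_cat -iotaD. Qed.

(** The path replaces the c - 1 vertices strictly between x_i and x_(i+c). The value c = m is
    included: the path then leaves and re-enters the cycle at the same vertex. *)
Lemma detour_cyc i c v s :
  0 < c <= m -> uniq (v :: s) -> {in v :: s, forall u, u \notin cset} ->
  e (x i) v -> path e v s -> e (last v s) (x (i + c)) ->
  has_cyc (m - c + (size s).+2).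
Proof.
move=> cm us out ev ps el.
exists (v :: s ++ seg x (i + c) (m - c).+1).
  by rewrite /= size_cat seg_size; lia.
have cm' : c + (m - c) = m by lia.
apply/andP; split.
  by rewrite /= rcons_path cat_path ps /= el path_seg last_cat /= last_seg -addnA cm' (cyc_per cx).
rewrite -cat_cons cat_uniq us uniq_seg ?andbT ?andTb; last lia.
apply/hasPn => u /mem_seg[j _ ->].
by apply: contraL (in_cset j) => /out.
Qed.

Definition swap (i : nat) (u : T) (j : nat) : T := if j %% m == i %% m then u else x j.

Lemma swap_at i u j : j = i %[mod m] -> swap i u j = u.
Proof. by rewrite /swap => ->; rewrite eqxx. Qed.

Lemma swap_off i u j : j %% m != i %% m -> swap i u j = x j.
Proof. by rewrite /swap => /negPf->. Qed.

Lemma swap_cyc i u : 1 < m -> u \notin cset -> e (x i) u -> e u (x i.+2) -> cyc m (swap i.+1 u).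
Proof.
move=> m1 uC eiu eui; split=> [|j|j k|j]; first by lia.
- by rewrite /swap modnDr (cyc_per cx).
- rewrite /swap; case: eqP => [->|nj]; case: eqP => [->|nk] // => eqx.
  + by move: uC; rewrite eqx in_cset.
  + by move: uC; rewrite -eqx in_cset.
  + exact: cyc_inj cx _ _ eqx.
- rewrite /swap; have [ej|nj] := eqVneq (j %% m) (i.+1 %% m).
    have -> : (j.+1 %% m == i.+1 %% m) = false.
      have : j.+1 %% m = (i.+1).+1 %% m by rewrite -addn1 -modnDml ej modnDml addn1.
      move=> ->; apply/negP; rewrite -addn1 -[X in _ == X %[mod _]]addn0 eqn_modDl.
      by rewrite mod0n modn_small.
    suff -> : x j.+1 = x i.+2 by [].
    by apply: cyc_eq; rewrite -addn1 -modnDml ej modnDml addn1.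
  have [ej1|nj1] := eqVneq (j.+1 %% m) (i.+1 %% m); last exact: cyc_step cx _.
  suff -> : x j = x i by [].
  by apply: cyc_eq; apply/eqP; move/eqP: ej1; rewrite -addn1 -[i.+1]addn1 eqn_modDr.
Qed.

End OneCycle.

Lemma has_cyc_cyc m : 0 < m -> has_cyc m -> exists x, cyc m x.
Proof.
move=> m0 [c sc /andP[cc uc]].
case: c => [|a c] in sc cc uc *; first by move: m0; rewrite -sc.
exists (fun i => nth a (a :: c) (i %% m)); split=> [||i j|i] //.
- by move=> i; rewrite modnDr.
- by move/eqP; rewrite nth_uniq ?sc ?ltn_mod // => /eqP.
- have im : i %% m < m by rewrite ltn_mod.
  have : e (nth a (a :: rcons c a) (i %% m)) (nth a (a :: rcons c a) (i %% m).+1).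
    by move/(pathP a): cc; apply; rewrite size_rcons -/(size (a :: c)) sc.
  rewrite -rcons_cons nth_rcons /= -/(nth a (a :: c) _) -/(size (a :: c)) sc im nth_rcons.
  have {}sc : size c = m.-1 by rewrite -sc.
  have -> : i.+1 %% m = (i %% m).+1 %% m by rewrite -[in RHS]addn1 modnDml addn1.
  case: ltnP => [lt|ge]; first by rewrite (modn_small (m := (i %% m).+1)) //; lia.
  have -> : (i %% m).+1 = m by lia.
  by rewrite modnn; have -> : i %% m == size c by lia.
Qed.

End Cycles.

Lemma has_cyc_rev (T : finType) (e : rel T) l :
  has_cyc e l -> has_cyc (fun u v => e v u) l.
Proof.
move=> [c sc /andP[cc uc]]; exists (rev c); first by rewrite size_rev.
by rewrite /ucycle rev_cycle rev_uniq uc andbT.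
Qed.

(** The factor m - 1 stands for -1 modulo m, which avoids truncated subtraction. *)
Lemma cyc_rev (T : finType) (e : rel T) m x :
  cyc e m x -> cyc (fun u v => e v u) m (fun i => x (m.-1 * i)).
Proof.
move=> cx; have m0 := cyc_gt0 cx; split=> // [i|i j|i].
- by apply: (cyc_eq cx); rewrite mulnDr addnC modnMDl.
- move/(cyc_inj cx) => eqm; apply/eqP; rewrite -(eqn_modDl (m.-1 * i)).
  have E k : (m.-1 * k + k) %% m = 0 by rewrite -mulSnr prednK // modnMr.
  by rewrite -[X in _ == X]modnDml eqm modnDml !E.
- have -> : x (m.-1 * i) = x (m.-1 * i.+1).+1; last exact: cyc_step cx _.
  by apply: (cyc_eq cx); rewrite mulnS -addSn prednK // modnDl.
Qed.

(** * Degree sums and sumsets in Z/m *)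

Definition odeg (T : finType) (e : rel T) (u : T) : nat := #|[set v | e u v]|.
Definition adj (T : finType) (e : rel T) (u v : T) : nat := e u v + e v u.

Section Sums.
Variables (T : finType) (e : rel T).

Lemma odeg_sum u : odeg e u = \sum_v e u v.
Proof.
rewrite /odeg -sum1_card big_mkcond; apply: eq_bigr => v _.
by rewrite inE; case: (e u v).
Qed.

Lemma sum_split (A : {set T}) (F : T -> nat) :
  \sum_v F v = \sum_(v in A) F v + \sum_(v in ~: A) F v.
Proof. by rewrite (bigID (mem A)) /=; congr (_ + _); apply: eq_bigl => v; rewrite inE. Qed.

Lemma leq_sum_card (A : {set T}) (F : T -> nat) c :
  (forall v, v \in A -> F v <= c) -> \sum_(v in A) F v <= c * #|A|.
Proof. by move=> H; rewrite mulnC -sum_nat_const; apply: leq_sum. Qed.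

Lemma sum_setD1 (A : {set T}) (F : T -> nat) a :
  a \in A -> \sum_(v in A) F v = F a + \sum_(v in A :\ a) F v.
Proof. exact: big_setD1. Qed.

Lemma sum_card_eq (A : {set T}) (F : T -> nat) c :
  (forall v, v \in A -> F v <= c) -> c * #|A| <= \sum_(v in A) F v ->
  forall v, v \in A -> F v = c.
Proof.
move=> H G v vA; apply/eqP; rewrite eqn_leq H //=.
move: G; rewrite (sum_setD1 _ vA) (cardsD1 v) vA mulnDr muln1.
have : \sum_(v0 in A :\ v) F v0 <= c * #|A :\ v|.
  by apply: leq_sum_card => w; rewrite inE => /andP[_ /H].
lia.
Qed.

End Sums.

Section Periodic.
Variable m : nat.
Implicit Types (f : nat -> nat) (X Y : nat -> bool).

Definition periodic (A : Type) (f : nat -> A) := forall i, f (i + m) = f i.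

Lemma sum_shift1 f : periodic f -> \sum_(0 <= i < m) f i.+1 = \sum_(0 <= i < m) f i.
Proof.
rewrite /periodic; case: m => [|k] pf; first by rewrite !big_geq.
rewrite [RHS]big_nat_recl // addnC [LHS]big_nat_recr //=.
by rewrite -[k.+1]add0n pf.
Qed.

Lemma sum_shift f s : periodic f -> \sum_(0 <= i < m) f (i + s) = \sum_(0 <= i < m) f i.
Proof.
move=> pf; elim: s => [|s <-]; first by apply: eq_bigr => i _; rewrite addn0.
rewrite -[RHS](sum_shift1 (f := fun i => f (i + s))).
  by apply: eq_bigr => i _; rewrite addnS.
by move=> i /=; rewrite addnAC pf.
Qed.

Lemma sum_le f c : (forall i, f i <= c) -> \sum_(0 <= i < m) f i <= c * m.
Proof.
by move=> H; rewrite mulnC -{2}[m]subn0 -sum_nat_const_nat; apply: leq_sum.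
Qed.

Lemma sum_lt f g i0 : 0 < m -> periodic f -> periodic g ->
  (forall i, f i <= g i) -> f i0 < g i0 ->
  \sum_(0 <= i < m) f i < \sum_(0 <= i < m) g i.
Proof.
move=> m0 pf pg le lt.
rewrite -(sum_shift i0 pf) -(sum_shift i0 pg).
rewrite [X in X < _]big_ltn // [X in _ < X]big_ltn // add0n -addSn leq_add //.
exact: leq_sum.
Qed.

Lemma sum_pos f i0 : 0 < m -> periodic f -> 0 < f i0 -> 0 < \sum_(0 <= i < m) f i.
Proof.
move=> m0 pf f0; have := @sum_lt (fun=> 0) f i0 m0 (fun=> erefl) pf (fun=> leq0n _) f0.
by rewrite sum_nat_const_nat muln0.
Qed.

Lemma sum_pos_ex X : 0 < \sum_(0 <= i < m) X i -> exists i, X i.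
Proof.
move=> s0; case: (boolP [exists i : 'I_m, X i]) => [/existsP[i Xi]|]; first by exists i.
rewrite negb_exists => /forallP H; move: s0; rewrite big_mkord big1 // => i _.
by rewrite (negPf (H i)).
Qed.

Lemma sum_tight f c i : 0 < m -> periodic f -> (forall i, f i <= c) ->
  c * m <= \sum_(0 <= i < m) f i -> f i = c.
Proof.
move=> m0 pf le ge; apply/eqP; rewrite eqn_leq le leqNgt; apply/negP => lt.
have := @sum_lt f (fun=> c) i m0 pf (fun=> erefl) le lt.
by rewrite sum_nat_const_nat subn0 mulnC ltnNge ge.
Qed.

Lemma closed_succ X i : 0 < m -> periodic X -> X i -> (forall i, X i -> X i.+1) -> forall j, X j.
Proof.
move=> m0 pX Xi step j.
have H k : X (i + k) by elim: k => [|k IH]; rewrite ?addn0 // addnS step.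
have perk q k : X (k + q * m) = X k.
  by elim: q => [|q IH]; rewrite ?addn0 // mulSn addnCA addnC pX.
by rewrite -(perk i) -(subnK (leq_trans (leq_pmulr i m0) (leq_addl j _))) addnC H.
Qed.

(* Each further shift of X by one enlarges X + [1..t], unless it is already everything. *)
Lemma sumset_bound t X Y : 0 < m -> periodic X -> periodic Y ->
  (exists i, X i) -> (exists i, Y i) ->
  (forall i c, X i -> 0 < c <= t.+1 -> c <= m -> ~~ Y (i + c)) ->
  \sum_(0 <= i < m) X i + \sum_(0 <= i < m) Y i + t <= m.
Proof.
move=> m0 + pY + exY.
elim: t X => [|t IH] X pX exX disj.
  have pYS : periodic (fun i => nat_of_bool (Y i)) by move=> i; rewrite pY.
  rewrite addn0 -(sum_shift1 pYS) -big_split /= -[X in _ <= X]mul1n; apply: sum_le => i.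
  case Xi: (X i) => /=; last exact: leq_b1.
  by have := disj i 1 Xi; rewrite addn1 m0 => /(_ isT isT)/negPf->.
(* X' is the union of X and X + 1. Passing to it gives up one of the t + 1 differences and has to
   gain at least one element. *)
pose X' i := X i || X (i + m.-1).
have pX' : periodic X' by move=> i; rewrite /X' pX addnAC pX.
have XS i : X (i.+1 + m.-1) = X i by rewrite addSnnS prednK // pX.
have exX' : exists i, X' i by case: exX => i Xi; exists i; rewrite /X' Xi.
have disj' i c : X' i -> 0 < c <= t.+1 -> c <= m -> ~~ Y (i + c).
  case/orP=> Xi ct cm; first by apply: disj => //; lia.
  have [ltcm|gecm] := ltnP c m.
    have := disj _ c.+1 Xi; rewrite -addnA addnS -addSn prednK // addnA.
    by rewrite addnAC pY; apply; lia.
  have -> : i + c = i + m.-1 + 1 by lia.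
  by apply: disj => //; lia.
have {IH} := IH X' pX' exX' disj'.
(* If nothing were gained, X would be closed under successor, hence everything, and the difference 1
   would already occur. *)
suff: \sum_(0 <= i < m) X i < \sum_(0 <= i < m) X' i by lia.
have [i nXi] : exists i, ~~ X i && X' i.
  case: (boolP [exists i : 'I_m, ~~ X i && X' i]) => [/existsP[i Xi]|nex]; first by exists i.
  have XmS i : X i -> X i.+1.
    move=> Xi; apply: contraR nex => nXi1; apply/existsP.
    have ltm : i.+1 %% m < m by rewrite ltn_mod.
    exists (Ordinal ltm) => /=.
    have perk q k : X (k + q * m) = X k.
      by elim: q => [|q IHq]; rewrite ?addn0 // mulSn addnCA addnC pX.
    have E k : X (i.+1 %% m + k) = X (i.+1 + k).
      by rewrite {2}(divn_eq i.+1 m) -addnA [in RHS]addnC perk.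
    by rewrite /X' E XS Xi orbT andbT -[i.+1 %% m]addn0 E addn0.
  case: exX => i0 Xi0; case: exY => j Yj.
  have allX := closed_succ m0 pX Xi0 XmS.
  have := disj (j + m.-1) 1 (allX _); rewrite m0 -addnA addn1 prednK // pY Yj.
  by move/(_ isT isT).
case/andP: nXi => /negPf nXi X'i; apply: (@sum_lt _ _ i) => //.
- by move=> k; rewrite pX.
- by move=> k; rewrite pX'.
- by move=> k; rewrite /X'; case: (X k).
- by rewrite nXi X'i.
Qed.

End Periodic.

(** * Inserting a vertex into a path *)

Section Insertion.
Variables (T : finType) (e : rel T).

Definition insertable (u : T) (s : seq T) : Prop :=
  exists s1 a b s2, [/\ s = s1 ++ [:: a, b & s2], e a u & e u b].

(** For consecutive a, b at most one of a -> u and u -> b is present. Only the arc from u to the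
    first vertex and the arc from the last vertex to u escape this pairing. *)
Lemma adj_path_bound u z s : ~ insertable u (z :: s) ->
  \sum_(v <- z :: s) adj e u v <= size s + e u z + e (last z s) u.
Proof.
elim: s z => [|a s IH] z nins; first by rewrite big_seq1 /adj.
have /IH le : ~ insertable u (a :: s).
  by move=> [s1 [b [c [s2 [E ? ?]]]]]; apply: nins; exists (z :: s1), b, c, s2; rewrite E.
have : e z u + e u a <= 1.
  case zu: (e z u); case ua: (e u a) => //.
  by case: nins; exists [::], z, a, s.
rewrite big_cons /=; move: le; rewrite {2}/adj; lia.
Qed.

Lemma insert_path u z s : uniq (z :: s) -> path e z s -> u \notin z :: s ->
  insertable u (z :: s) ->
  exists s', [/\ path e z s', last z s' = last z s, uniq (z :: s') & 
     z :: s' =i [predU1 u & z :: s] /\ size s' = (size s).+1].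
Proof.
move=> us ps unot [s1 [a [b [s2 [E eau eub]]]]].
have [s' E'] : exists s', z :: s' = s1 ++ [:: a, u, b & s2].
  by case: s1 E => [|c s1] [-> _]; eexists.
have Es' : perm_eq (z :: s') (u :: z :: s).
  by rewrite E E'; apply/permP => q; rewrite /= !count_cat /=; lia.
exists s'; split.
- case: s1 E E' => [|c s1] [Ez Es] [_ Es'2]; rewrite Es'2 /=.
    by move: ps; rewrite Es Ez /= eau eub => /andP[].
  move: ps; rewrite Es !cat_path /= => /andP[-> /and3P[-> _ ->]].
  by rewrite eau eub.
- have := congr1 (last z) E; rewrite last_cat /= => ->.
  by have := congr1 (last z) E'; rewrite last_cat /= => ->.
- by rewrite (perm_uniq Es') cons_uniq unot.
- split; last by have := perm_size Es' => /= -[].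
  by move=> v; rewrite (perm_mem Es') !inE.
Qed.

End Insertion.

(** * Dense digraphs: the non-strong case and the cut-vertex case *)

(* One fixed elaboration of #|T|, which lia would otherwise see as several atoms. *)
Definition nverts (T : finType) : nat := #|T|.

Lemma nvertsC (T : finType) (A : {set T}) : #|A| + #|~: A| = nverts T.
Proof. exact: cardsC. Qed.

Definition conv (T : finType) (e : rel T) : rel T := fun u v => e v u.

(** The out- and in-conditions are kept apart, so that reversing all arcs merely exchanges them. *)
Record dense (T : finType) (e : rel T) : Prop := Dense {
  dense_irr : irreflexive e;
  dense_ge5 : 5 <= nverts T;
  dense_deg : forall u, nverts T <= (\sum_v adj e u v).+1;
  dense_out : forall u, nverts T <= 2 * (odeg e u).+1;
  dense_in : forall u, nverts T <= 2 * (odeg (conv e) u).+1 }.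

Lemma adjC (T : finType) (e : rel T) u v : adj e u v = adj e v u.
Proof. by rewrite /adj addnC. Qed.

Lemma adj_conv (T : finType) (e : rel T) u v : adj (conv e) u v = adj e u v.
Proof. by rewrite /adj addnC. Qed.

Lemma adj_le2 (T : finType) (e : rel T) u v : adj e u v <= 2.
Proof. by rewrite /adj; case: (e u v); case: (e v u). Qed.

Lemma adj2 (T : finType) (e : rel T) u v : adj e u v = 2 -> e u v /\ e v u.
Proof. by rewrite /adj; case: (e u v); case: (e v u). Qed.

Lemma adj0 (T : finType) (e : rel T) u v : ~~ e u v -> ~~ e v u -> adj e u v = 0.
Proof. by rewrite /adj => /negPf-> /negPf->. Qed.

Section Dense.
Variables (T : finType) (e : rel T).
Hypothesis de : dense e.

Lemma dense_conv : dense (conv e).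
Proof.
case: de => irr p5 dg od id; split=> // u.
by under eq_bigr do rewrite adj_conv; apply: dg.
Qed.

Lemma adj_irr u : adj e u u = 0.
Proof. by rewrite /adj (dense_irr de). Qed.

Lemma odeg_subset u (A : {set T}) : (forall v, e u v -> v \in A) -> odeg e u <= #|A|.
Proof. by move=> sub; apply: subset_leq_card; apply/subsetP => v; rewrite inE => /sub. Qed.

(** The at most 2|A| arcs between u and A have to supply a degree of p - 1 >= 2|A|, so none may be
    missing. *)
Lemma deg_saturated u (A : {set T}) : (forall v, v \notin A -> adj e u v = 0) ->
  2 * #|A| < nverts T -> nverts T = 2 * #|A| + 1 /\ forall v, v \in A -> e u v /\ e v u.
Proof.
move=> out small; have := dense_deg de u.
rewrite (sum_split A) [X in _ + X]big1 ?addn0; last by move=> v; rewrite inE => /out.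
move=> ge; have le := leq_sum_card (fun v (_ : v \in A) => adj_le2 e u v).
split=> [|v vA]; first arith.
apply: adj2; apply: (sum_card_eq (A := A)) vA => // [w _|]; [exact: adj_le2|arith].
Qed.

End Dense.

Lemma out_saturated (T : finType) (e : rel T) u (A : {set T}) : dense e ->
  (forall v, e u v -> v \in A) -> 2 * #|A| + 2 <= nverts T ->
  nverts T = 2 * #|A| + 2 /\ forall v, v \in A -> e u v.
Proof.
move=> de sub le.
have subA : [set v | e u v] \subset A by apply/subsetP => v; rewrite inE => /sub.
have := dense_out de u; have := subset_leq_card subA; rewrite /odeg => le1 le2.
split=> [|v vA]; first arith.
have : [set v | e u v] == A by rewrite eqEcard subA; arith.
by move/eqP/setP/(_ v); rewrite inE vA => ->.
Qed.

Section Strong.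
Variables (T : finType) (e : rel T).
Hypothesis de : dense e.

(** Out-neighbours of a vertex reachable from [u0] are reachable, and in-neighbours of an
    unreachable vertex are unreachable. By the semidegree bounds each part then has at least p/2
    vertices, and equality leaves no arc missing inside a part. *)
Lemma not_strong_structure u0 v0 : ~~ connect e u0 v0 ->
  exists F : {set T},
  [/\ nverts T = 2 * #|F| /\ #|~: F| = #|F|,
      {in F &, forall u v, u != v -> e u v},
      {in ~: F &, forall u v, u != v -> e u v},
      forall b f, b \notin F -> f \in F -> ~~ e b f
    & (forall f, f \in F -> exists2 b, b \notin F & e f b) /\
      (forall b, b \notin F -> exists2 f, f \in F & e f b)].
Proof.
move=> nc; pose S := [set w | connect e u0 w]; pose F := ~: S.
have irr := dense_irr de; have dc := dense_conv de.
have clS s v : s \in S -> e s v -> v \in S.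
  by rewrite !inE => cs sv; apply: connect_trans cs (connect1 sv).
have outS s v : s \in S -> e s v -> v \in S :\ s.
  move=> sS sv; rewrite !inE -(in_set (connect e u0)) (clS s) // andbT.
  by apply: contraTneq sv => ->; rewrite irr.
have inF f v : f \in F -> conv e f v -> v \in F :\ f.
  move=> fF vf; apply/setD1P; split.
    by apply: contraTneq vf => ->; rewrite /conv irr.
  by move: fF; rewrite ![_ \in F]inE; apply: contra => /clS; apply.
have u0S : u0 \in S by rewrite inE.
have v0F : v0 \in F by rewrite !inE.
have D1 (A : {set T}) a : a \in A -> #|A| = #|A :\ a|.+1 by move=> aA; rewrite (cardsD1 a A) aA.
have tot := nvertsC S; rewrite -/F in tot.
have leS := leq_trans (dense_out de u0) (leq_mul (leqnn 2) (_ : _ <= #|S|)).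
have {leS}leS : nverts T <= 2 * #|S|.
  by apply: leS; rewrite (D1 _ _ u0S) ltnS; apply: odeg_subset => v; apply: outS.
have leF := leq_trans (dense_in de v0) (leq_mul (leqnn 2) (_ : _ <= #|F|)).
have {leF}leF : nverts T <= 2 * #|F|.
  by apply: leF; rewrite (D1 _ _ v0F) ltnS; apply: odeg_subset => v; apply: inF.
have fullS s v : s \in S -> v \in S -> s != v -> e s v.
  move=> sS vS nsv; have [|_] := out_saturated de (fun w => outS s w sS).
    by have := D1 _ _ sS; arith.
  by apply; rewrite in_setD1 eq_sym nsv.
have fullF f v : f \in F -> v \in F -> f != v -> e v f.
  move=> fF vF nfv; have [|_] := out_saturated dc (fun w => inF f w fF).
    by have := D1 _ _ fF; arith.
  by apply; rewrite in_setD1 eq_sym nfv.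
have nSF b f : b \notin F -> f \in F -> ~~ e b f.
  rewrite inE negbK => bS; apply: contraL => bf.
  by rewrite inE negbK (clS _ _ bS bf).
exists F; rewrite [~: F]setCK; split.
- by split; arith.
- by move=> u v uF vF nuv; apply: fullF => //; rewrite eq_sym.
- by move=> u v uS vS; apply: fullS.
- exact: nSF.
(* Inside A the vertex a has degree at most 2(|A| - 1) = p - 2, one short of what is required. *)
have cross (A : {set T}) a : a \in A -> 2 * #|A| = nverts T -> exists2 b, b \notin A & 0 < adj e a b.
  move=> aA eqA; case: (pickP [pred b | (b \notin A) && (0 < adj e a b)]) => [b /andP[? ?]|none].
    by exists b.
  have [v vA||eqA1 _] := deg_saturated de (u := a) (A := A :\ a).
  - have [->|nva] := eqVneq v a; first exact: adj_irr.
    have := none v; rewrite /= in_setD1 nva /= in vA *.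
    by rewrite vA /= lt0n => /negbFE/eqP.
  - by have := D1 _ _ aA; arith.
  - by have := D1 _ _ aA; arith.
split=> [f fF|b]; last rewrite inE negbK => bS.
  have [|b nbF adb] := cross F f fF; first arith.
  exists b => //; move: adb; rewrite /adj (negPf (nSF _ _ nbF fF)) addn0.
  by case: (e f b).
have [|f nfS adb] := cross S b bS; first arith.
have fF : f \in F by rewrite inE.
have nbF : b \notin F by rewrite inE negbK.
exists f => //; move: adb; rewrite /adj (negPf (nSF b f nbF fF)).
by case: (e f b).
Qed.

(** * Walks through the complement of a vertex set *)

Section Exits.
Variable C : {set T}.

(** There is at least one inner vertex; repetitions and a = b are allowed, so that walks can be
    glued freely. [bypass_uniq] makes the inner part simple afterwards. *)
Definition bypass a b := exists v s,
  [/\ all [predC C] (v :: s), e a v, path e v s & e (last v s) b].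

Lemma bypass_uniq a b : bypass a b -> exists v s,
  [/\ all [predC C] (v :: s), uniq (v :: s), e a v, path e v s & e (last v s) b].
Proof.
move=> [v [s [/= /andP[vC sC] av ps sb]]].
case/shortenP: ps sb => s' ps' us' sub sb.
exists v, s'; split=> //=; rewrite vC /=.
by apply/allP => z /sub zs; exact: (allP sC).
Qed.

Lemma bypass_glue a v s w t b : all [predC C] (v :: s) -> all [predC C] (w :: t) ->
  e a v -> path e v s -> e (last v s) w -> path e w t -> e (last w t) b -> bypass a b.
Proof.
move=> as_ at_ av ps sw pt tb; exists v, (s ++ w :: t); split=> //.
- by rewrite -cat_cons all_cat as_ at_.
- by rewrite cat_path ps /= sw.
- by rewrite last_cat.
Qed.

Lemma first_entry v c : v \notin C -> c \in C -> connect e v c ->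
  exists s c', [/\ all [predC C] (v :: s), path e v s, c' \in C & e (last v s) c'].
Proof.
move=> vC cC /connectP[s ps Ec]; elim: s v vC ps Ec => [|w s IH] v vC /=.
  by move=> _ E; move: vC; rewrite -E cC.
case/andP=> vw ps Ec; have [wC|wC] := boolP (w \in C).
  by exists [::], w; rewrite /= vC.
have [s' [c' [al ps' c'C sc']]] := IH w wC ps Ec.
by exists (w :: s'), c'; rewrite /= vC vw; split.
Qed.

Lemma last_exit c v : c \in C -> v \notin C -> connect e c v ->
  exists c' w s, [/\ all [predC C] (w :: s), c' \in C, e c' w, path e w s & last w s = v].
Proof.
move=> cC vC /connectP[s]; case/lastP: s => [_ E|s z0]; first by move: vC; rewrite E cC.
rewrite last_rcons => + E; rewrite -{}E; elim/last_ind: s v vC => [|s z IH] v vC.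
  by rewrite /= andbT => cv; exists c, v, [::]; rewrite /= vC.
rewrite rcons_path last_rcons => /andP[ps zv].
have [zC|zC] := boolP (z \in C); first by exists z, v, [::]; rewrite /= vC.
have [c' [w [t [al c'C cw pt lt]]]] := IH z zC ps.
exists c', w, (rcons t v); split=> //; last by rewrite last_rcons.
  by rewrite -rcons_cons all_rcons al /= vC.
by rewrite rcons_path pt lt.
Qed.
End Exits.

Lemma strong_exit (A : {set T}) u v : connect e u v -> u \in A -> v \notin A ->
  exists a b, [/\ a \in A, b \notin A & e a b].
Proof.
case/connectP=> s; elim: s u => [|w s IH] u /= => [_ -> ->|] // /andP[uw ps] Ev uA vA.
have [wA|wA] := boolP (w \in A); first exact: IH ps Ev wA vA.
by exists u, w.
Qed.

(** Every excursion from C returns to the vertex where it started. Let S be reached from a through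
    the complement: neighbours of S in either direction lie in S or equal a. The degree bound gives
    p <= 2|S| + 1 and the same for the remaining part S', so both are equalities and no arc is
    missing on either side of a. *)
Lemma no_bypass_structure (C : {set T}) : (forall u v, connect e u v) ->
  1 < #|C| -> C != setT ->
  (forall a b, a \in C -> b \in C -> bypass C a b -> a = b) ->
  exists (z : T) (S1 S2 : {set T}),
  [/\ [/\ z |: S1 :|: S2 = setT, z \notin S1, z \notin S2 & [disjoint S1 & S2]],
      nverts T = (2 * #|S1|).+1, nverts T = (2 * #|S2|).+1,
      forall u v, u \in S1 -> v \in S2 -> ~~ e u v && ~~ e v u
    & forall u v, u != v -> (u \in z |: S1) && (v \in z |: S1) ||
                            (u \in z |: S2) && (v \in z |: S2) -> e u v].
Proof.
move=> str C2 CnT nobyp.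
have [c0 c0C] : exists c, c \in C by apply/card_gt0P; arith.
have [r0 r0C] : exists r, r \notin C.
  have /subsetPn[r _ rC] : ~~ (setT \subset C) by rewrite subTset.
  by exists r.
have [a [v0 [aC v0C av0]]] := strong_exit (str c0 r0) c0C r0C.
pose inner := [rel u v | [&& u \notin C, v \notin C & e u v]].
pose S := [set w | (w \notin C) && [exists v, [&& v \notin C, e a v & connect inner v w]]].
have SP w : reflect (exists v s, [/\ all [predC C] (v :: s), e a v, path e v s & last v s = w])
                    (w \in S).
  rewrite inE; apply: (iffP idP) => [/andP[wC /existsP[v /and3P[vC av /connectP[s ps ->]]]]|].
    exists v, s; split=> //=.
      rewrite vC /=; elim: s v vC ps {av wC} => //= u s IH v vC /andP[/and3P[_ uC _] /IH-> //].
      by rewrite uC.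
    by apply: sub_path ps => x y /and3P[].
  move=> [v [s [al av ps <-]]]; have /= -> /= := allP al _ (mem_last v s).
  apply/existsP; exists v; rewrite av; have /= -> /= := allP al _ (mem_head v s).
  apply/connectP; exists s => //; elim: s v al ps {av} => //= z s IH v /and3P[vC zC al] /andP[vz ps].
  by rewrite vC zC vz IH //= zC.
have v0S : v0 \in S by apply/SP; exists v0, [::]; rewrite /= v0C.
have SC w : w \in S -> w \notin C by rewrite inE => /andP[].
have aS : a \notin S by apply: contraL aC => /SC.
have outS s v : s \in S -> e s v -> (v \in S) || (v == a).
  move=> /SP[w [t [al aw pt Es]]] sv; have [vC|vC] := boolP (v \in C).
    by rewrite -(nobyp a v aC vC) ?eqxx ?orbT //; exists w, t; rewrite Es; split.
  apply/orP; left; apply/SP; exists w, (rcons t v); rewrite -rcons_cons all_rcons al /= vC.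
  by rewrite rcons_path pt last_rcons Es.
(* Strong connectivity brings s back to C, necessarily at a. An in-neighbour of s outside C is
   itself reached from C, and the walk continued through s to a shows that it started at a. *)
have inS s v : s \in S -> e v s -> (v \in S) || (v == a).
  move=> sS vs; have [t [c [al pt cC tc]]] := first_entry (SC _ sS) c0C (str s c0).
  have Eac : a = c.
    case/SP: sS => w [t' [al' aw pt' Es]] in al pt tc *.
    apply: nobyp => //; exists w, (t' ++ t); split=> //.
    - by rewrite -cat_cons all_cat al' /=; case/andP: al.
    - by rewrite cat_path pt' Es.
    - by rewrite last_cat Es.
  have [vC|vC] := boolP (v \in C).
    by rewrite Eac -(nobyp v c vC cC) ?eqxx ?orbT //; exists s, t; split.
  have [c' [w [t' [al' c'C cw pt' Ev]]]] := last_exit c0C vC (str c0 v).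
  have Ec' : c' = c.
    by apply: nobyp => //; apply: bypass_glue al' al cw pt' _ pt tc; rewrite Ev.
  by apply/orP; left; apply/SP; exists w, t'; rewrite Eac -Ec'.
pose S' := ~: (a |: S).
have noSS' u v : u \in S -> v \in S' -> ~~ e u v && ~~ e v u.
  move=> uS; rewrite in_setC in_setU1 orbC => vS'; apply/andP.
  by split; apply: contra vS'; [apply: outS | apply: inS].
have cardE : nverts T = (#|S| + #|S'|).+1.
  by rewrite -(nvertsC (a |: S)) cardsU1 aS.
have satur (A B : {set T}) u : u \in A -> a \notin A -> #|A| <= #|B| -> 
    (forall v, v \in B -> adj e u v = 0) -> (nverts T = (#|A| + #|B|).+1) ->
    (forall v, [|| v == a, v \in A | v \in B]) ->
    #|A| = #|B| /\ forall v, v \in (a |: A) :\ u -> e u v /\ e v u.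
  move=> uA aA le0 adjB cT cover.
  have E : #|(a |: A) :\ u| = #|A|.
    have := cardsU1 a A; rewrite aA (cardsD1 u (a |: A)) in_setU1 uA orbT; arith.
  have [v||eT sat] := deg_saturated de (u := u) (A := (a |: A) :\ u).
  - rewrite !inE; have [->|_] := eqVneq v u; first by rewrite (adj_irr de).
    by rewrite /= -[v \in A]/(v \in A); case/or3P: (cover v) => [->|->|/adjB]; rewrite ?orbT.
  - by rewrite E; arith.
  - by split=> //; arith.
have coverS v : [|| v == a, v \in S | v \in S'] by rewrite in_setC in_setU1; case: eqP; case: (v \in S).
have coverS' v : [|| v == a, v \in S' | v \in S] by rewrite in_setC in_setU1; case: eqP; case: (v \in S).
have aS' : a \notin S' by rewrite in_setC negbK setU11.
have [b bS'] : exists b, b \in S'.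
  have [b /setD1P[nba bC]] : exists b, b \in C :\ a.
    by apply/card_gt0P; move: C2; rewrite (cardsD1 a) aC; arith.
  by exists b; rewrite in_setC in_setU1 (negPf nba) /=; apply: contraL bC => /SC.
have adjSS' u v : u \in S -> v \in S' -> adj e u v = 0.
  by move=> uS vS'; case/andP: (noSS' u v uS vS'); apply: adj0.
have adjS'S u v : u \in S' -> v \in S -> adj e u v = 0.
  by move=> uS vS'; rewrite adjC adjSS'.
have le2 (A : {set T}) u : u \in A -> (forall v, v \notin a |: A -> adj e u v = 0) -> nverts T <= (2 * #|A|).+1.
  move=> uA out; have := dense_deg de u.
  rewrite (sum_split ((a |: A) :\ u)) [X in _ + X]big1 ?addn0; last first.
    move=> v; rewrite in_setC in_setD1 negb_and negbK => /orP[/eqP->|/out //].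
    exact: adj_irr.
  have := leq_sum_card (fun v (_ : v \in (a |: A) :\ u) => adj_le2 e u v).
  have := cardsU1 a A; rewrite (cardsD1 u (a |: A)) in_setU1 uA orbT.
  by case: (a \notin A); arith.
have le2S : nverts T <= (2 * #|S|).+1.
  by apply: (le2 _ _ v0S) => v vS; apply: (adjSS' _ _ v0S); rewrite in_setC.
have le2S' : nverts T <= (2 * #|S'|).+1.
  apply: (le2 _ _ bS') => v vS; apply: (adjS'S _ _ bS').
  by move: (coverS' v) vS; rewrite in_setU1 orbA => /orP[->|].
have satS u v : u \in S -> v \in a |: S -> u != v -> e u v /\ e v u.
  move=> uS vS nuv; have [||||_] := satur S S' u uS aS.
  - arith.
  - by move=> w; apply: adjSS'.
  - exact: cardE.
  - exact: coverS.
  by apply; rewrite in_setD1 eq_sym nuv.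
have satS' u v : u \in S' -> v \in a |: S' -> u != v -> e u v /\ e v u.
  move=> uS vS nuv; have [||||_] := satur S' S u uS aS'.
  - arith.
  - by move=> w; apply: adjS'S.
  - by rewrite addnC; exact: cardE.
  - exact: coverS'.
  by apply; rewrite in_setD1 eq_sym nuv.
exists a, S, S'; split=> //; [|arith|arith|].
- split=> //; first exact: setUCr.
  by rewrite disjoint_sym disjoints_subset; apply/subsetP => v; rewrite !in_setC in_setU1 negb_or => /andP[].
move=> u v nuv /orP[] /andP[].
  rewrite in_setU1 => /orP[/eqP Eu|uS] vS; last by case: (satS u v).
  move: (vS); rewrite in_setU1 => /orP[/eqP Ev|vS1]; first by rewrite Eu Ev eqxx in nuv.
  by case: (satS v u); rewrite // ?Eu ?setU11 // eq_sym -Eu.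
rewrite in_setU1 => /orP[/eqP Eu|uS] vS; last by case: (satS' u v).
move: (vS); rewrite in_setU1 => /orP[/eqP Ev|vS1]; first by rewrite Eu Ev eqxx in nuv.
by case: (satS' v u); rewrite // ?Eu ?setU11 // eq_sym -Eu.
Qed.

End Strong.

(** * A path through the complement between consecutive vertices: the pentagon *)

Lemma chord_cyc (T : finType) (e : rel T) m x i c :
  cyc e m x -> 0 < c <= m -> e (x i) (x (i + c)) -> has_cyc e (m - c).+1.
Proof.
move=> cx cm ec; exists (seg x (i + c) (m - c).+1); first by rewrite seg_size.
rewrite /ucycle (uniq_seg cx); last arith.
rewrite andbT segS /= rcons_path (path_seg cx) last_seg.
have -> : i + c + (m - c) = i + m by arith.
by rewrite (cyc_per cx).
Qed.

Record maxcyc (T : finType) (e : rel T) (m : nat) (x : nat -> T) : Prop := MaxCyc {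
  mc_cyc : cyc e m x;
  mc_gt1 : 1 < m;
  mc_le : m.+2 <= nverts T;
  mc_max : forall l, m < l < nverts T -> ~ has_cyc e l }.

Lemma maxcyc_shift (T : finType) (e : rel T) m x s :
  maxcyc e m x -> maxcyc e m (fun i => x (s + i)).
Proof. by case=> cx m1 mr mx; split=> //; apply: cyc_shift. Qed.

Lemma maxcyc_conv (T : finType) (e : rel T) m x :
  maxcyc e m x -> maxcyc (conv e) m (fun i => x (m.-1 * i)).
Proof.
case=> cx m1 mr mx; split=> //; first exact: cyc_rev.
by move=> l /mx nc /has_cyc_rev; apply: nc.
Qed.

Section MaxCycle.
Variables (T : finType) (e : rel T) (m : nat) (x : nat -> T).
Hypotheses (de : dense e) (mc : maxcyc e m x).

Let C := cset m x.
Let cx := mc_cyc mc.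

Lemma cyc_periodic (A : Type) (f : T -> A) : periodic m (fun i => f (x i)).
Proof. by move=> i; rewrite (cyc_per cx). Qed.

Lemma cyc_periodicS (A : Type) (f : T -> A) : periodic m (fun i => f (x i.+1)).
Proof. by move=> i; rewrite -addSn (cyc_per cx). Qed.

Lemma card_out : #|~: C| = nverts T - m.
Proof. by rewrite -(nvertsC C) (card_cset cx) addKn. Qed.

Lemma no_detour i c v s : 0 < c <= m -> uniq (v :: s) -> all [predC C] (v :: s) ->
  e (x i) v -> path e v s -> e (last v s) (x (i + c)) ->
  m < m - c + (size s).+2 < nverts T -> False.
Proof.
move=> cm us /allP out ev ps el /(mc_max mc); apply.
exact: (detour_cyc cx cm us out ev ps el).
Qed.

Lemma word1 u i : u \notin C -> e (x i) u -> e u (x i.+1) -> False.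
Proof.
move=> uC xu ux; have m1 := mc_gt1 mc; have mT := mc_le mc.
by apply: (@no_detour i 1 u [::]); rewrite ?addn1 //= ?uC //; arith.
Qed.

Lemma word_le1 u i : u \notin C -> e (x i) u + e u (x i.+1) <= 1.
Proof.
move=> uC; case xu: (e (x i) u); case ux: (e u (x i.+1)) => //.
by case: (@word1 u i).
Qed.

Lemma sum_adj_cset u :
  \sum_(v in C) adj e u v = \sum_(0 <= i < m) (e (x i) u + e u (x i.+1)).
Proof.
rewrite /C (sum_cset cx _ 0) /adj !big_split /= addnC; congr (_ + _).
exact/esym/sum_shift1/(cyc_periodic (fun v => nat_of_bool (e u v))).
Qed.

Lemma sum_word u : u \notin C -> \sum_(0 <= i < m) (e (x i) u + e u (x i.+1)) <= m.
Proof. by move=> uC; rewrite -[X in _ <= X]mul1n; apply: sum_le => i; apply: word_le1. Qed.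

Lemma adj_out_ge u : u \notin C -> nverts T - m <= (\sum_(v in ~: C) adj e u v).+1.
Proof.
move=> uC; have := dense_deg de u; rewrite (sum_split C) sum_adj_cset.
by have := sum_word uC; arith.
Qed.

Lemma odeg_split u : odeg e u = \sum_(0 <= i < m) e u (x i) + \sum_(v in ~: C) e u v.
Proof. by rewrite odeg_sum (sum_split C) /C (sum_cset cx _ 0). Qed.

Lemma ideg_split u : odeg (conv e) u = \sum_(0 <= i < m) e (x i) u + \sum_(v in ~: C) e v u.
Proof. by rewrite odeg_sum (sum_split C) /C (sum_cset cx _ 0). Qed.

End MaxCycle.

(** * At least three vertices outside the cycle *)

Section LongDetour.
Variables (T : finType) (e : rel T) (m : nat) (x : nat -> T).
Hypotheses (de : dense e) (mc : maxcyc e m x).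
Let C := cset m x.
Let cx := mc_cyc mc.
Let irr := dense_irr de.

(** A chord skipping one or two vertices closes a cycle of length 4 or 3. Only the two cyclic
    neighbours remain, and degree 4 needs both arcs to each. *)
Lemma cyc5_structure y : cyc e 5 y -> nverts T = 5 -> ~ has_cyc e 3 -> ~ has_cyc e 4 ->
  forall i j, e (y i) (y j) = (j == i.+1 %[mod 5]) || (i == j.+1 %[mod 5]).
Proof.
move=> cy T5 n3 n4.
have yT : cset 5 y = setT by apply/eqP; rewrite eqEcard subsetT cardsT -/(nverts T) T5 (card_cset cy).
have arcs i c : c < 5 -> e (y i) (y (i + c)) -> (c == 1) || (c == 4).
  case: c => [|[|[|[|[|c]]]]] // _; first by rewrite addn0 irr.
  - by move/(chord_cyc cy) => H; case: n4; apply: H.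
  - by move/(chord_cyc cy) => H; case: n3; apply: H.
have repr i j : exists2 c, c < 5 & y j = y (i + c).
  have : y j \in cset 5 y by rewrite yT inE.
  case/(csetP cy _ i) => k ki ->; exists (k - i); first arith.
  by congr y; arith.
have sat i : e (y i) (y i.+1) /\ e (y i) (y (i + 4)).
  have [v nv||_ H] := deg_saturated de (u := y i) (A := [set y i.+1; y (i + 4)]).
  - have : v \in cset 5 y by rewrite yT inE.
    case/(csetP cy _ i) => k ki Ev; have Ek : k = i + (k - i) by arith.
    move: nv; rewrite !inE Ev Ek negb_or => /andP[nv1 nv4].
    have lt5 : k - i < 5 by arith.
    apply: adj0; apply/negP => ar.
      by case/orP: (arcs _ _ lt5 ar) => /eqP E; move: nv1 nv4; rewrite E ?addn1 eqxx.
    have [E0|n0] := eqVneq (k - i) 0; first by rewrite E0 addn0 irr in ar.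
    have lt5' : 5 - (k - i) < 5 by arith.
    have Ei : y i = y (i + (k - i) + (5 - (k - i))).
      by rewrite -(cyc_per cy); congr y; arith.
    rewrite Ei in ar; case/orP: (arcs _ _ lt5' ar) => /eqP E.
      have E4 : k - i = 4 by arith.
      by rewrite E4 eqxx in nv4.
    have E1 : k - i = 1 by arith.
    by rewrite E1 addn1 eqxx in nv1.
  - by rewrite cards2 T5; case: (_ != _).
  - by split; [case: (H (y i.+1)) | case: (H (y (i + 4)))]; rewrite ?inE ?eqxx ?orbT.
move=> i j; apply/idP/idP => [|/orP[]/eqP E].
- have [c c5 Ej] := repr i j; rewrite Ej => /(arcs _ _ c5) c14.
  have /eqP Em := cyc_inj cy Ej.
  by case/orP: c14 Em => /eqP->; rewrite -?[i.+1]addn1; arith.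
- by rewrite (cyc_eq cy E); case: (sat i).
- have -> : y j = y (i + 4) by apply: (cyc_eq cy); arith.
  by case: (sat i).
Qed.

(** No detour between x_0 and x_1 may be shorter than the given one, so within R its start v has a
    single out-neighbour and its end w a single in-neighbour. The degrees then provide short ways
    back from w to v, and cycles entering R at w and leaving at v supply the forbidden
    differences. *)
Lemma long_detour_structure v s : 3 <= nverts T - m ->
  uniq (v :: s) -> all [predC C] (v :: s) -> e (x 0) v -> path e v s -> e (last v s) (x 1) ->
  nverts T = 5 /\ exists2 y, cyc e 5 y & 
    forall i j, e (y i) (y j) = (j == i.+1 %[mod 5]) || (i == j.+1 %[mod 5]).
Proof.
move=> r3 us al xv ps sx; have m1 := mc_gt1 mc; have mT := mc_le mc.
have cR : #|~: C| = nverts T - m := card_out mc.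
have LsubR : {subset v :: s <= ~: C} by move=> z /(allP al) zC; rewrite in_setC.
have sz : (size s).+1 = nverts T - m.
  apply/eqP; rewrite -cR eqn_leq; apply/andP; split.
    rewrite -[(size s).+1]/(size (v :: s)) -(card_uniqP us); apply: subset_leq_card; exact/subsetP.
  rewrite leqNgt; apply/negP => lt.
  by apply: (no_detour mc (i := 0) (c := 1) _ us al xv ps sx); arith.
have LR : ~: C =i v :: s.
  move=> z; have /subset_leqif_card/geq_leqif := (introT subsetP LsubR).
  by rewrite (card_uniqP us) /= sz cR leqnn => /esym/subsetP S; apply/idP/idP => [/S|/LsubR].
case: s => [|v2 s] in us al ps sx sz LsubR LR *; first by move: sz => /=; arith.
case/lastP: s => [|s w] in us al ps sx sz LsubR LR *; first by move: sz => /=; arith.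
rewrite /= last_rcons in sx; rewrite /= size_rcons in sz.
have inR z : (z \in ~: C) = (z \in [:: v, v2 & rcons s w]) by rewrite LR.
have notC z : z \in [:: v, v2 & rcons s w] -> z \notin C by rewrite -inR inE.
have vL : v \in [:: v, v2 & rcons s w] by rewrite mem_head.
have v2L : v2 \in [:: v, v2 & rcons s w] by rewrite !inE eqxx orbT.
have wL : w \in [:: v, v2 & rcons s w] by rewrite !inE mem_rcons mem_head !orbT.
have [[vC v2C] wC] := (notC _ vL, notC _ v2L, notC _ wL).
have vR : v \in ~: C by rewrite inE.
have wR : w \in ~: C by rewrite inE.
have v2R : v2 \in ~: C by rewrite inE.
have [nv2 nvw n2w] : [/\ v != v2, v != w & v2 != w].
  move: us; rewrite /= !inE !mem_rcons !inE !negb_or.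
  by case/and3P=> /and3P[-> -> _] /andP[-> _].
have [evv2 ps2] : e v v2 /\ path e v2 (rcons s w) by case/andP: ps.
(* An arc from v to a later vertex skips [v2]; the detour then has fewer than |R| vertices and gives
   a length strictly between m and p. *)
have outv z : z \in ~: C -> e v z -> z = v2.
  rewrite inR 2!inE => /or3P[/eqP->|/eqP->|] //; first by rewrite irr.
  move=> zs evz; exfalso.
  have alz : all [predC C] (rcons s w) by case/and3P: al.
  have ul : uniq (rcons s w) by case/and3P: us.
  have nvl : v \notin rcons s w by move: us; rewrite /= inE negb_or => /andP[/andP[]].
  have szl : size (rcons s w) = (size s).+1 by rewrite size_rcons.
  have ll : last v2 (rcons s w) = w by rewrite last_rcons.
  case/splitPr: zs alz ul nvl szl ll ps2 => s1 s2.
  rewrite all_cat cat_uniq mem_cat cat_path size_cat last_cat /=.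
  move=> /andP[_ /andP[z1 z2]] /and3P[_ _ /andP[u1 u2]] /norP[_ nvz] szl ll /and3P[_ _ p2].
  apply: (no_detour mc (i := 0) (c := 1) (v := v) (s := z :: s2)).
  - arith.
  - by rewrite /= nvz u1.
  - by rewrite /= vC z1.
  - by [].
  - by rewrite /= evz.
  - by rewrite /= ll.
  - by move: szl => /=; arith.
have inw z : z \in ~: C -> e z w -> z = last v2 s.
  rewrite inR -[_ :: _ :: _]/(rcons [:: v, v2 & s] w) mem_rcons inE => /orP[/eqP->|]; first by rewrite irr.
  move=> zs ezw; apply/eqP; apply/negPn/negP => nz.
  have us' : uniq (rcons [:: v, v2 & s] w) by [].
  have al' : all [predC C] (rcons [:: v, v2 & s] w) by [].
  have ps' : path e (x 0) [:: v, v2 & s] by move: ps; rewrite -rcons_cons rcons_path /= xv => /andP[].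
  have szl : size [:: v, v2 & s] = (size s).+2 by [].
  have ll : last (x 0) [:: v, v2 & s] = last v2 s by [].
  case/splitPr: zs us' al' ps' szl ll => s1 s2; rewrite cat_path last_cat size_cat /=.
  case: s2 => [|z2 s2]; first by move=> _ _ _ _ /= E; rewrite E eqxx in nz.
  move=> us' al' /and3P[p1 p1z _] szl _.
  have us1 : uniq (s1 ++ [:: z; w]).
    apply: subseq_uniq us'; rewrite -cats1 -catA; apply: cat_subseq => //.
    apply: (@cat_subseq _ [:: z] [:: w] [:: z] ([:: z2 & s2] ++ [:: w])) => //.
    by rewrite sub1seq mem_cat mem_head orbT.
  have al1 : all [predC C] (s1 ++ [:: z; w]).
    by move: al'; rewrite -cats1 !all_cat /= !andbT => /andP[/and3P[-> -> _] ->].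
  case: s1 => [|v' s1] in us' al' p1 p1z szl us1 al1 *.
    rewrite /= in szl us1 al1.
    by apply: (no_detour mc (i := 0) (c := 1) (v := z) (s := [:: w])); rewrite //= ?ezw //; arith.
  move: p1 p1z us1 al1 szl => /= /andP[xv' p1] p1z us1 al1 szl.
  apply: (no_detour mc (i := 0) (c := 1) (v := v') (s := s1 ++ [:: z; w])) => //.
  - arith.
  - by rewrite cat_path p1 /= p1z ezw.
  - by rewrite last_cat.
  - by rewrite size_cat /=; arith.
have le1 (F : T -> bool) z0 : (forall z, z \in ~: C -> F z -> z = z0) -> \sum_(z in ~: C) F z <= 1.
  move=> H; have [z0R|nz0] := boolP (z0 \in ~: C).
    rewrite (sum_setD1 _ z0R) big1 ?addn0 ?leq_b1 // => z /setD1P[nz zR].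
    by case Fz: (F z) => //; rewrite (H z zR Fz) eqxx in nz.
  by rewrite big1 // => z zR; case Fz: (F z) => //; move: (zR); rewrite (H z zR Fz) (negPf nz0).
have outv1 := le1 _ _ outv; have inw1 := le1 _ _ inw.
have cR2 : #|(~: C :\ v) :\ w| = #|~: C| - 2.
  by rewrite (cardsD1 v (~: C)) vR (cardsD1 w (~: C :\ v)) in_setD1 wR eq_sym nvw; arith.
have sumR2 (F : T -> nat) : \sum_(z in ~: C) F z = F v + F w + \sum_(z in ~: C :\ v :\ w) F z.
  by rewrite (sum_setD1 _ vR) (@sum_setD1 _ (~: C :\ v) _ w) ?addnA // in_setD1 wR eq_sym nvw.
have v2in : v2 \in ~: C :\ v :\ w by rewrite !in_setD1 v2R n2w eq_sym nv2.
have adjv := adj_out_ge de mc vC; have adjw := adj_out_ge de mc wC.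
rewrite /adj big_split /= in adjv; rewrite /adj big_split /= in adjw.
(* Inside R, v has at least |R| - 1 arcs and at most one of them goes out, so at most one other
   vertex of R sends no arc to v. The same holds for the out-arcs of w. If w -> v fails, it is the
   only exception on both sides. *)
have back : e w v \/ e w v2 /\ e v2 v.
  case wv: (e w v); [by left | right; split].
    have : (e w v2 : nat) = 1; last by case: (e w v2).
    apply: (sum_card_eq (F := fun z => e w z) (A := ~: C :\ v :\ w)) v2in => [z _|]; first exact: leq_b1.
    move: adjw; rewrite (sumR2 (fun z => e w z)) wv irr.
    set s1 := \sum_(z in _ :\ _) _; set s2 := \sum_(z in _) _ in inw1 *; arith.
  have : (e v2 v : nat) = 1; last by case: (e v2 v).
  apply: (sum_card_eq (F := fun z => e z v) (A := ~: C :\ v :\ w)) v2in => [z _|]; first exact: leq_b1.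
  move: adjv; rewrite (sumR2 (fun z => e z v)) wv irr.
  set s1 := \sum_(z in _ :\ _) _; set s2 := \sum_(z in _) _ in outv1 *; arith.
have perE u : periodic m (fun i => e (x i) u) := cyc_periodic mc (fun z => e z u).
have perO u : periodic m (fun i => e u (x i)) := cyc_periodic mc (fun z => e u z).
have le_m u : u \notin C -> \sum_(0 <= i < m) e (x i) u + \sum_(0 <= i < m) e u (x i) <= m.
  move=> uC; rewrite -(sum_shift1 (cyc_periodic mc (fun z => nat_of_bool (e u z)))) -big_split /=.
  exact: (sum_word mc uC).
have EA := le_m v vC; have EB := le_m w wC.
have geA' := dense_out de v; rewrite (odeg_split mc) -/C in geA'.
have geB' := dense_in de w; rewrite (ideg_split mc) -/C in geB'.
have T5 := dense_ge5 de.
have exA' : exists i, e v (x i) by apply: (sum_pos_ex (m := m)); arith.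
have exB' : exists i, e (x i) w by apply: (sum_pos_ex (m := m)); arith.
have exA : exists i, e (x i) v by exists 0.
have exB : exists i, e w (x i) by exists 1.
have adjvC := dense_deg de v; rewrite (sum_split C) (sum_adj_cset mc) big_split /= in adjvC.
rewrite (sum_shift1 (cyc_periodic mc (fun z => nat_of_bool (e v z)))) in adjvC.
have adjwC := dense_deg de w; rewrite (sum_split C) (sum_adj_cset mc) big_split /= in adjwC.
rewrite (sum_shift1 (cyc_periodic mc (fun z => nat_of_bool (e w z)))) in adjwC.
(* Entering the bypass at its end w and leaving at its start v gives cycles just longer than m. *)
have direct i c : e w v -> e (x i) w -> 0 < c <= 2 -> c <= m -> ~~ e v (x (i + c)).
  move=> wv xw c2 cm; apply/negP => vx.
  apply: (no_detour mc (i := i) (c := c) (v := w) (s := [:: v])); rewrite //= ?wv ?wC ?vC //; try arith.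
  by rewrite inE eq_sym nvw.
have via2 i c : e w v2 -> e v2 v -> e (x i) w -> 0 < c <= 3 -> c <= m ->
    1 < c \/ 3 < nverts T - m -> ~~ e v (x (i + c)).
  move=> wv2 v2v xw c3 cm c1; apply/negP => vx.
  apply: (no_detour mc (i := i) (c := c) (v := w) (s := [:: v2; v])); rewrite //= ?wv2 ?v2v ?wC ?vC ?v2C //; try arith.
  by rewrite !inE negb_or eq_sym n2w eq_sym nvw eq_sym nv2.
have m0 : 0 < m by arith.
(* For |R| >= 4 both differences 1 and 2 are forbidden, whereas w has at least p/2 - 2 in-arcs from
   C and v at least p/2 - 2 out-arcs to C, together at least p - 4 >= m. *)
have r3' : nverts T - m = 3.
  apply/eqP; rewrite eqn_leq r3 andbT leqNgt; apply/negP => r4.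
  have : \sum_(0 <= i < m) e (x i) w + \sum_(0 <= i < m) e v (x i) + 1 <= m.
    apply: sumset_bound => // i c xw c2 cm.
    by case: back => [wv|[wv2 v2v]]; [apply: direct | apply: via2 => //; arith].
  by arith.
have /nilP s0 : nilp s by move/eqP: sz; rewrite r3' !eqSS.
rewrite {}s0 /= in sz us al ps sx ps2 inw LsubR LR inR notC vL v2L wL *.
have ev2w : e v2 w by case/andP: ps2.
have sumR (F : T -> nat) : \sum_(z in ~: C) F z = F v + F v2 + F w.
  rewrite (eq_bigl _ _ LR) -big_uniq //= big_cons big_cons big_seq1; arith.
have evw : e v w = false by apply/negP => /(outv _ wR) E; rewrite E eqxx in n2w.
rewrite !sumR /adj !irr evv2 ev2w evw in geA' geB' adjvC adjwC.
have forward i c : e (x i) v -> 1 < c <= 3 -> c <= m -> ~~ e w (x (i + c)).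
  move=> xv' c3 cm; apply/negP => wx.
  apply: (no_detour mc (i := i) (c := c) (v := v) (s := [:: v2; w])); rewrite //= ?evv2 ?ev2w //; arith.
have [m2|m3] := leqP m 2.
  have T5' : nverts T = 5 by arith.
  split=> //.
  have [|y cy] := has_cyc_cyc (e := e) (m := 5) isT.
    have := detour_cyc cx (i := 0) (c := 1) (v := v) (s := [:: v2; w]) _ us _ xv ps.
    have -> : m - 1 + (size [:: v2; w]).+2 = 5 by move=> /=; arith.
    by apply; [arith | apply/allP | rewrite add0n].
  exists y => //; apply: cyc5_structure => // H; [apply: (mc_max mc (l := 3)) | apply: (mc_max mc (l := 4))] => //; arith.
(* The degrees of v and w sum to at least 2(p - 1) = 2m + 4. The sumset bounds for the in-arcs of v
   with the out-arcs of w, and for the in-arcs of w with the out-arcs of v, together with the arcs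
   inside R, allow at most 2m + 3 in each of the cases below. *)
exfalso.
have bound1 : \sum_(0 <= i < m) e (x i) v + \sum_(0 <= i < m) e w (x i) + 1 <= m.
  rewrite -(sum_shift1 (cyc_periodic mc (fun z => nat_of_bool (e w z)))) /=.
  apply: sumset_bound => //; [exact: (cyc_periodicS mc (fun z => e w z)) | |].
    by exists 0.
  by move=> i c xv' c2 cm; rewrite -addnS; apply: forward => //; arith.
case wv: (e w v) geA' geB' adjvC adjwC => geA' geB' adjvC adjwC.
  case both: (e w v2 && e v2 v).
    have [wv2 v2v] := andP both.
    have : \sum_(0 <= i < m) e (x i) w + \sum_(0 <= i < m) e v (x i) + 2 <= m.
      apply: sumset_bound => // i c xw c3 cm.
      by have [c1|c1] := leqP c 1; [apply: direct => //; arith | apply: via2 => //; left].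
    by move: adjvC adjwC; rewrite wv2 v2v; arith.
  have : \sum_(0 <= i < m) e (x i) w + \sum_(0 <= i < m) e v (x i) + 1 <= m.
    by apply: sumset_bound => // i c xw c2 cm; apply: direct.
  by case: (e w v2) (e v2 v) both adjvC adjwC => [] [] //= _; arith.
have [wv2 v2v] : e w v2 /\ e v2 v by case: back; rewrite // wv.
have : \sum_(0 <= i < m) e (x i) w + \sum_(0 <= i < m) e v (x i) + 1 <= m.
  rewrite -(sum_shift1 (cyc_periodic mc (fun z => nat_of_bool (e v z)))) /=.
  apply: sumset_bound => //; first exact: (cyc_periodicS mc (fun z => e v z)).
    by case: exA' => i Ai; exists (i + m.-1); rewrite -addnS prednK // (cyc_per cx).
  by move=> i c xw c2 cm; rewrite -addnS; apply: via2 => //; arith.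
by move: adjvC adjwC; rewrite wv2 v2v; arith.
Qed.
End LongDetour.

(** * Two vertices outside the cycle: the bipartite case *)

(** A boolean over finite colourings, so that its negation can be assumed without excluded
    middle. *)
Definition bipartite (T : finType) (e : rel T) : bool :=
  [exists f : {ffun T -> bool}, [forall a, forall b, e a b ==> (f a != f b)]].

Lemma odd_eqmod m i j : ~~ odd m -> i = j %[mod m] -> odd i = odd j.
Proof.
move=> /negPf om E; rewrite (divn_eq i m) (divn_eq j m) E !oddD !oddM om.
by rewrite !andbF.
Qed.

Section TwoOutside.
Variables (T : finType) (e : rel T) (m : nat).
Hypotheses (de : dense e) (Tm : nverts T = m.+2).
Let irr := dense_irr de.

Record outside2 (x : nat -> T) (u v : T) : Prop := Outside2 {
  o2_max : maxcyc e m x;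
  o2_u : u \notin cset m x;
  o2_v : v \notin cset m x;
  o2_uv : u != v }.

Lemma outside2C x u v : outside2 x u v -> outside2 x v u.
Proof. by case=> *; split=> //; rewrite eq_sym. Qed.

Lemma outside2_shift x u v s : outside2 x u v -> outside2 (fun i => x (s + i)) u v.
Proof.
case=> mc uC vC uv; have E : cset m (fun i => x (s + i)) = cset m x.
  apply/setP => z; apply/idP/idP.
    by case/(csetP (cyc_shift (mc_cyc mc) s) z 0) => i _ ->; apply: in_cset (mc_cyc mc) _.
  case/(csetP (mc_cyc mc) z s) => i si ->; rewrite -(subnKC (proj1 (andP si))).
  exact: (in_cset (cyc_shift (mc_cyc mc) s)).
by split; rewrite ?E //; apply: maxcyc_shift.
Qed.

Lemma m_ge3 : 3 <= m.
Proof. by have := dense_ge5 de; arith. Qed.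

Section Words.
Variables (x : nat -> T) (u v : T).
Hypothesis o2 : outside2 x u v.
Let mc := o2_max o2.
Let cx := mc_cyc mc.
Let uC := o2_u o2.
Let vC := o2_v o2.
Let uv := o2_uv o2.

Lemma outs z : [\/ z = u, z = v | exists i, z = x i].
Proof.
have [/(csetP cx _ 0)[i _ ->]|zC] := boolP (z \in cset m x); first by constructor 3; exists i.
have cR : #|~: cset m x| = 2 by rewrite (card_out mc) Tm; arith.
have sub : [set u; v] \subset ~: cset m x.
  by apply/subsetP => w; rewrite in_set2 in_setC => /orP[]/eqP->.
have /eqP E : [set u; v] == ~: cset m x by rewrite eqEcard sub cR cards2 uv.
have : z \in [set u; v] by rewrite E in_setC.
by rewrite !inE => /orP[]/eqP->; [constructor 1 | constructor 2].
Qed.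

Lemma sum_out2 (F : T -> nat) : \sum_(z in ~: cset m x) F z = F u + F v.
Proof.
have uR : u \in ~: cset m x by rewrite in_setC.
have vR : v \in ~: cset m x :\ u by rewrite in_setD1 in_setC eq_sym uv.
rewrite (sum_setD1 _ uR) (sum_setD1 _ vR) big1 ?addn0 // => z.
rewrite !in_setD1 in_setC => /and3P[nv nu nC]; case: (outs z) => [E|E|[i E]].
- by rewrite E eqxx in nu.
- by rewrite E eqxx in nv.
- by rewrite E (in_cset cx) in nC.
Qed.

Lemma uniq_window i (l : seq nat) (c : seq T) : uniq l -> all (fun j => i <= j < i + m) l ->
  perm_eq c [:: u, v & map x l] -> uniq c.
Proof.
move=> ul al pc.
have nmem w : w \notin cset m x -> (w \in map x l) = false.
  by move=> wC; apply/mapP => -[j _ E]; move: wC; rewrite E (in_cset cx).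
rewrite (perm_uniq pc) /= inE (negPf uv) !nmem //= map_inj_in_uniq //.
move=> a b /(allP al) a1 /(allP al) b1 eqx.
case: (leqP a b) => [lab|lba]; first by apply: (cyc_lt_eq cx) => //; arith.
by apply/esym; apply: (cyc_lt_eq cx) => //; arith.
Qed.

Lemma no_cyc_m1 : ~ has_cyc e m.+1.
Proof. by apply: (mc_max mc); rewrite Tm; arith. Qed.

Lemma step i : e (x i) (x i.+1). Proof. exact: cyc_step cx i. Qed.

Lemma x_eq i j : j = i + m -> x j = x i.
Proof. by move=> ->; rewrite (cyc_per cx). Qed.

(* Dropping x_(i+1) and inserting u, v between x_l and x_(l+1) gives a cycle of length m+1. *)
Lemma no_skip i l : e u v -> e (x i) (x i.+2) -> i.+2 <= l -> l.+1 <= i + m ->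
  e (x l) u -> e v (x l.+1) -> False.
Proof.
move=> euv ch il lm xu vx; have m3 := m_ge3; apply: no_cyc_m1.
exists (seg x i.+2 (l - i.+2).+1 ++ [:: u, v & seg x l.+1 (i + m - l.+1).+1]).
  by rewrite size_cat /= !seg_size; arith.
apply/andP; split.
  rewrite segS /= rcons_cat cat_path (path_seg cx) last_seg /= rcons_path (path_seg cx) last_seg.
  have -> : i.+2 + (l - i.+2) = l by arith.
  by rewrite xu euv vx (@x_eq i) //; arith.
apply: (@uniq_window i.+1 (iota i.+2 (l - i.+2).+1 ++ iota l.+1 (i + m - l.+1).+1)).
- rewrite cat_uniq !iota_uniq andbT; apply/hasPn => j; rewrite !mem_iota; arith.
- by apply/allP => j; rewrite mem_cat !mem_iota; arith.
- by rewrite /seg map_cat; set a := map x _; set b := map x _; apply/permP => q; rewrite /= !count_cat /= ?count_cat; arith.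
Qed.

(* The cycle x_(i+c) .. x_(i+m-1) b x_(i+1) .. x_(i+c-2) a x_i misses only x_(i+c-1). *)
Lemma no_parity_chord (a b : T) i c : perm_eq [:: a; b] [:: u; v] -> ~~ odd c -> ~~ odd m ->
  e a (x i) -> e (x (i + c - 2)) a -> e (x (i + m - 1)) b -> e b (x i.+1) ->
  3 < c < m -> e (x i) (x (i + c)) -> False.
Proof.
move=> pab oc om ax xa xb bx cm ch; apply: no_cyc_m1.
exists (seg x (i + c) (m - c.+1).+1 ++ b :: seg x i.+1 (c - 3).+1 ++ [:: a; x i]).
  by rewrite size_cat /= size_cat /= !seg_size; arith.
apply/andP; split.
  rewrite segS /= rcons_cat cat_path (path_seg cx) last_seg /= rcons_cat cat_path.
  rewrite (path_seg cx) last_seg /= ax ch bx.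
  have -> : i + c + (m - c.+1) = i + m - 1 by arith.
  have -> : i.+1 + (c - 3) = i + c - 2 by arith.
  by rewrite xb xa.
apply: (@uniq_window i (iota (i + c) (m - c.+1).+1 ++ iota i.+1 (c - 3).+1 ++ [:: i])).
- rewrite cat_uniq iota_uniq andTb; apply/andP; split.
    by apply/hasPn => j; rewrite mem_cat mem_seq1 !mem_iota; arith.
  by rewrite cat_uniq iota_uniq andTb andbT; apply/hasPn => j; rewrite mem_seq1 !mem_iota; arith.
- by apply/allP => j; rewrite !mem_cat !mem_iota inE; arith.
- rewrite /seg !map_cat; set d := map x _; set f := map x _; apply/permP => q.
  by move/permP/(_ q): pab; rewrite /= !count_cat /= ?count_cat /=; arith.
Qed.

(** All arcs between u and C end in even vertices, those between v and C in odd ones; the colour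
    class of v is v with the even vertices. A chord between vertices of equal parity yields a cycle
    of length m + 1, by [no_skip] at distance 2 and by [no_parity_chord] at larger even
    distances. *)
Lemma alternating_bipartite : e u v -> ~~ odd m ->
  (forall i, if odd i then e (x i) v && e u (x i.+1) else e (x i) u && e v (x i.+1)) ->
  bipartite e.
Proof.
move=> euv om alt; have m3 := m_ge3.
have evn i : ~~ odd i -> [/\ e (x i) u, e v (x i.+1), ~~ e (x i) v & ~~ e u (x i.+1)].
  move=> oi; have := alt i; rewrite (negPf oi) => /andP[xu vx]; split=> //.
    by apply/negP => xv; apply: (word1 mc vC xv).
  by apply/negP; apply: (word1 mc uC xu).
have odd_ i : odd i -> [/\ e (x i) v, e u (x i.+1), ~~ e (x i) u & ~~ e v (x i.+1)].
  move=> oi; have := alt i; rewrite oi => /andP[xu vx]; split=> //.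
    by apply/negP => xv; apply: (word1 mc uC xv).
  by apply/negP; apply: (word1 mc vC xu).
have prev i : exists j, [/\ x i = x j.+1 & odd j = ~~ odd i].
  exists (i + m).-1; split; first by apply/esym/x_eq; arith.
  arith.
have same i c : 0 < c < m -> ~~ odd c -> ~~ e (x i) (x (i + c)).
  move=> cm oc; apply/negP => ch.
  have [c3|c3] := leqP c 3.
    have c2 : c = 2 by move: c cm oc c3 {ch} => [|[|[|[|c]]]].
    rewrite {}c2 addn2 in ch.
    case oi: (odd i).
      by case: (evn i.+3) => [|xu vx _ _]; [rewrite /= oi | apply: (no_skip euv ch _ _ xu vx); arith].
    by case: (evn i.+2) => [|xu vx _ _]; [rewrite /= oi | apply: (no_skip euv ch _ _ xu vx); arith].
  have [j [Ej oj]] := prev i.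
  have oic : odd (i + c - 2) = odd i by arith.
  have oim : odd (i + m - 1) = ~~ odd i by arith.
  case oi: (odd i).
    have [xv ux _ _] := odd_ i oi.
    apply: (@no_parity_chord v u i c) => //; try arith.
    - by rewrite -cat1s perm_catC.
    - by rewrite Ej; case: (evn j) => //; rewrite oj oi.
    - by case: (odd_ (i + c - 2)); rewrite ?oic.
    - by case: (evn (i + m - 1)); rewrite ?oim ?oi.
  have [xu vx _ _] := evn i (negbT oi).
  apply: (@no_parity_chord u v i c) => //; try arith.
  - by rewrite Ej; case: (odd_ j) => //; rewrite oj oi.
  - by case: (evn (i + c - 2)); rewrite ?oic ?oi.
  - by case: (odd_ (i + m - 1)); rewrite ?oim ?oi.
pose f z := (z == v) || [exists i : 'I_m, ~~ odd i && (z == x i)].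
have fx i : f (x i) = ~~ odd i.
  rewrite /f; case: eqP => [E|_] /=; first by move: vC; rewrite -E (in_cset cx).
  apply/existsP/idP => [[j /andP[oj /eqP/(cyc_inj cx)/(odd_eqmod om)->]] //|oi].
  have lt : i %% m < m by rewrite ltn_mod; arith.
  exists (Ordinal lt) => /=; by rewrite (cyc_mod cx) eqxx andbT (odd_eqmod om (modn_mod i m)).
have fu : f u = false.
  rewrite /f (negPf uv) /=; apply/existsP => -[j /andP[_ /eqP E]].
  by move: uC; rewrite E (in_cset cx).
have fv : f v by rewrite /f eqxx.
have u_out j : e u (x j) -> ~~ odd j.
  have [k [Ek ok]] := prev j; rewrite Ek; apply: contraTN => oj.
  by case: (evn k) => //; rewrite ok oj.
have v_out j : e v (x j) -> odd j.
  have [k [Ek ok]] := prev j; rewrite Ek; apply: contraTT => oj.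
  by case: (odd_ k) => //; rewrite ok oj.
have u_in j : e (x j) u -> ~~ odd j by apply: contraTN => /odd_[].
have v_in j : e (x j) v -> odd j by apply: contraTT => /evn[].
apply/existsP; exists [ffun z => f z]; apply/forallP => a; apply/forallP => b.
rewrite !ffunE; apply/implyP.
case: (outs a) => [->|->|[i ->]]; case: (outs b) => [->|->|[j ->]]; rewrite ?fx ?fu ?fv ?irr //=.
- by move/u_out=> ->.
- by move/v_out=> ->.
- by move/u_in=> ->.
- by move/v_in=> ->.
move=> ch; apply/eqP => E.
have : x j \in cset m x by exact: (in_cset cx).
case/(csetP cx _ i) => k ki Ek; have oe : odd k = odd j by rewrite (odd_eqmod om (cyc_inj cx Ek)).
have [E0|n0] := eqVneq (k - i) 0.
  have Eki : k = i by arith.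
  by rewrite Ek Eki irr in ch.
have oki : ~~ odd (k - i).
  rewrite oddB ?oe; last by arith.
  by move/(congr1 negb): E; rewrite !negbK => ->; rewrite addbb.
have ki2 : 0 < k - i < m by arith.
by move: (same i _ ki2 oki); rewrite subnKC; [rewrite -Ek ch | arith].
Qed.

(** Otherwise u, v replace the single vertex x_(i+1), for a cycle of length m + 1. *)
Lemma cross i : e u v -> e (x i) u -> ~~ e v (x i.+2).
Proof.
move=> euv xu; apply/negP => vx; have m3 := m_ge3.
apply: (no_detour mc (i := i) (c := 2) (v := u) (s := [:: v])); rewrite ?addn2 //= ?euv ?uC ?vC ?inE ?uv //.
  by arith.
by rewrite Tm; arith.
Qed.

Lemma sum_word_ge : m.+1 <= \sum_(0 <= i < m) (e (x i) u + e u (x i.+1)) + adj e u v.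
Proof.
have := dense_deg de u; rewrite (sum_split (cset m x)) (sum_adj_cset mc) sum_out2 Tm.
by rewrite (adj_irr de); arith.
Qed.

Lemma in_word_ge : m <= 2 * (\sum_(0 <= i < m) e (x i) u + e v u).
Proof. by have := dense_in de u; rewrite (ideg_split mc) sum_out2 Tm irr; arith. Qed.

Lemma out_word_ge : m <= 2 * (\sum_(0 <= i < m) e u (x i.+1) + e u v).
Proof.
have := dense_out de u; rewrite (odeg_split mc) sum_out2 Tm irr.
rewrite -(sum_shift1 (cyc_periodic mc (fun z => nat_of_bool (e u z)))) /=; arith.
Qed.

Lemma swap_outside i : e (x i) u -> e u (x i.+2) -> outside2 (swap m x i.+1 u) (x i.+1) v.
Proof.
move=> xu ux; have m3 := m_ge3; have m1 : 1 < m by arith.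
have cy := swap_cyc cx m1 uC xu ux.
have notin z : z \notin cset m x \/ z = x i.+1 -> z != u -> z \notin cset m (swap m x i.+1 u).
  move=> zC nzu; apply/negP => /(csetP cy _ 0)[j _ Ez].
  have [E|nE] := eqVneq (j %% m) (i.+1 %% m).
    by rewrite Ez (swap_at _ _ E) eqxx in nzu.
  rewrite (swap_off _ _ nE) in Ez; case: zC => [zC|E].
    by rewrite Ez (in_cset cx) in zC.
  by move: nE; rewrite E in Ez; rewrite (cyc_inj cx Ez) eqxx.
split.
- by case: mc => _ ? ? ?; split.
- apply: notin; first by right.
  by apply: contraNneq uC => <-; exact: (in_cset cx).
- by apply: notin; [left | rewrite eq_sym].
- by apply: contraNneq vC => <-; exact: (in_cset cx).
Qed.

End Words.

(** With a single arc between u and v the degrees leave no empty place in either word. By [cross],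
    shifting the in-neighbours of u by one gives in-neighbours of v. The former number at least m/2;
    the latter at most m/2, because v has at least m/2 out-neighbours on C. *)
Lemma single_words x u v : outside2 x u v -> e u v -> ~~ e v u ->
  [/\ forall i, e u (x i.+1) = ~~ e (x i) u, forall i, e v (x i.+1) = ~~ e (x i) v,
      forall i, e (x i.+1) v = e (x i) u & 2 * \sum_(0 <= i < m) e (x i) u = m].
Proof.
move=> o2 euv nvu; have m3 := m_ge3; have m0 : 0 < m by arith.
have mc := o2_max o2; have cx := mc_cyc mc; have o2' := outside2C o2.
have full w (f := fun i => e (x i) w + e w (x i.+1)) :
    w \notin cset m x -> m <= \sum_(0 <= i < m) f i -> forall i, e w (x i.+1) = ~~ e (x i) w.
  move=> wC ge i; have : f i = 1.
    apply: (sum_tight (m := m)) => //.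
    - by move=> j; rewrite /f -addSn !(cyc_per cx).
    - by move=> j; apply: (word_le1 mc j wC).
    - by rewrite mul1n.
  by rewrite /f; case: (e (x i) w); case: (e w _).
have adjuv : adj e u v = 1 by rewrite /adj euv (negPf nvu).
have wu : forall i, e u (x i.+1) = ~~ e (x i) u.
  by apply: full (o2_u o2) _; have := sum_word_ge o2; rewrite adjuv; arith.
have wv : forall i, e v (x i.+1) = ~~ e (x i) v.
  by apply: full (o2_v o2) _; have := sum_word_ge o2'; rewrite adjC adjuv; arith.
have le i : e (x i) u <= e (x i.+1) v.
  case xu: (e (x i) u) => //; have := cross o2 euv xu.
  by rewrite wv negbK => ->.
have inu := in_word_ge o2; rewrite (negPf nvu) addn0 in inu.
have outv := out_word_ge o2'; rewrite (negPf nvu) addn0 in outv.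
have Ev : \sum_(0 <= i < m) e v (x i.+1) + \sum_(0 <= i < m) e (x i) v = m.
  rewrite -big_split /= -[RHS]subn0 -[RHS]muln1 -sum_nat_const_nat.
  by apply: eq_bigr => i _; rewrite wv; case: (e (x i) v).
rewrite -(sum_shift1 (cyc_periodic mc (fun z => nat_of_bool (e z v)))) /= in Ev.
have lesum : \sum_(0 <= i < m) e (x i) u <= \sum_(0 <= i < m) e (x i.+1) v by apply: leq_sum.
split=> //; last by arith.
move=> i; apply/idP/idP => [xv|xu]; last by have := le i; rewrite xu; case: (e _ v).
apply/negPn/negP => nxu.
have : \sum_(0 <= i < m) e (x i) u < \sum_(0 <= i < m) e (x i.+1) v.
  apply: (@sum_lt _ _ _ i) => //.
  - exact: (cyc_periodic mc (fun z => nat_of_bool (e z u))).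
  - exact: (cyc_periodicS mc (fun z => nat_of_bool (e z v))).
  - by rewrite (negPf nxu) xv.
by arith.
Qed.

(* A pattern 1 1 0 would let u replace x_(i+2), which then has the neighbours of u; this yields the
   chord from x_i to x_(i+2). So the word of u alternates. *)
Lemma single_bipartite x u v : outside2 x u v -> e u v -> ~~ e v u -> bipartite e.
Proof.
move=> o2 euv nvu; have m3 := m_ge3; have m0 : 0 < m by arith.
have mc := o2_max o2; have cx := mc_cyc mc.
have [wu wv uv_ half] := single_words o2 euv nvu.
have om : ~~ odd m by rewrite -half oddM.
pose a i := e (x i) u.
have pera : periodic m a by move=> i; rewrite /a (cyc_per cx).
have no110 i : a i -> a i.+1 -> a i.+2.
  move=> ai ai1; apply/negPn/negP => nai2.
  have ux3 : e u (x i.+3) by rewrite wu.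
  have o2' := swap_outside o2 ai1 ux3.
  have xv : e (x i.+2) v by rewrite uv_.
  have nvx : ~~ e v (x i.+2) by rewrite wv uv_ negbK.
  have [_ _ uv' _] := single_words o2' xv nvx.
  have off j : j < i.+2 -> i.+2 < j + m -> swap m x i.+2 u j = x j.
    move=> ji ij; apply: swap_off; apply/eqP => E.
    by have := cyc_lt_eq cx (cyc_eq cx E) (ltnW ji) ij; arith.
  have ch : e (x i) (x i.+2).
    by have := uv' i; rewrite !off; [rewrite uv_ => <- | arith..].
  (* Where a letter 0 is followed by a letter 1, the pair u, v fits into the cycle, and the chord
     drops x_(i+1). *)
  have rise l : i.+2 <= l -> l.+1 < i + m -> ~~ a l -> a l.+1 -> False.
    move=> il lm nal al1; apply: (no_skip o2 euv ch (l := l.+1)) => //; [arith |].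
    by rewrite wv uv_.
  (* If the letter before i is 1, going back from it to the 0 at i + 2 meets a change from 0 to 1.
     Otherwise the letter at i + 3 is also 0, and the cycle exhibited below misses only x_(i+3). *)
  have [prev|prev] := boolP (a (i + m.-1)).
    have {}prev : a (i.+2 + (m - 3)) by have -> : i.+2 + (m - 3) = i + m.-1 by arith.
    have : m - 3 <= m - 3 by [].
    elim: {1 2}(m - 3) prev => [|k IH] + km; first by rewrite addn0 (negPf nai2).
    rewrite addnS => ak1; have [ak|nak] := boolP (a (i.+2 + k)).
      by apply: IH => //; arith.
    by apply: (rise (i.+2 + k)) => //; arith.
  have [a3|na3] := boolP (a i.+3); first by apply: (rise i.+2) => //; arith.
  apply: (no_cyc_m1 o2).
  exists [:: x i.+2, v, x i.+1, u & seg x i.+4 (m - 4).+1]; first by rewrite /= seg_size; arith.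
  have vx1 : e v (x i.+1).
    rewrite wv; have -> : x i = x (i + m.-1).+1 by rewrite -addnS prednK // (cyc_per cx).
    by rewrite uv_.
  apply/andP; split.
    have xu1 : e (x i.+1) u by [].
    have ux4 : e u (x i.+4) by rewrite wu.
    rewrite segS /= xv vx1 xu1 ux4 /= rcons_path (path_seg cx) last_seg.
    have -> : i.+4 + (m - 4) = i + m by arith.
    by rewrite (cyc_per cx).
  apply: (uniq_window o2 (i := i.+1) (l := [:: i.+2, i.+1 & iota i.+4 (m - 4).+1])).
  - by rewrite !cons_uniq in_cons !mem_iota iota_uniq andbT; arith.
  - by apply/allP => j; rewrite !in_cons mem_iota; arith.
  - by rewrite -/(seg _ _ _) /seg [map _ [:: _, _ & _]]/=; set b := map x _; apply/permP => q /=; arith.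
have sing i : a i -> ~~ a i.+1.
  move=> ai; apply/negP => ai1.
  have all1 : forall j, a j && a j.+1.
    apply: (closed_succ m0 (X := fun j => a j && a j.+1) (i := i)); last first.
    - by move=> j /andP[aj aj1]; rewrite aj1 no110.
    - by rewrite ai.
    - by move=> j; rewrite -addSn !pera.
  move: half; rewrite (eq_bigr (fun=> 1)); last by move=> j _; case/andP: (all1 j); rewrite /a => ->.
  by rewrite sum_nat_const_nat; arith.
have alt i : a i.+1 = ~~ a i.
  have : a i + a i.+1 = 1.
    apply: (sum_tight (m := m) (f := fun i => a i + a i.+1)) => //.
    - by move=> j; rewrite -addSn !pera.
    - by move=> j; have := sing j; case: (a j); case: (a j.+1) => //= /(_ isT).
    - rewrite big_split /= (sum_shift1 (f := fun i => nat_of_bool (a i))); last by move=> j; rewrite pera.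
      by rewrite /a; arith.
  by case: (a i); case: (a _).
have [s as_] : exists s, a s.
  by apply: (sum_pos_ex (m := m)); move: half; rewrite /a; arith.
apply: (alternating_bipartite (outside2_shift s o2)) => // i.
have ai : a (s + i) = ~~ odd i by elim: i => [|i IH]; rewrite ?addn0 // addnS alt IH.
have bi : e (x (s + i)) v = odd i.
  have -> : x (s + i) = x (s + i + m.-1).+1 by rewrite -addnS prednK // (cyc_per cx).
  rewrite uv_ -/(a _) -[LHS]negbK -alt -addnS prednK // pera ai negbK //.
rewrite addnS wu wv -/(a (s + i)) ai bi negbK.
by case: (odd i).
Qed.

End TwoOutside.

Lemma sum_ge_length F a b : (forall i, a <= i < b -> 0 < F i) -> b - a <= \sum_(a <= i < b) F i.
Proof.
move=> H; rewrite -[b - a]muln1 -sum_nat_const_nat big_nat [X in _ <= X]big_nat.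
exact: leq_sum.
Qed.

Lemma two_extra F m j : (forall i, 0 < i < m -> 0 < F i) -> 0 < j -> j.+1 < m ->
  1 < F j -> 1 < F j.+1 -> m < \sum_(0 <= i < m) F i.
Proof.
move=> H j0 jm Fj Fj1; rewrite big_ltn; last by arith.
rewrite (@big_cat_nat _ _ _ j) //=; last by arith.
rewrite (@big_ltn _ _ _ j); last by arith.
rewrite (@big_ltn _ _ _ j.+1) //.
have h1 : j - 1 <= \sum_(1 <= i < j) F i by apply: sum_ge_length => i ij; apply: H; arith.
have h2 : m - j.+2 <= \sum_(j.+2 <= i < m) F i by apply: sum_ge_length => i ij; apply: H; arith.
by arith.
Qed.

(** * Two outside vertices joined both ways *)

Section Double.
Variables (T : finType) (e : rel T) (m : nat).
Hypotheses (de : dense e) (Tm : nverts T = m.+2) (nb : ~~ bipartite e).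
Let irr := dense_irr de.
Let m3 := m_ge3 de Tm.
Let m0 : 0 < m. Proof. by move: m3; arith. Qed.

Notation outside2 := (@outside2 T e m).

Lemma double x u v : outside2 x u v -> e u v /\ e v u.
Proof.
move=> o2; have := sum_word_ge de Tm o2; have := sum_word (o2_max o2) (o2_u o2).
rewrite /adj; case uv: (e u v); case vu: (e v u) => // le ge; last by arith.
  by case/negP: nb; apply: (single_bipartite de Tm o2); rewrite ?uv ?vu.
by case/negP: nb; apply: (single_bipartite de Tm (outside2C o2)); rewrite ?uv ?vu.
Qed.

(* The arcs between w and the cycle form a cyclic word: letter 1 at s if x_s -> w, letter 0 if
   w -> x_(s+1); both together would lengthen the cycle. *)
Definition blank (x : nat -> T) (w : T) (s : nat) := ~~ e (x s) w && ~~ e w (x s.+1).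

Section Words.
Variables (x : nat -> T) (u v : T).
Hypothesis o2 : outside2 x u v.
Let mc := o2_max o2.
Let cx := mc_cyc mc.

Lemma blank_eq w s t : s = t %[mod m] -> blank x w s = blank x w t.
Proof.
move=> E; rewrite /blank (cyc_eq cx E); congr (_ && ~~ e _ _); apply: (cyc_eq cx).
by rewrite -addn1 -modnDml E modnDml addn1.
Qed.

(** Exchanging u with x_(i+1) leaves x_(i+1) and v outside a cycle of the same length, and [double]
    applies to this pair. *)
Lemma swap_double i : e (x i) u -> e u (x i.+2) -> e (x i.+1) v /\ e v (x i.+1).
Proof. by move=> xu ux; apply: double (swap_outside de Tm o2 xu ux). Qed.

Lemma word_ex1 : exists i, e (x i) u.
Proof.
apply: (sum_pos_ex (m := m)); have := dense_in de u.
rewrite (ideg_split mc) (sum_out2 Tm o2) Tm irr; have := leq_b1 (e v u); move: m3; arith.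
Qed.

Lemma word_ex0 : exists i, e u (x i.+1).
Proof.
suff [i ui] : exists i, e u (x i) by exists (i + m.-1); rewrite -addnS prednK // (cyc_per cx).
apply: (sum_pos_ex (m := m)); have := dense_out de u.
rewrite (odeg_split mc) (sum_out2 Tm o2) Tm irr; have := leq_b1 (e u v); move: m3; arith.
Qed.

(** Only two arcs of u avoid the cycle, so its degree m + 1 requires m - 1 letters. *)
Lemma one_blank s t : blank x u s -> blank x u t -> t = s %[mod m].
Proof.
move=> /andP[s1 s2] /andP[t1 t2]; apply/eqP/negPn/negP => nts.
have := sum_word_ge de Tm o2; have [uv vu] := double o2; rewrite /adj uv vu.
set f := fun i => e (x i) u + e u (x i.+1).
pose g i := f i + (i == s %[mod m]).
have perf : periodic m f by move=> i; rewrite /f -addSn !(cyc_per cx).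
have perI : periodic m (fun i => nat_of_bool (i == s %[mod m])) by move=> i; rewrite modnDr.
have perg : periodic m g by move=> i; rewrite /g perf modnDr.
have fs i : i = s %[mod m] -> f i = 0.
  move=> E; have := blank_eq u E; rewrite /blank s1 s2 /f => /andP[/negPf-> /negPf->].
  by [].
have : \sum_(0 <= i < m) g i < \sum_(0 <= i < m) 1.
  apply: (@sum_lt _ _ _ t) => //.
    move=> i; rewrite /g; case: eqP => [/fs-> //|_].
    by rewrite addn0; apply: (word_le1 mc i (o2_u o2)).
  by rewrite /g (negPf nts) /f (negPf t1) (negPf t2).
have : 0 < \sum_(0 <= i < m) (i == s %[mod m]) by apply: (sum_pos (i0 := s) m0 perI); rewrite eqxx.
by rewrite sum_nat_const_nat muln1 subn0 /g /f !big_split /=; arith.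
Qed.

End Words.

(* A blank of u facing a letter of v would force all letters 0 on one side or 1 on the other. *)
Lemma blank_both x u v s : outside2 x u v -> blank x u s -> blank x v s.
Proof.
move=> o2 su; have [uv vu] := double o2; have o2' := outside2C o2.
have mc := o2_max o2; have cx := mc_cyc mc.
have [/negPf su1 /negPf su0] := andP su.
have sE i : blank x u i -> e (x i) v = e (x s) v /\ e v (x i.+1) = e v (x s.+1).
  move=> si; have E := one_blank o2 su si; split; first by rewrite (cyc_eq cx E).
  by congr (e v _); apply: (cyc_eq cx); rewrite -addn1 -modnDml E modnDml addn1.
apply/andP; split; apply/negP => b.
  have nb0 : ~~ e v (x s.+1) by apply/negP; apply: (word1 mc (o2_v o2) b).
  have nstar i : ~~ blank x v i || ~~ blank x u i.
    rewrite -negb_and; apply/negP => /andP[/andP[vi _] ui].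
    by case: (sE i ui) => E _; rewrite E b in vi.
  (* If v has letter 1 at s, the absence of letters 0 from both words passes from each place to the
     next, whereas u has some letter 0. *)
  have clos : forall j, ~~ e u (x j.+1) && ~~ e v (x j.+1).
    apply: (closed_succ m0 (i := s)); last 1 first.
    - move=> i /andP[/negPf na0 /negPf nb0']; have := nstar i; rewrite /blank na0 nb0' !andbT !negbK.
      move=> ab; apply/andP; split; apply/negP => c.
        have nb1 : ~~ e (x i) v by apply: contraTN c; apply: (cross de Tm o2' vu).
        have a1 : e (x i) u by case/orP: ab => // b1; rewrite b1 in nb1.
        by case: (swap_double o2 a1 c) => _; rewrite nb0'.
      have na1 : ~~ e (x i) u by apply: contraTN c; apply: (cross de Tm o2 uv).
      have b1 : e (x i) v by case/orP: ab => // a1; rewrite a1 in na1.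
      by case: (swap_double o2' b1 c) => _; rewrite na0.
    - by move=> i; rewrite -addSn !(cyc_per cx).
    - by rewrite su0 nb0.
  by case: (word_ex0 o2) => i ui; case/andP: (clos i); rewrite ui.
have nb1 : ~~ e (x s) v by apply/negP => b1; exact: (word1 mc (o2_v o2) b1 b).
have clos : forall j, e (x j) u || e (x j) v.
  have [i ui] := word_ex1 o2.
  apply: (closed_succ m0 (i := i)); last 1 first.
  - move=> j /orP[a1|b1]; apply/negPn/negP => /norP[na1 nb1'].
      have nb0 := cross de Tm o2 uv a1.
      have a0 : e u (x j.+2).
        apply/negPn/negP => na0; have sj : blank x u j.+1 by rewrite /blank na1 na0.
        by case: (sE _ sj) => _ E; rewrite E b in nb0.
      by case: (swap_double o2 a1 a0) => E _; rewrite E in nb1'.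
    have na0 := cross de Tm o2' vu b1.
    have sj : blank x u j.+1 by rewrite /blank na1 na0.
    have b0 : e v (x j.+2) by case: (sE _ sj) => _ ->.
    by case: (swap_double o2' b1 b0) => E _; rewrite E in na1.
  - by move=> j; rewrite !(cyc_per cx).
  - by rewrite ui.
by have := clos s; rewrite su1 (negPf nb1).
Qed.

(** Without blanks, [cross] turns a letter 1 of either word into a letter 1 of the other one place
    later. A place with two letters 1 would reproduce itself all around the cycle, so every place
    has exactly one; both words alternate and the digraph is bipartite. *)
Lemma blank_exists x u v : outside2 x u v -> exists s, blank x u s && blank x v s.
Proof.
move=> o2; have [uv vu] := double o2; have o2' := outside2C o2.
have mc := o2_max o2; have cx := mc_cyc mc.
have [/existsP[s /orP[su|sv]]|none] := boolP [exists s : 'I_m, blank x u s || blank x v s].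
- by exists s; rewrite su (blank_both o2 su).
- by exists s; rewrite sv (blank_both o2' sv).
have ns i : ~~ blank x u i && ~~ blank x v i.
  move: none; rewrite negb_exists => /forallP ns.
  have lt : i %% m < m by rewrite ltn_mod.
  have := ns (Ordinal lt); rewrite /= negb_or.
  by rewrite !(blank_eq o2 _ (modn_mod i m)).
have bi w i : ~~ blank x w i -> w \notin cset m x -> e w (x i.+1) = ~~ e (x i) w.
  rewrite /blank negb_and !negbK => /orP[a1|a0] wC.
    by rewrite a1; apply/negP => a0; apply: (word1 mc wC a1 a0).
  by rewrite a0; apply/esym/negP => a1; apply: (word1 mc wC a1 a0).
have ua i : e u (x i.+1) = ~~ e (x i) u by case/andP: (ns i) => nsu _; apply: bi nsu (o2_u o2).
have va i : e v (x i.+1) = ~~ e (x i) v by case/andP: (ns i) => _ nsv; apply: bi nsv (o2_v o2).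
have uv1 i : e (x i) u -> e (x i.+1) v by move=> a1; have := cross de Tm o2 uv a1; rewrite va negbK.
have vu1 i : e (x i) v -> e (x i.+1) u by move=> a1; have := cross de Tm o2' vu a1; rewrite ua negbK.
have some i : e (x i) u || e (x i) v.
  have [k uk] := word_ex1 o2.
  apply: (closed_succ m0 (i := k) (X := fun i => e (x i) u || e (x i) v)).
  - by move=> j; rewrite !(cyc_per cx).
  - by rewrite uk.
  - by move=> j /orP[/uv1->|/vu1->]; rewrite ?orbT.
have notboth i : ~~ (e (x i) u && e (x i) v).
  apply/negP => both; have [k] := word_ex0 o2; rewrite ua; apply/negP; rewrite negbK.
  have := closed_succ m0 (i := i) (X := fun i => e (x i) u && e (x i) v) _ both _ k.
  case/(_ _ _)/andP=> //; first by move=> j; rewrite !(cyc_per cx).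
  by move=> j /andP[/uv1-> /vu1->].
have vE i : e (x i) v = ~~ e (x i) u.
  by have := some i; have := notboth i; case: (e (x i) u); case: (e (x i) v).
have alt i : e (x i.+1) u = ~~ e (x i) u.
  case a1: (e (x i) u); first by have := uv1 i a1; rewrite vE => /negPf->.
  by have := vu1 i; rewrite vE a1 => /(_ isT) ->.
have altk k i : e (x (k + i)) u = odd i (+) e (x k) u.
  elim: i => [|i IH]; first by rewrite addn0.
  by rewrite addnS alt IH /= addNb.
have om : ~~ odd m by have := altk 0 m; rewrite -{1}[0 + m](addn0) addn0 (cyc_per cx); case: (odd m); case: (e _ _).
have [k uk] := word_ex1 o2.
case/negP: nb; apply: (alternating_bipartite de Tm (outside2_shift k o2) uv om) => i.
rewrite addnS ua va vE altk uk.
by case: (odd i).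
Qed.

Section BlankAt0.
Variables (x : nat -> T) (u v : T).
Hypotheses (o2 : outside2 x u v) (su : blank x u 0) (sv : blank x v 0).
Let mc := o2_max o2.
Let cx := mc_cyc mc.
Let xm i : x (i + m) = x i. Proof. exact: cyc_per cx i. Qed.

Lemma binary0 i : 0 < i < m -> e u (x i.+1) = ~~ e (x i) u.
Proof.
move=> im; case a1: (e (x i) u); first by apply/negP => a0; apply: (word1 mc (o2_u o2) a1 a0).
apply/negPn/negP => na0; have si : blank x u i by rewrite /blank a1 na0.
by have := one_blank o2 su si; rewrite mod0n modn_small; arith.
Qed.

Lemma sum_blank0 : (\sum_(0 <= i < m) e (x i) u + \sum_(0 <= i < m) e u (x i.+1)).+1 = m.
Proof.
rewrite -big_split /= big_ltn //; case/andP: su => /negPf-> /negPf->; rewrite add0n.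
rewrite big_nat (eq_bigr (fun=> 1)); last by move=> i im; rewrite binary0 //; case: (e _ u).
by rewrite -big_nat sum_nat_const_nat; move: m3; arith.
Qed.

Lemma count1 : 2 * \sum_(0 <= i < m) e (x i) u <= m.
Proof.
have := out_word_ge de Tm o2; have [-> _] := double o2; have := sum_blank0; arith.
Qed.

Lemma count0 : 2 * \sum_(0 <= i < m) e u (x i.+1) <= m.
Proof.
have := in_word_ge de Tm o2; have [_ ->] := double o2; have := sum_blank0; arith.
Qed.

(* u can replace x_(i+1), whose blank relative to the new cycle must sit where v has its blank. *)
Lemma swap_blank i : 0 < i -> i.+1 < m -> e (x i) u -> ~~ e (x i.+1) u ->
  ~~ e (x 0) (x i.+1) && ~~ e (x i.+1) (x 1).
Proof.
move=> i0 im xu nux.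
have ux : e u (x i.+2) by rewrite binary0 //; arith.
have o2s := swap_outside de Tm o2 xu ux.
have off j : j < i.+1 -> swap m x i.+1 u j = x j.
  move=> ji; apply: swap_off; rewrite !modn_small //; arith.
have s0 : blank (swap m x i.+1 u) v 0.
  by move: sv; rewrite /blank !off.
have := blank_both (outside2C o2s) s0; rewrite /blank !off //.
Qed.

Lemma outdeg_gt1 z : ~ (exists w, forall t, e z t -> t = w).
Proof.
case=> w H; have : odeg e z <= #|[set w]|.
  by apply: odeg_subset => t /H->; rewrite in_set1.
have := dense_out de z; rewrite cards1 Tm; move: m3; arith.
Qed.

Lemma indeg_gt1 z : ~ (exists w, forall t, e t z -> t = w).
Proof.
case=> w H; have : odeg (conv e) z <= #|[set w]|.
  by apply: odeg_subset => t /H->; rewrite in_set1.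
have := dense_in de z; rewrite cards1 Tm; move: m3; arith.
Qed.

End BlankAt0.

Section NoBlank0.
Variables (x : nat -> T) (u v : T).
Hypotheses (o2 : outside2 x u v) (su : blank x u 0) (sv : blank x v 0).
Let o2' := outside2C o2.
Let mc := o2_max o2.
Let cx := mc_cyc mc.
Let uv : e u v. Proof. by case: (double o2). Qed.
Let vu : e v u. Proof. by case: (double o2). Qed.
Let bu i := binary0 o2 su (i := i).
Let bv i := binary0 o2' sv (i := i).

Let skip i l : e (x i) (x i.+2) -> i.+2 <= l -> l.+1 <= i + m ->
  (e (x l) u && e v (x l.+1)) || (e (x l) v && e u (x l.+1)) -> False.
Proof.
by move=> ch il lm /orP[] /andP[a b];
  [apply: (no_skip de Tm o2 uv ch il lm a b) | apply: (no_skip de Tm o2' vu ch il lm a b)].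
Qed.

Let col i : 0 < i < m ->
  (e (x i) u && e v (x i.+1)) || (e (x i) v && e u (x i.+1)) = (e (x i) u (+) e (x i) v).
Proof. by move=> im; rewrite bu // bv //; case: (e _ u); case: (e _ v). Qed.

Let alternates i : 0 < i -> i.+1 < m -> e (x i) u (+) e (x i) v -> e (x i.+1) u (+) e (x i.+1) v ->
  ~~ e (x 0) (x i.+1) && ~~ e (x i.+1) (x 1).
Proof.
move=> i0 im c1 c2.
have im1 : 0 < i.+1 < m by arith.
case a: (e (x i) u) c1 => /= c1.
  have := cross de Tm o2 uv a; rewrite bv // negbK => b.
  by apply: (swap_blank o2 su sv) => //; rewrite b addbT in c2.
have := cross de Tm o2' vu c1; rewrite bu // negbK => b.
by apply: (swap_blank o2' sv su) => //; rewrite b in c2.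
Qed.

Let step11 i : 0 < i -> i.+1 < m -> e (x i) u && e (x i) v -> e (x i.+1) u && e (x i.+1) v.
Proof.
move=> i0 im /andP[a b]; have im1 : 0 < i.+1 < m by arith.
by have := cross de Tm o2 uv a; have := cross de Tm o2' vu b; rewrite bu // bv // !negbK => -> ->.
Qed.

Let step1 i : 0 < i -> i.+1 < m -> e (x i) u || e (x i) v -> e (x i.+1) u || e (x i.+1) v.
Proof.
move=> i0 im; have im1 : 0 < i.+1 < m by arith.
by case/orP=> a; [have := cross de Tm o2 uv a | have := cross de Tm o2' vu a];
  rewrite ?bu // ?bv // negbK => ->; rewrite ?orbT.
Qed.

Let lt1m : 1 < m. Proof. by move: m3; arith. Qed.

(** Column i means the letters of u and v at i. If column 1 had a letter 1, so would all later ones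
    by [cross]. A column 11 before the last is followed by another, which would exceed the m letters
    1 that [count1] allows in both words together; so all columns but possibly the last are mixed.
    With the blank at 0 this leaves x_0 as the only in-neighbour of x_1. *)
Lemma first_column : ~~ (e (x 1) u || e (x 1) v).
Proof.
apply/negP => c1.
have some i : 0 < i < m -> e (x i) u || e (x i) v.
  case: i => // i; elim: i => // i IH im; apply: step1; [by [] | by arith | by apply: IH; arith].
have exact1 j : 0 < j -> j.+1 < m -> e (x j) u (+) e (x j) v.
  move=> j0 jm; have := some j; rewrite j0 (ltnW jm) => /(_ isT).
  have [both|] := boolP (e (x j) u && e (x j) v); last by case: (e _ u); case: (e _ v).
  have := @two_extra (fun i => e (x i) u + e (x i) v) m j _ j0 jm.
  have [b1 b2] := andP both; have [c1' c2'] := andP (step11 j0 jm both).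
  rewrite b1 b2 c1' c2' big_split /= => H.
  have := count1 o2 su; have := count1 o2' sv.
  suff : m < \sum_(0 <= i < m) e (x i) u + \sum_(0 <= i < m) e (x i) v by arith.
  by apply: H => // i im; have := some i im; case: (e _ u); case: (e _ v).
apply: (indeg_gt1 (z := x 1)); exists (x 0) => t et.
case: (outs Tm o2 t) => [E|E|[i0 E]].
- by move: et; rewrite E; case/andP: su => _ /negPf->.
- by move: et; rewrite E; case/andP: sv => _ /negPf->.
have : t \in cset m x by rewrite E; exact: (in_cset cx).
case/(csetP cx _ 0) => i; rewrite add0n leq0n /= => im Et; rewrite Et in et *.
case: i im et {Et} => // -[|i] im et; first by rewrite irr in et.
have [lt|ge] := ltnP i.+3 m.
  have := alternates (i := i.+1) isT im (exact1 i.+1 isT im) (exact1 i.+2 isT lt).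
  by rewrite et andbF.
have Ei : i.+2 = m.-1 by arith.
exfalso; apply: (skip (i := i.+2) (l := m.+1)).
- have E4 : i.+4 = 1 + m by arith.
  have -> : x i.+4 = x 1 by rewrite E4; apply: (cyc_eq cx); rewrite modnDr.
  exact: et.
- by arith.
- by arith.
- have -> : x m.+1 = x 1 by rewrite -(cyc_per cx 1).
  have -> : x m.+2 = x 2 by rewrite -(cyc_per cx 2).
  by rewrite col //; apply: exact1.
Qed.

(** The mirror image: since 11 persists, it occurs nowhere if not at the end, [count0] makes all
    columns from 2 on mixed, and x_1 is left as the only out-neighbour of x_0. *)
Lemma last_column : e (x m.-1) u && e (x m.-1) v.
Proof.
apply/negPn/negP => c1.
have nb11 i : 0 < i < m -> ~~ (e (x i) u && e (x i) v).
  move=> im; apply: contra c1 => both.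
  have : forall k, i + k < m -> e (x (i + k)) u && e (x (i + k)) v.
    elim=> [|k IH] km; first by rewrite addn0.
    rewrite addnS in km *; apply: step11; [by arith | by arith |].
    by apply: IH; arith.
  have Em : i + (m.-1 - i) = m.-1 by arith.
  by move/(_ (m.-1 - i)); rewrite Em; apply; arith.
have exact0 j : 1 < j < m -> e (x j) u (+) e (x j) v.
  move=> jm; have := nb11 j; have -> : 0 < j < m by arith.
  move/(_ isT).
  have [some|] := boolP (e (x j) u || e (x j) v); first by case: (e _ u) some; case: (e _ v).
  case: j jm => // j jm none _.
  have none1 : ~~ (e (x j) u || e (x j) v).
    by apply: contra none; apply: step1; arith.
  have := @two_extra (fun i => e u (x i.+1) + e v (x i.+1)) m j.
  have := nb11 j; rewrite !(negb_or, negb_and).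
  have jm1 : 0 < j < m by arith.
  have jm2 : 0 < j.+1 < m by arith.
  move: none none1; rewrite !negb_or -!bu // -!bv // => /andP[-> ->] /andP[-> ->] _ H.
  have := count0 o2 su; have := count0 o2' sv.
  suff : m < \sum_(0 <= i < m) e u (x i.+1) + \sum_(0 <= i < m) e v (x i.+1) by arith.
  rewrite -big_split /=; apply: H => //; [|by arith..].
  move=> i im; have := nb11 i im; rewrite negb_and -bu // -bv //.
  by case: (e u _); case: (e v _).
apply: (outdeg_gt1 (z := x 0)); exists (x 1) => t et.
case: (outs Tm o2 t) => [E|E|[i0 E]].
- by move: et; rewrite E; case/andP: su => /negPf->.
- by move: et; rewrite E; case/andP: sv => /negPf->.
have : t \in cset m x by rewrite E; exact: (in_cset cx).
case/(csetP cx _ 0) => i; rewrite add0n leq0n /= => im Et; rewrite Et in et *.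
case: i im et {Et} => [|[|[|i]]] im et //; first by rewrite irr in et.
  exfalso; apply: (skip (i := 0) (l := m.-1)) => //; [by arith | by arith |].
  by rewrite col; [apply: exact0; arith | arith].
have c2 : e (x i.+2) u (+) e (x i.+2) v by apply: exact0; arith.
have c3 : e (x i.+3) u (+) e (x i.+3) v by apply: exact0; arith.
by have := alternates (i := i.+2) isT im c2 c3; rewrite et.
Qed.

(** The blank and the last column 11 deprive x_0 of all arcs with u and v, and column l excludes x_0
    -> x_2. Nor can x_0 be inserted into x_2 .. x_(m-1), which closes to a cycle through v and u. So
    x_0 has degree at most m instead of m + 1. *)
Lemma no_blank0 l : 0 < l < m -> e (x l) u -> e v (x l.+1) -> False.
Proof.
move=> lm xl vl.
have /norP[na1 nb1] := first_column; have /andP[am bm] := last_column.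
have l1 : 1 < l.
  case: l lm xl vl => [|[|l]] // _ a _; by rewrite a in na1.
have lm1 : l.+1 < m.
  rewrite ltn_neqAle; apply/andP; split; last by arith.
  apply/eqP => E; have := vl; rewrite bv; last by arith.
  by rewrite -E in bm; rewrite bm.
have [/andP[] nx0u nux1 /andP[nx0v nvx1]] := (su, sv).
have xm0 : x m = x 0 by rewrite -[RHS](cyc_per cx).
have nu0 : ~~ e u (x 0) by rewrite -xm0 -[m in x m]prednK // bu ?am //; arith.
have nv0 : ~~ e v (x 0) by rewrite -xm0 -[m in x m]prednK // bv ?bm //; arith.
have u2 : e u (x 2) by rewrite bu.
have nskip : ~~ e (x 0) (x 2).
  by apply/negP => ch; apply: (skip (i := 0) (l := l)) => //; rewrite ?xl ?vl //; arith.
pose L := seg x 2 (m - 2).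
have EL : L = x 2 :: seg x 3 (m - 3) by rewrite /L; have -> : m - 2 = (m - 3).+1 by arith.
have lastL : last (x 2) (seg x 3 (m - 3)) = x m.-1.
  by rewrite last_seg; congr x; arith.
have nins : ~ insertable e (x 0) L.
  move=> [s1 [a [b [s2 [E ea eb]]]]]; apply: (no_cyc_m1 Tm o2).
  have szL : size L = m - 2 by rewrite seg_size.
  exists (u :: s1 ++ [:: a, x 0, b & s2 ++ [:: v]]).
    by move: szL; rewrite E /= !size_cat /= size_cat /=; arith.
  apply/andP; split.
    have pL : path e u (L ++ [:: v; u]).
      by rewrite EL /= u2 cat_path (path_seg cx) lastL /= bm vu.
    move: pL; rewrite /= E rcons_cat /= rcons_cat -!catA !cat_path /= !cat_path /=.
    by rewrite -!andbA => /and5P[-> -> _ -> /andP[-> ->]]; rewrite ea eb.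
  apply: (uniq_window Tm o2 (i := 0) (l := 0 :: iota 2 (m - 2))).
  - by rewrite cons_uniq mem_iota iota_uniq; arith.
  - by apply/allP => j; rewrite in_cons mem_iota; arith.
  - rewrite map_cons -/(seg x 2 _) -/L E; apply/permP => q; rewrite /= !count_cat /= count_cat /=; arith.
have bound : \sum_(2 <= i < m) adj e (x 0) (x (0 + i)) <= m - 3 + 1.
  have := adj_path_bound (e := e) (u := x 0) (z := x 2) (s := seg x 3 (m - 3)).
  rewrite -EL lastL seg_size (negPf nskip) /L /seg big_map addn0 => /(_ nins) le.
  by apply: leq_trans le _; rewrite leq_add2l leq_b1.
have := dense_deg de (x 0).
rewrite (sum_split (cset m x)) (sum_out2 Tm o2) (sum_cset cx _ 0).
rewrite (adj0 nx0u nu0) (adj0 nx0v nv0) big_ltn // big_ltn // (adj_irr de) Tm.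
have := adj_le2 e (x 0) (x (0 + 1)); move: m3; arith.
Qed.

End NoBlank0.
End Double.

(** A rotation moves the common blank to 0; the given detour then sits at a column l, nonzero
    because x_0 -> u. *)
Lemma gap0_bipartite (T : finType) (e : rel T) m x u v : dense e -> nverts T = m.+2 ->
  outside2 e m x u v -> e (x 0) u -> e v (x 1) -> bipartite e.
Proof.
move=> de Tm o2 xu vx; case: (boolP (bipartite e)) => // nb; exfalso.
have [s /andP[su sv]] := blank_exists de Tm nb o2.
have o2s := outside2_shift s o2.
have cx := mc_cyc (o2_max o2).
have shift0 w : blank e x w s -> blank e (fun i => x (s + i)) w 0.
  by rewrite /blank addn0 addn1.
have m0 := cyc_gt0 cx.
have [l ls E] : exists2 l, l < m & s + l = 0 %[mod m].
  have : x 0 \in cset m x by exact: (in_cset cx).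
  case/(csetP cx _ s) => i si E; exists (i - s); first by arith.
  by rewrite subnKC; [apply/esym/(cyc_inj cx) | arith].
have xl : x (s + l) = x 0 by apply: (cyc_eq cx).
have xl1 : x (s + l.+1) = x 1.
  by apply: (cyc_eq cx); rewrite addnS -addn1 -modnDml E modnDml.
have := no_blank0 de Tm nb o2s (shift0 _ su) (shift0 _ sv) (l := l).
rewrite xl xl1; apply=> //; rewrite ls andbT lt0n; apply/eqP => l0.
by move: su; rewrite /blank -[s]addn0 -l0 xl xu.
Qed.

(** * Paths that skip the least number of vertices *)

Section Routes.
Variables (T : finType) (e : rel T) (C : {set T}).

Definition route_from (a w : T) := exists v s,
  [/\ all [predC C] (v :: s), e a v, path e v s & last v s = w].

Definition route_to (w b : T) := exists s,
  [/\ all [predC C] (w :: s), path e w s & e (last w s) b].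

Lemma route_from1 a w : w \notin C -> e a w -> route_from a w.
Proof. by move=> wC aw; exists w, [::]; rewrite /= wC. Qed.

Lemma route_to1 w b : w \notin C -> e w b -> route_to w b.
Proof. by move=> wC aw; exists [::]; rewrite /= wC. Qed.

Lemma route_fromS a w z : route_from a w -> e w z -> z \notin C -> route_from a z.
Proof.
move=> [v [s [al av ps E]]] wz zC; exists v, (rcons s z); split=> //.
- by rewrite -rcons_cons all_rcons al /= zC.
- by rewrite rcons_path ps E.
- by rewrite last_rcons.
Qed.

Lemma route_toS z w b : z \notin C -> e z w -> route_to w b -> route_to z b.
Proof.
move=> zC zw [s [al ps wb]]; exists (w :: s); split=> //; last by rewrite /= zw.
by rewrite /= zC.
Qed.

Lemma route_bypass a w b : route_from a w -> route_to w b -> bypass e C a b.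
Proof.
move=> [v [s [al av ps E]]] [t [al' pt tb]]; exists v, (s ++ t); split=> //.
- by rewrite -cat_cons all_cat al; case/andP: al'.
- by rewrite cat_path ps E.
- by rewrite last_cat E.
Qed.

Lemma bypass_mid a b : bypass e C a b -> exists2 w, w \notin C & route_from a w /\ route_to w b.
Proof.
move=> [v [s [al av ps sb]]]; have /andP[vC _] := al; exists v => //; split.
  exact: route_from1.
by exists s.
Qed.

(** A decidable form of [bypass], needed for choosing the least jump. *)
Definition bypassb (a b : T) : bool := [exists v, exists w,
  [&& v \notin C, w \notin C, e a v, connect [rel s t | [&& s \notin C, t \notin C & e s t]] v w & e w b]].

Lemma bypassP a b : reflect (bypass e C a b) (bypassb a b).
Proof.
apply: (iffP existsP) => [[v /existsP[w /and5P[vC wC av /connectP[s ps ->] wb]]]|[v [s [al av ps sb]]]].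
  exists v, s; split=> //.
    elim: s v vC ps {av wC wb} => [|u s IH] v vC /=; first by rewrite vC.
    by case/andP=> /and3P[_ uC _] ps; rewrite vC /=; have := IH u uC ps.
  by apply: sub_path ps => z z' /and3P[].
exists v; apply/existsP; exists (last v s).
have /= -> := allP al _ (mem_head v s); have /= -> := allP al _ (mem_last v s).
rewrite av sb andbT /=; apply/connectP; exists s => //.
elim: s v al ps {av sb} => //= u s IH v /and3P[vC uC al] /andP[vu ps].
by rewrite vC uC vu IH //= uC.
Qed.

Definition complete_on (A : {set T}) := {in A &, forall a b, a != b -> e a b}.

Lemma complete_path_enum (A : {set T}) a : complete_on A -> a \in A ->
  exists s, [/\ path e a s, uniq (a :: s) & a :: s =i A].
Proof.
move=> cA aA; have memE z : z \in enum (A :\ a) = (z \in A :\ a) by rewrite mem_enum.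
exists (enum (A :\ a)); split.
- have aux s b : all [in A] (b :: s) -> uniq (b :: s) -> path e b s.
    elim: s b => //= c s IH b /and3P[bA cA_ al] /andP[nbc us].
    rewrite IH //= ?cA_ // andbT; apply: cA => //.
    by move: nbc; rewrite inE negb_or => /andP[].
  apply: aux; last by rewrite /= memE setD11 enum_uniq.
  by rewrite /= aA; apply/allP => z; rewrite memE => /setD1P[].
- by rewrite /= memE setD11 enum_uniq.
- by move=> z; rewrite inE memE in_setD1; case: eqP => [->|].
Qed.

Lemma complete_path (A : {set T}) a b : complete_on A -> a \in A -> b \in A -> a != b ->
  exists s, [/\ path e a s, last a s = b, uniq (a :: s) & a :: s =i A].
Proof.
move=> cA aA bA nab; have cA' : complete_on (A :\ b).
  by move=> z t /setD1P[_ zA] /setD1P[_ tA]; apply: cA.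
have aA' : a \in A :\ b by rewrite in_setD1 nab.
have [s [ps us E]] := complete_path_enum cA' aA'.
have lA : last a s \in A :\ b by rewrite -E mem_last.
exists (rcons s b); split; last 1 first.
- move=> z; rewrite -rcons_cons mem_rcons inE E in_setD1.
  by case: eqP => [->|] //=; rewrite bA.
- by rewrite rcons_path ps; case/setD1P: lA => nl lA; apply: cA.
- by rewrite last_rcons.
- by rewrite -rcons_cons rcons_uniq us E setD11.
Qed.

Lemma maximal_path (A : {set T}) a : a \in A -> exists v s,
  [/\ uniq (v :: s), all [in A] (v :: s), path e v s &
      forall z, z \in A -> e (last v s) z -> z \in v :: s].
Proof.
move=> aA; suff H n : forall v s, uniq (v :: s) -> all [in A] (v :: s) -> path e v s ->
    #|A| <= n + (size s).+1 -> exists v s,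
    [/\ uniq (v :: s), all [in A] (v :: s), path e v s &
      forall z, z \in A -> e (last v s) z -> z \in v :: s].
  by apply: (H #|A| a [::]); rewrite //= ?aA // leq_addr.
elim: n => [|n IH] v s us al ps sz.
  exists v, s; split=> // z zA _.
  have sub : {subset v :: s <= A} by move=> t /(allP al).
  have := subset_leqif_card (introT subsetP sub).
  rewrite (card_uniqP us) /= => /geq_leqif; rewrite sz => /esym/subsetP; exact.
case: (pickP [pred z | [&& z \in A, e (last v s) z & z \notin v :: s]]) => [z /and3P[zA lz zn]|none].
  apply: (IH v (rcons s z)).
  - by rewrite -rcons_cons rcons_uniq zn us.
  - by rewrite -rcons_cons all_rcons al /= zA.
  - by rewrite rcons_path ps lz.
  - by rewrite size_rcons; arith.
exists v, s; split=> // z zA lz; apply/negPn/negP => zn.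
by have := none z; rewrite /= zA lz zn.
Qed.

End Routes.

Lemma bypass_conv (T : finType) (e : rel T) C a b : bypass (conv e) C a b -> bypass e C b a.
Proof.
move=> [v [s [al av ps sb]]]; have := rev_path e v s; rewrite /conv in av ps sb => R.
exists (last v s), (rev (belast v s)); split=> //.
- by rewrite -rev_rcons -lastI all_rev.
- by rewrite R.
- by case: s {al ps R} sb => [|u s] //= _; rewrite rev_cons last_rcons.
Qed.

Lemma cset_conv (T : finType) (e : rel T) m x : cyc e m x ->
  cset m (fun i => x (m.-1 * i)) = cset m x.
Proof.
move=> cx; have cx' := cyc_rev cx; apply/eqP; rewrite eqEcard (card_cset cx) (card_cset cx') leqnn andbT.
by apply/subsetP => z /(csetP cx' _ 0)[i _ ->]; exact: (in_cset cx).
Qed.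

(** * A part of the complement without arcs to the rest of it *)

Section SinkPart.
Variables (T : finType) (e : rel T) (m : nat) (x : nat -> T).
Hypotheses (de : dense e) (mc : maxcyc e m x).
Let C := cset m x.
Let cx := mc_cyc mc.
Hypothesis nogap0 : forall i, ~ bypass e C (x i) (x i.+1).
Variables (W I O : {set T}) (w0 : T).
Hypotheses (WC : {in W, forall z, z \notin C}) (IC : {in I, forall z, z \notin C}).
Hypothesis WI : [disjoint W & I].
Hypothesis card_WIO : #|W| + #|I| + #|O| = nverts T - m.
Hypotheses (cW : complete_on e W) (w0W : w0 \in W).
Hypothesis WtoI : forall w z, w \in W -> z \in I -> e w z.
Hypothesis in_w0 : forall z, e z w0 -> [|| z \in C, z \in W | z \in O].
Hypothesis out_I : forall z t, z \in I -> e z t -> (t \in C) || (t \in I).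
Hypothesis ent : exists i, e (x i) w0.
Hypothesis smallI : 2 * (#|I| + #|W|) <= nverts T.

(* E = in-neighbours of w0 on the cycle, X = out-neighbours of the end of a maximal path of I:
   running through all of W and this path bypasses up to |W| + |path| - 1 vertices, so X avoids
   E + [1 .. |W| + |path|]. *)
Lemma sink_part_empty : I = set0.
Proof.
apply/eqP/set0Pn => -[z0 z0I]; have irr := dense_irr de; have mT := mc_le mc.
have m0 : 0 < m := cyc_gt0 cx.
have [v [s [us al ps mx]]] := maximal_path e z0I.
have [t [pt ut Et]] := complete_path_enum cW w0W.
have szs : (size s).+1 <= #|I|.
  rewrite -[(size s).+1]/(size (v :: s)) -(card_uniqP us); apply/subset_leq_card/subsetP.
  by move=> z /(allP al).
have szt : (size t).+1 = #|W| by rewrite -[(size t).+1]/(size (w0 :: t)) -(card_uniqP ut); apply: eq_card.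
have vI : v \in I by case/andP: al.
have ltW : last w0 t \in W by rewrite -Et mem_last.
have lsI : last v s \in I by apply: (allP al); rewrite mem_last.
pose E i := e (x i) w0; pose X i := e (last v s) (x i).
(* The path cannot be extended in I, so the out-neighbours of its end outside C lie on the path. *)
have outX : odeg e (last v s) <= \sum_(0 <= i < m) X i + size s.
  rewrite (odeg_split mc) leq_add2l -/C -[size s]/(size (v :: s)).-1.
  rewrite -(card_uniqP us) (cardD1 (last v s)) mem_last /= -sum1_card big_mkcond [X in _ <= X]big_mkcond.
  apply: leq_sum => z _; rewrite in_setC [z \in predD1 _ _]inE /=.
  case lz: (e _ z); last by case: ifP.
  case zC: (z \in C) => //=; have := out_I lsI lz; rewrite zC /= => zI.
  have := mx z zI lz; rewrite inE => ->; rewrite andbT.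
  by case: eqP => // Ez; rewrite Ez irr in lz.
have inE_ : odeg (conv e) w0 <= \sum_(0 <= i < m) E i + (#|W| + #|O|).-1.
  rewrite (ideg_split mc) leq_add2l -/C.
  have -> : (#|W| + #|O|).-1 = #|W :\ w0| + #|O| by rewrite (cardsD1 w0 W) w0W.
  apply: leq_trans (leq_card_setU _ _); rewrite -sum1_card big_mkcond [X in _ <= X]big_mkcond.
  apply: leq_sum => z _; rewrite in_setC in_setU in_setD1; case zw: (e z _); last by case: ifP.
  case zC: (z \in C) => /=; first by []. 
  have := in_w0 zw; rewrite zC /=.
  by case: eqP => [Ez|_ ->] //; rewrite Ez irr in zw.
have := dense_out de (last v s); have := dense_in de w0.
(* [smallI] leaves an out-neighbour on the cycle; [sumset_bound] requires both sets to be
   nonempty. *)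
have exX : exists i, X i by apply: (sum_pos_ex (m := m)); have := dense_out de (last v s); arith.
have W0 : 0 < #|W| by apply/card_gt0P; exists w0.
have sz : size (t ++ v :: s) = #|W| + size s by rewrite size_cat /= addnS -addSn szt.
have allC : all [predC C] (w0 :: t ++ v :: s).
  rewrite -cat_cons all_cat; apply/andP; split; apply/allP => z.
    by rewrite Et => /WC.
  by move/(allP al) => /IC.
have uWI : uniq (w0 :: t ++ v :: s).
  rewrite -cat_cons cat_uniq ut us andbT; apply/hasPn => z /(allP al) /= zI.
  by rewrite Et; move/disjointFl: WI => ->.
have pWI : path e w0 (t ++ v :: s) by rewrite cat_path pt /= WtoI.
have bound : \sum_(0 <= i < m) E i + \sum_(0 <= i < m) X i + (#|W| + size s) <= m.
  apply: sumset_bound => //.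
  - exact: (cyc_periodic mc (fun z => e z w0)).
  - exact: (cyc_periodic mc (fun z => e (last v s) z)).
  move=> i c Ei cWs cm; apply/negP => Xc.
  have lWI : e (last w0 (t ++ v :: s)) (x (i + c)) by rewrite last_cat.
  (* For c = 1 the cycle might have length p, which is no contradiction; [nogap0] excludes this
     difference instead. *)
  have [c1|c1] := leqP c 1.
    have Ec : c = 1 by arith.
    by apply: (@nogap0 i); exists w0, (t ++ v :: s); split=> //; rewrite -addn1 -Ec.
  by apply: (no_detour mc (i := i) (c := c) _ uWI allC Ei pWI lWI); [arith | rewrite sz; arith].
(* Inserting both degree bounds leaves p - m <= |O| + 1, but W and I contribute at least 2 to |W| +
   |I| + |O| = p - m. *)
by arith.
Qed.
End SinkPart.

Lemma sum_exact1 F a b i : (forall j, a <= j < b -> F j <= 1) -> b - a <= \sum_(a <= j < b) F j ->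
  a <= i < b -> F i = 1.
Proof.
move=> le ge iab; apply/eqP; rewrite eqn_leq le //= lt0n; apply/eqP => Fi.
have lel c d : a <= c -> d <= b -> \sum_(c <= j < d) F j <= d - c.
  move=> ac db; rewrite -[d - c]muln1 -sum_nat_const_nat big_nat [X in _ <= X]big_nat.
  by apply: leq_sum => j jcd; apply: le; arith.
move: ge; rewrite (@big_cat_nat _ _ _ i) /=; [|by arith..].
rewrite (@big_ltn _ _ _ i) ?Fi; last by arith.
have := lel a i (leqnn a); have := lel i.+1 b; arith.
Qed.

(** * Meyniel's count for a path with the least jump *)

Section Gap.
Variables (T : finType) (e : rel T) (m : nat) (x : nat -> T) (k g : nat).
Hypotheses (de : dense e) (mc : maxcyc e m x).
Let C := cset m x.
Let cx := mc_cyc mc.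
Let irr := dense_irr de.
Hypotheses (mkg : m = k + g) (k2 : 2 <= k) (g1 : 1 <= g).
(* g is the least number of cycle vertices that a path through the complement jumps over. *)
Hypothesis no_small : forall i c, 0 < c <= g -> ~ bypass e C (x i) (x (i + c)).
Hypothesis byp : bypass e C (x k.-1) (x m).

Let p := nverts T.
Let r := p - m.
Let pm : m.+2 <= p. Proof. exact: mc_le mc. Qed.
Let xm : x m = x 0. Proof. by rewrite -(cyc_per cx 0). Qed.
Let xC i : x i \in C. Proof. exact: (in_cset cx). Qed.
Let cR : #|~: C| = r. Proof. exact: card_out mc. Qed.

Lemma no_small_route i j w : i < j <= i + g -> route_from e C (x i) w -> route_to e C w (x j) -> False.
Proof.
move=> ij rf rt; apply: (@no_small i (j - i)); first by arith.
rewrite subnKC; last by arith.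
exact: route_bypass rf rt.
Qed.

(** The degree of u is split over the kept vertices x_0 .. x_(k-1), the skipped ones x_k .. x_(m-1)
    and the complement of C. *)
Let ZS u := \sum_(0 <= i < k) adj e u (x i).
Let YS u := \sum_(k <= i < m) adj e u (x i).
Let RS u := \sum_(z in ~: C) adj e u z.

Lemma deg_ZYR u : p <= (ZS u + YS u + RS u).+1.
Proof.
have := dense_deg de u; rewrite (sum_split C) /C (sum_cset cx _ 0).
by rewrite (@big_cat_nat _ _ _ k) //; rewrite mkg leq_addr.
Qed.

Lemma ZS_split u : ZS u = e u (x 0) + e (x k.-1) u + \sum_(0 <= i < k.-1) (e (x i) u + e u (x i.+1)).
Proof.
have kE : k = k.-1.+1 by arith.
rewrite /ZS /adj !big_split /= {1}kE [in X in X + _]big_nat_recl // {2}kE [in X in _ + X]big_nat_recr //=.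
by set a := \sum_(_ <= _ < _) _; set b := \sum_(_ <= _ < _) _; arith.
Qed.

Lemma ZS_le u : (forall i, i < k.-1 -> e (x i) u + e u (x i.+1) <= 1) ->
  ZS u <= e u (x 0) + e (x k.-1) u + k.-1.
Proof.
move=> H; rewrite ZS_split leq_add2l -[X in _ <= X]subn0 -[X in _ <= X]muln1 -sum_nat_const_nat.
by rewrite big_nat [X in _ <= X]big_nat; apply: leq_sum => i /H.
Qed.

Lemma ZS_exact u : (forall i, i < k.-1 -> e (x i) u + e u (x i.+1) <= 1) -> k < ZS u ->
  [/\ e u (x 0), e (x k.-1) u & forall i, i < k.-1 -> e u (x i.+1) = ~~ e (x i) u].
Proof.
move=> H big; have := ZS_le H; have := leq_b1 (e u (x 0)); have := leq_b1 (e (x k.-1) u).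
move=> b1 b2 le; have [u0 k0] : e u (x 0) /\ e (x k.-1) u.
  by move: le; case: (e u (x 0)); case: (e (x k.-1) u) => //=; arith.
split=> // i ik; have : e (x i) u + e u (x i.+1) = 1.
  apply: (sum_exact1 (F := fun i => e (x i) u + e u (x i.+1)) (a := 0) (b := k.-1)) => //.
  by move: big; rewrite ZS_split u0 k0; arith.
by case: (e _ _); case: (e _ _).
Qed.

(** The count applies to inner vertices of a least jump only; [outside_mid] shows eventually that
    every outside vertex is one. *)
Definition mid w := [/\ w \notin C, route_from e C (x k.-1) w & route_to e C w (x m)].

Lemma word_out u i : u \notin C -> e (x i) u + e u (x i.+1) <= 1.
Proof. exact: word_le1. Qed.

Lemma mid_nonadj w j : mid w -> k <= j < m -> adj e (x j) w = 0.
Proof.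
move=> [wC rf rt] jm; apply: adj0; apply/negP => a.
  by apply: (@no_small_route j m w) => //; [arith | exact: route_from1].
by apply: (@no_small_route k.-1 j w) => //; [arith | exact: route_to1].
Qed.

Lemma mid_in w j z : mid w -> k <= j < m -> z \notin C -> e (x j) z + e z w <= 1.
Proof.
move=> [wC rf rt] jm zC; case a: (e (x j) z); case b: (e z w) => //; exfalso.
apply: (@no_small_route j m z); [arith | exact: route_from1 | exact: route_toS b rt].
Qed.

Lemma mid_out w j z : mid w -> k <= j < m -> z \notin C -> e w z + e z (x j) <= 1.
Proof.
move=> [wC rf rt] jm zC; case a: (e w z); case b: (e z (x j)) => //; exfalso.
apply: (@no_small_route k.-1 j z); [arith | exact: route_fromS rf a zC | exact: route_to1].
Qed.

(** A path x_j -> z -> w or w -> z -> x_j would allow a jump over fewer than g vertices, so each z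
    adds at most 2 to both degrees together. *)
Lemma RS_pair_le w j : mid w -> k <= j < m -> RS w + RS (x j) <= 2 * r.-1.
Proof.
move=> mw jm; have [wC _ _] := mw; have wR : w \in ~: C by rewrite in_setC.
rewrite /RS -big_split /= (sum_setD1 _ wR) (adj_irr de) (mid_nonadj mw jm) !add0n.
have -> : r.-1 = #|~: C :\ w| by move: cR; rewrite (cardsD1 w (~: C)) wR; arith.
apply: leq_sum_card => z /setD1P[_]; rewrite in_setC => zC.
by have := mid_in mw jm zC; have := mid_out mw jm zC; rewrite /adj; arith.
Qed.

Lemma mid_YS w : mid w -> YS w = 0.
Proof.
by move=> mw; rewrite /YS big_nat big1 // => j jm; rewrite adjC (mid_nonadj mw jm).
Qed.

Lemma mid_ZS_le w : mid w -> ZS w <= k.+1.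
Proof.
move=> [wC _ _]; have := ZS_le (fun i _ => word_out i wC).
have := leq_b1 (e w (x 0)); have := leq_b1 (e (x k.-1) w); arith.
Qed.

(* Paths from x_0 to x_(k-1) along the cycle with n of the skipped vertices inserted. *)
Definition inserted n s := [/\ path e (x 0) s, last (x 0) s = x k.-1, uniq (x 0 :: s),
  {subset x 0 :: s <= C} & size s = (k + n).-1 /\ forall i, i < k -> x i \in x 0 :: s].

Lemma inserted0 : inserted 0 (seg x 1 k.-1).
Proof.
have kE : k = k.-1.+1 by arith.
split.
- exact: (path_seg cx).
- by rewrite last_seg.
- by rewrite -segS (uniq_seg cx) //; arith.
- by rewrite -segS => z /mem_seg[i _ ->].
- split; first by rewrite seg_size addn0.
  by move=> i ik; rewrite -segS; apply/mem_seg; exists i => //; arith.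
Qed.

Lemma inserted_cyc n s v t : inserted n s ->
  all [predC C] (v :: t) -> uniq (v :: t) -> e (x k.-1) v -> path e v t -> e (last v t) (x m) ->
  has_cyc e (k + n + (size t).+1).
Proof.
move=> [ps ls us sub [sz _]] al ut ev pt lt; exists (x 0 :: s ++ v :: t).
  by rewrite /= size_cat sz /=; arith.
apply/andP; split.
  by rewrite /= rcons_cat cat_path ps ls /= ev rcons_path pt /= -xm.
rewrite -cat_cons cat_uniq us ut andbT; apply/hasPn => z /(allP al) /= zC.
by apply: contra zC => /sub.
Qed.

(* Meyniel's count: a skipped y not on the path satisfies d(w) + d(y) <= 2p - 2 - n, while both
   degrees are at least p - 1. *)
Lemma inserted_count n s w j : inserted n s -> mid w -> k <= j < m -> x j \notin x 0 :: s ->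
  ~ insertable e (x j) (x 0 :: s) -> n < g -> n = 0.
Proof.
move=> [ps ls us sub [sz Zs]] mw jm jns nins ng.
have := deg_ZYR w; rewrite mid_YS // addn0; have := mid_ZS_le mw; have := RS_pair_le mw jm.
have bound := adj_path_bound nins; have := leq_b1 (e (x j) (x 0)); have := leq_b1 (e (last (x 0) s) (x j)).
have := dense_deg de (x j); rewrite (sum_split C) -/(RS (x j)).
rewrite (big_setID [set z in x 0 :: s]) /=.
have -> : C :&: [set z in x 0 :: s] = [set z in x 0 :: s].
  by apply/setIidPr/subsetP => z; rewrite inE => /sub.
have -> : \sum_(z in [set z in x 0 :: s]) adj e (x j) z = \sum_(z <- x 0 :: s) adj e (x j) z.
  by rewrite big_uniq //; apply: eq_bigl => z; rewrite inE.
have jD : x j \in C :\: [set z in x 0 :: s] by rewrite in_setD xC inE jns.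
rewrite (sum_setD1 _ jD) (adj_irr de) add0n.
have cD : #|C :\: [set z in x 0 :: s]| + (size s).+1 = m.
  have := cardsID [set z in x 0 :: s] C; rewrite (card_cset cx).
  have -> : C :&: [set z in x 0 :: s] = [set z in x 0 :: s].
    by apply/setIidPr/subsetP => z; rewrite inE => /sub.
  by rewrite cardsE (card_uniqP us) /= addnC.
have := leq_sum_card (fun z (_ : z \in (C :\: [set z in x 0 :: s]) :\ x j) => adj_le2 e (x j) z).
have := cardsD1 (x j) (C :\: [set z in x 0 :: s]); rewrite jD.
by arith.
Qed.

Lemma insert_inserted n s y : inserted n s -> y \in C -> y \notin x 0 :: s ->
  insertable e y (x 0 :: s) -> exists s', inserted n.+1 s'.
Proof.
move=> [ps ls us sub [sz Zs]] yC ys insy.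
have [s' [ps' ls' us' [E' sz']]] := insert_path us ps ys insy.
exists s'; split=> //; first by rewrite ls'.
  by move=> z; rewrite E' inE => /predU1P[->|/sub].
split; first by rewrite sz' sz; arith.
by move=> i ik; rewrite E' inE Zs ?orbT.
Qed.

(** Closed by a simple bypass with t <= r vertices, the paths give cycles of lengths m - 1 + t and m
    + t. One of them lies strictly between m and p, because r >= 2. *)
Lemma inserted_all n s s' : inserted n s -> inserted n.+1 s' -> n.+1 = g -> False.
Proof.
move=> ins ins' ng; have [v [t [al ut ev pt lt]]] := bypass_uniq byp.
have c1 := inserted_cyc ins al ut ev pt lt; have c2 := inserted_cyc ins' al ut ev pt lt.
have tr : (size t).+1 <= r.
  rewrite -cR -[(size t).+1]/(size (v :: t)) -(card_uniqP ut); apply/subset_leq_card/subsetP.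
  by move=> z /(allP al); rewrite in_setC.
have [lt'|ge'] := ltnP (k + n.+1 + (size t).+1) p.
  by apply: (mc_max mc) c2; rewrite -/p; arith.
by apply: (mc_max mc) c1; rewrite -/p; arith.
Qed.

(** By [inserted_count] a further vertex can be inserted as long as some are missing, until
    [inserted_all] applies. *)
Lemma no_inserted n s : 0 < n < g -> inserted n s -> False.
Proof.
have [N] := ubnP (g - n); elim: N n s => // N IH n s gN ng ins.
have [w wC [rf rt]] := bypass_mid byp.
have mw : mid w by [].
have [ps ls us sub [sz Zs]] := ins.
have [y yC ys] : exists2 y, y \in C & y \notin x 0 :: s.
  have : ~~ (C \subset [set z in x 0 :: s]).
    apply/negP => /subset_leq_card; rewrite (card_cset cx) cardsE (card_uniqP us) /= sz; arith.
  by case/subsetPn => y yC; rewrite inE => ys; exists y.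
have [j jm yj] : exists2 j, k <= j < m & y = x j.
  case/(csetP cx _ 0): yC => j; rewrite add0n => /andP[_ jm] E; exists j => //.
  by rewrite jm andbT leqNgt; apply/negP => /Zs; rewrite -E (negPf ys).
have : n <> 0 by arith.
case; apply: (inserted_count ins mw jm); rewrite -?yj //; last by arith.
move=> insy; have [s' ins'] := insert_inserted ins yC ys insy.
have [lt|ge] := ltnP n.+1 g; first by apply: (IH n.+1 s'); [arith | arith |].
by apply: (inserted_all ins ins'); arith.
Qed.

Lemma y_word i j : i < k.-1 -> k <= j < m -> e (x i) (x j) + e (x j) (x i.+1) <= 1.
Proof.
move=> ik jm; case a: (e (x i) (x j)); case b: (e (x j) (x i.+1)) => //; exfalso.
have kE : k = k.-1.+1 by arith.
have insy : insertable e (x j) (x 0 :: seg x 1 k.-1).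
  exists (seg x 0 i), (x i), (x i.+1), (seg x i.+2 (k - i.+2)); split=> //.
  have -> : [:: x i, x i.+1 & seg x i.+2 (k - i.+2)] = seg x (0 + i) (k - i).
    by have -> : k - i = (k - i.+2).+2 by arith.
  by rewrite seg_cat -segS; congr seg; arith.
have jnot : x j \notin x 0 :: seg x 1 k.-1.
  rewrite -segS; apply/negP => /mem_seg[i' i'k E].
  have := cyc_lt_eq cx (esym E); rewrite -kE in i'k; arith.
have [s' ins'] := insert_inserted inserted0 (xC j) jnot insy.
have [lt|ge] := ltnP 1 g; first exact: (no_inserted (n := 1) (s := s')).
by apply: (inserted_all inserted0 ins'); arith.
Qed.

Lemma y_ZS_le j : k <= j < m -> ZS (x j) <= k.+1.
Proof.
move=> jm; have := ZS_le (fun i ik => y_word ik jm).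
have := leq_b1 (e (x j) (x 0)); have := leq_b1 (e (x k.-1) (x j)); arith.
Qed.

Lemma YS_le u j : k <= j < m -> adj e u (x j) = 0 -> YS u <= 2 * g.-1.
Proof.
move=> jm uj; rewrite /YS (@big_cat_nat _ _ _ j) /=; [|by arith..].
rewrite (@big_ltn _ _ _ j) ?uj; last by arith.
have lel c d : \sum_(c <= i < d) adj e u (x i) <= 2 * (d - c).
  rewrite mulnC -sum_nat_const_nat; apply: leq_sum => i _; exact: adj_le2.
have := lel k j; have := lel j.+1 m; arith.
Qed.

(** The upper bounds k + 1 for w and (k + 1) + 2(g - 1) for x_j towards C, and 2(r - 1) towards R,
    add up to 2p - 2, the least sum that two degrees can have. *)
Lemma mid_exact w j : mid w -> k <= j < m ->
  [/\ ZS w = k.+1, ZS (x j) = k.+1, YS (x j) = 2 * g.-1, RS w + 2 = r + g & RS (x j) + g = r].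
Proof.
move=> mw jm; have := deg_ZYR w; have := deg_ZYR (x j).
have := y_ZS_le jm; have := mid_ZS_le mw; have := mid_YS mw.
have := YS_le jm (adj_irr de (x j)); have := RS_pair_le mw jm.
by rewrite /r; split; arith.
Qed.

Lemma mid_ends w : mid w -> [/\ e w (x 0), e (x k.-1) w &
  forall i, i < k.-1 -> e w (x i.+1) = ~~ e (x i) w].
Proof.
move=> mw; have km : k <= k < m by arith.
have [Zw _ _ _ _] := mid_exact mw km; have [wC _ _] := mw.
by apply: ZS_exact; [move=> i _; apply: word_out | rewrite Zw].
Qed.

Lemma y_ends w j : mid w -> k <= j < m -> [/\ e (x j) (x 0), e (x k.-1) (x j) &
  forall i, i < k.-1 -> e (x j) (x i.+1) = ~~ e (x i) (x j)].
Proof.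
move=> mw jm; have [_ Zy _ _ _] := mid_exact mw jm.
by apply: ZS_exact; [move=> i ik; apply: y_word | rewrite Zy].
Qed.

Lemma y_complete w i j : mid w -> k <= i < m -> k <= j < m -> i != j -> e (x i) (x j).
Proof.
move=> mw im jm nij; have [_ _ Yi _ _] := mid_exact mw im.
suff /adj2[] : adj e (x i) (x j) = 2 by [].
apply/eqP; rewrite eqn_leq adj_le2 leqNgt; apply/negP => lt.
wlog lij : i j im jm nij Yi lt / i < j.
  move=> H; have [ij|ji|E] := ltngtP i j; last by rewrite E eqxx in nij.
    exact: (H i j).
  have [_ _ Yj _ _] := mid_exact mw jm.
  by apply: (H j i) => //; [rewrite eq_sym | rewrite adjC].
move: Yi; rewrite /YS (@big_cat_nat _ _ _ i) /=; [|by arith..].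
rewrite (@big_ltn _ _ _ i) ?(adj_irr de); last by arith.
rewrite (@big_cat_nat _ _ _ j i.+1) /=; [|by arith..].
rewrite (@big_ltn _ _ _ j); last by arith.
have lel c d : \sum_(c <= l < d) adj e (x i) (x l) <= 2 * (d - c).
  rewrite mulnC -sum_nat_const_nat; apply: leq_sum => l _; exact: adj_le2.
have := lel k i; have := lel i.+1 j; have := lel j.+1 m; arith.
Qed.

(** Equality in [RS_pair_le] holds term by term: exactly one of x_j -> z, z -> w and exactly one of
    w -> z, z -> x_j is present. *)
Lemma mid_types w j z : mid w -> k <= j < m -> z \notin C -> z != w ->
  e (x j) z = ~~ e z w /\ e z (x j) = ~~ e w z.
Proof.
move=> mw jm zC nzw; have [wC _ _] := mw; have wR : w \in ~: C by rewrite in_setC.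
have [_ _ _ Rw Ry] := mid_exact mw jm.
have zR : z \in ~: C :\ w by rewrite in_setD1 nzw in_setC.
have le2 t : t \in ~: C :\ w -> adj e w t + adj e (x j) t <= 2.
  case/setD1P=> _; rewrite in_setC => tC.
  by have := mid_in mw jm tC; have := mid_out mw jm tC; rewrite /adj; arith.
have E : adj e w z + adj e (x j) z = 2.
  apply: (sum_card_eq (F := fun t => adj e w t + adj e (x j) t) le2) zR.
  rewrite big_split /=; move: Rw Ry; rewrite /RS !(sum_setD1 _ wR) (adj_irr de) (mid_nonadj mw jm).
  by move: cR; rewrite (cardsD1 w (~: C)) wR; arith.
have := mid_in mw jm zC; have := mid_out mw jm zC; move: E; rewrite /adj.
by case: (e w z); case: (e z w); case: (e (x j) z); case: (e z (x j)).
Qed.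

Let kin : k <= k < m. Proof. by arith. Qed.

Let from_xk z : z \notin C -> e (x k) z -> route_to e C z (x m) -> False.
Proof. by move=> zC yz rt; apply: (@no_small_route k m z); [arith | apply: route_from1 |]. Qed.

Let to_xk z : z \notin C -> route_from e C (x k.-1) z -> e z (x k) -> False.
Proof. by move=> zC rf zy; apply: (@no_small_route k.-1 k z); [arith | | apply: route_to1]. Qed.

(** Either z -> x_0 or x_(k-1) -> z suffices. Without both, z has at most k - 1 arcs with the kept
    vertices, none with the skipped ones and no more than w with R, a degree two short of that of
    w. *)
Lemma mid_spread w z : mid w -> z \notin C -> z != w -> e w z -> e z w -> mid z.
Proof.
move=> mw zC nzw wz zw; have [wC rf rt] := mw.
have [z0|nz0] := boolP (e z (x 0)).
  by split=> //; [exact: route_fromS rf wz zC | rewrite xm; exact: route_to1].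
have [kz|nkz] := boolP (e (x k.-1) z).
  by split=> //; [exact: route_from1 | exact: route_toS zw rt].
have [wR zR] : w \in ~: C /\ z \in ~: C by rewrite !in_setC.
exfalso; have Zz := ZS_le (fun i _ => word_out i zC); rewrite (negPf nz0) (negPf nkz) in Zz.
have Yz : YS z = 0.
  rewrite /YS big_nat big1 // => j jm; have [Ez1 Ez2] := mid_types mw jm zC nzw.
  by apply: adj0; rewrite ?Ez1 ?Ez2 negbK.
have Rz : RS z <= RS w.
  have zR' : z \in ~: C :\ w by rewrite in_setD1 nzw.
  rewrite /RS !(sum_setD1 _ wR) !(sum_setD1 _ zR') !(adj_irr de) (adjC e w z) !add0n leq_add2l.
  apply: leq_sum => t /setD1P[ntz /setD1P[ntw]]; rewrite in_setC => tC.
  have [Et1 Et2] := mid_types mw kin tC ntw; rewrite /adj; apply: leq_add.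
    case zt: (e z t) => //; case wt: (e w t) Et2 => //= Et2; exfalso.
    by apply: (to_xk tC) => //; exact: route_fromS (route_fromS rf wz zC) zt tC.
  case tz: (e t z) => //; case tw: (e t w) Et1 => //= Et1; exfalso.
  by apply: (from_xk tC Et1); exact: route_toS tC tz (route_toS zC zw rt).
have := deg_ZYR z; have [_ _ _ Rw _] := mid_exact mw kin.
by rewrite Yz /r; arith.
Qed.

(** Otherwise z is joined both ways to all skipped vertices. Minimality of g then excludes z -> x_0
    and x_(k-1) -> z and leaves z at most r - g - 2 arcs inside R, for a degree of at most p - 3. *)
Lemma mid_adjacent w z : mid w -> z \notin C -> z != w -> e w z || e z w.
Proof.
move=> mw zC nzw; have [wC rf rt] := mw; apply/negPn/negP => /norP[nwz nzw'].
have zR : z \in ~: C by rewrite in_setC.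
have ty j : k <= j < m -> e (x j) z /\ e z (x j).
  by move=> jm; have [-> ->] := mid_types mw jm zC nzw; rewrite nwz nzw'.
have nz0 : ~~ e z (x 0).
  apply/negP => z0; apply: (@no_small_route m.-1 m z); first by arith.
    by apply: route_from1 => //; case: (ty m.-1) => //; arith.
  by apply: route_to1 => //; rewrite xm.
have nkz : ~~ e (x k.-1) z.
  by apply/negP => kz; apply: (to_xk zC); [apply: route_from1 | case: (ty k kin)].
have Zz := ZS_le (fun i _ => word_out i zC); rewrite (negPf nz0) (negPf nkz) in Zz.
have Yz : YS z <= 2 * g.
  have -> : g = m - k by arith.
  rewrite /YS mulnC -sum_nat_const_nat; apply: leq_sum => i _; exact: adj_le2.
have Rz : RS z + 2 <= RS (x k).
  rewrite /RS !(sum_setD1 _ zR) (adj_irr de) addnC add0n.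
  have [yz zy] := ty k kin; apply: leq_add; first by rewrite /adj yz zy.
  apply: leq_sum => t /setD1P[ntz]; rewrite in_setC => tC.
  have [->|ntw] := eqVneq t w; first by rewrite adj0.
  have [Et1 Et2] := mid_types mw kin tC ntw; rewrite /adj; apply: leq_add.
    case zt: (e z t) => //; rewrite Et1; case tw: (e t w) => //; exfalso.
    by apply: (from_xk zC yz); exact: route_toS zC zt (route_toS tC tw rt).
  case tz: (e t z) => //; rewrite Et2; case wt: (e w t) => //; exfalso.
  by apply: (to_xk zC _ zy); exact: route_fromS (route_fromS rf wt tC) tz zC.
have := deg_ZYR z; have [_ _ _ _ Ry] := mid_exact mw kin.
by rewrite /r in Ry *; arith.
Qed.

Lemma sum_mem (A B : {set T}) : A \subset B -> \sum_(z in B) (z \in A) = #|A|.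
Proof.
move=> /subsetP AB; rewrite -sum1_card big_mkcond [RHS]big_mkcond; apply: eq_bigr => z _.
by case zA: (z \in A); [rewrite AB | case: ifP].
Qed.

Lemma mid_deg w : mid w -> odeg e w + odeg (conv e) w = p.-1.
Proof.
move=> mw; have [Zw _ _ Rw _] := mid_exact mw kin; rewrite !odeg_sum -big_split /=.
have -> : \sum_i (e w i + conv e w i) = ZS w + YS w + RS w.
  rewrite (sum_split C) /C (sum_cset cx _ 0) (@big_cat_nat _ _ _ k) //.
  by rewrite mkg leq_addr.
by rewrite (mid_YS mw) Zw; rewrite /r in Rw; arith.
Qed.

(* W, I and O collect the outside vertices joined to w both ways, from w only and to w only. I and O
   are empty by sink_part_empty, applied to e and to its converse. *)
Lemma mid_joined w z : mid w -> z \notin C -> z != w -> e w z /\ e z w.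
Proof.
move=> mw zC nzw; have [wC rf rt] := mw; have wR : w \in ~: C by rewrite in_setC.
pose W := [set t | (t \notin C) && ((t == w) || e w t && e t w)].
pose I := [set t | [&& t \notin C, t != w, e w t & ~~ e t w]].
pose O := [set t | [&& t \notin C, t != w, ~~ e w t & e t w]].
have inW t : (t \in W) = (t \notin C) && ((t == w) || e w t && e t w) by rewrite [LHS]in_set.
have inI t : (t \in I) = [&& t \notin C, t != w, e w t & ~~ e t w] by rewrite [LHS]in_set.
have inO t : (t \in O) = [&& t \notin C, t != w, ~~ e w t & e t w] by rewrite [LHS]in_set.
have sub (P : pred T) : [set t | (t \notin C) && P t] \subset ~: C.
  by apply/subsetP => t; rewrite in_set in_setC => /andP[].
have [_ _ _ Rw _] := mid_exact mw kin.
have card_at (A : {set T}) : A \subset ~: C -> #|A| = (w \in A) + \sum_(t in ~: C :\ w) (t \in A).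
  by move=> sA; rewrite -(sum_mem sA) (sum_setD1 _ wR).
have r1 : \sum_(t in ~: C :\ w) 1 + 1 = r.
  by rewrite -cR -sum1_card (sum_setD1 _ wR) addnC.
have RSw : RS w = \sum_(t in ~: C :\ w) adj e w t by rewrite /RS (sum_setD1 _ wR) (adj_irr de).
have [WC IC OC] : [/\ W \subset ~: C, I \subset ~: C & O \subset ~: C] by split; apply: sub.
have [wW wI wO] : [/\ w \in W, w \in I = false & w \in O = false].
  by rewrite inW inI inO wC eqxx.
(* The sum RS w = r + g - 2 counts the r - 1 other outside vertices once and those in W a second
   time. *)
have EW : #|W| = g.
  have E : RS w = \sum_(t in ~: C :\ w) 1 + \sum_(t in ~: C :\ w) (t \in W).
    rewrite RSw -big_split /=; apply: eq_bigr => t /setD1P[ntw]; rewrite in_setC => tC.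
    have := mid_adjacent mw tC ntw; rewrite inW tC (negPf ntw) /adj.
    by case: (e w t); case: (e t w).
  by rewrite (card_at _ WC) wW; arith.
have EWIO : #|W| + #|I| + #|O| = r.
  rewrite (card_at _ WC) (card_at _ IC) (card_at _ OC) wW wI wO -r1 !add0n.
  rewrite -addnA -addnA addnC -!big_split /=; congr (_ + _).
  apply: eq_bigr => t /setD1P[ntw]; rewrite in_setC => tC; rewrite inW inI inO tC ntw (negPf ntw) /=.
  by have := mid_adjacent mw tC ntw; case: (e w t); case: (e t w).
have degw := mid_deg mw.
have [w0 kw _] := mid_ends mw.
have m0 : 0 < m by arith.
(* From d(w) = p - 1 and id(w) >= p/2 - 1 follows od(w) <= p/2; the arc w -> x_0 compensates for
   counting w itself in W. *)
have smallI : 2 * (#|I| + #|W|) <= p.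
  have : #|W| + #|I| <= odeg e w.
    rewrite (odeg_split mc) -/C (card_at _ WC) (card_at _ IC) wW wI (sum_setD1 _ wR) irr !add0n -addnA leq_add //.
      by apply: (sum_pos (i0 := 0) m0 (cyc_periodic mc (fun z => nat_of_bool (e w z)))); rewrite w0.
    rewrite -big_split /=; apply: leq_sum => t /setD1P[ntw]; rewrite in_setC inW ?inI ?inO ntw (negPf ntw) => ->.
    by case: (e w t); case: (e t w).
  have := dense_in de w; rewrite -/p; arith.
have smallO : 2 * (#|O| + #|W|) <= p.
  have : #|W| + #|O| <= odeg (conv e) w.
    rewrite (ideg_split mc) -/C (card_at _ WC) (card_at _ OC) wW wO (sum_setD1 _ wR) irr !add0n -addnA leq_add //.
      by apply: (sum_pos (i0 := k.-1) m0 (cyc_periodic mc (fun z => nat_of_bool (e z w)))); rewrite kw.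
    rewrite -big_split /=; apply: leq_sum => t /setD1P[ntw]; rewrite in_setC inW ?inI ?inO ntw (negPf ntw) => ->.
    by case: (e w t); case: (e t w).
  have := dense_out de w; rewrite -/p; arith.
have WP t : t \in W -> [/\ t \notin C, mid t & t != w -> e w t /\ e t w].
  rewrite inW => /andP[tC]; have [->|ntw] := eqVneq t w; first by split=> //; rewrite eqxx.
  by case/andP=> wt tw; split=> //; apply: mid_spread mw _ _ _ _.
have IP t : t \in I -> [/\ t \notin C, t != w, e w t & ~~ e t w] by rewrite inI => /and4P[].
have OP t : t \in O -> [/\ t \notin C, t != w, ~~ e w t & e t w] by rewrite inO => /and4P[].
(* By [mid_types] the arcs between t and x_k determine those between t and every other inner vertex
   of a least jump, so s and w are joined to t in the same way. *)
have cW : complete_on e W.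
  move=> s t /WP[sC ms sw] /WP[tC mt tw] nst.
  have [Et|ntw] := eqVneq t w; first by rewrite Et in nst *; case: (sw nst).
  have [Es|nsw] := eqVneq s w; first by rewrite Es; case: (tw ntw).
  have [_ E1] := mid_types mw kin tC ntw; have nts : t != s by rewrite eq_sym.
  have [_ E2] := mid_types ms kin tC nts.
  by apply/negPn; rewrite -E2 E1; case: (tw ntw) => ->.
have WtoI s t : s \in W -> t \in I -> e s t.
  move=> /WP[sC ms sw] /IP[tC ntw wt ntw']; have [->//|nsw] := eqVneq s w.
  have nts : t != s.
    by apply: contraNneq ntw' => ->; case: (sw nsw).
  have [_ E1] := mid_types mw kin tC ntw; have [_ E2] := mid_types ms kin tC nts.
  by apply/negPn; rewrite -E2 E1 wt.
have OtoW s t : s \in W -> t \in O -> e t s.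
  move=> /WP[sC ms sw] /OP[tC ntw nwt tw]; have [->//|nsw] := eqVneq s w.
  have nts : t != s by apply: contraNneq nwt => ->; case: (sw nsw).
  have [E1 _] := mid_types mw kin tC ntw; have [E2 _] := mid_types ms kin tC nts.
  by apply/negPn; rewrite -E2 E1 tw.
have nogap0 i : ~ bypass e C (x i) (x i.+1).
  by have := @no_small i 1; rewrite addn1; apply.
have WI : [disjoint W & I].
  by apply/pred0P => t /=; rewrite inW inI; case: (t == w); case: (e w t); case: (e t w); rewrite ?andbF.
have WO : [disjoint W & O].
  by apply/pred0P => t /=; rewrite inW inO; case: (t == w); case: (e w t); case: (e t w); rewrite ?andbF.
have I0 : I = set0.
  apply: (sink_part_empty de mc nogap0 (W := W) (O := O) (w0 := w)) => //.
  - by move=> t /WP[].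
  - by move=> t /IP[].
  - move=> t tw; rewrite -/C inW inO tw; case tC: (t \in C) => //=.
    by have [->|ntw] := eqVneq t w; case: (e w _).
  - move=> s t /IP[sC nsw ws nsw'] st; rewrite -/C inI; case tC: (t \in C) => //=.
    have ntw : t != w by apply: contraNneq nsw' => <-.
    rewrite ntw /=; have := mid_adjacent mw (negbT tC) ntw.
    case tw: (e t w); last by rewrite orbF => ->.
    exfalso; apply: (from_xk sC); first by have [-> _] := mid_types mw kin sC nsw.
    exact: route_toS sC st (route_toS (negbT tC) tw rt).
  - by exists k.-1.
have O0 : O = set0.
  have eC := cset_conv cx.
  apply: (sink_part_empty (dense_conv de) (maxcyc_conv mc) _ (W := W) (O := I) (w0 := w)); rewrite ?eC -?/C //.
  - move=> i /bypass_conv; set a := x (m.-1 * i.+1).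
    have -> : x (m.-1 * i) = x (m.-1 * i.+1).+1; last exact: nogap0.
    by apply: (cyc_eq cx); rewrite mulnS -addSn prednK // modnDl.
  - by move=> t /WP[].
  - by move=> t /OP[].
  - by rewrite addnAC.
  - by move=> s t sW tW nst; apply: cW; rewrite // eq_sym.
  - move=> t; rewrite /conv => wt; rewrite inW inI wt; case tC: (t \in C) => //=.
    by have [->|ntw] := eqVneq t w; case: (e _ w).
  - move=> s t /OP[sC nsw nws sw]; rewrite /conv => ts; rewrite inO; case tC: (t \in C) => //=.
    have ntw : t != w by apply: contraNneq nws => <-.
    rewrite ntw /=; have := mid_adjacent mw (negbT tC) ntw.
    case wt: (e w t); last by move=> /= ->.
    exfalso; apply: (to_xk sC); last by have [_ ->] := mid_types mw kin sC nsw.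
    exact: route_fromS (route_fromS rf wt (negbT tC)) ts sC.
  - have [j E] : exists j, x 0 = x (m.-1 * j).
      have := in_cset cx 0; rewrite -eC => /(csetP (cyc_rev cx) _ 0)[j _ E]; by exists j.
    by exists j; rewrite -E.
have := mid_adjacent mw zC nzw; have := inI z; have := inO z.
rewrite I0 O0 !in_set0 zC nzw /=.
by case: (e w z); case: (e z w).
Qed.

Lemma outside_mid z : z \notin C -> mid z.
Proof.
have [w wC [rf rt]] := bypass_mid byp; have mw : mid w by [].
move=> zC; have [->//|nzw] := eqVneq z w.
by have [wz zw] := mid_joined mw zC nzw; apply: mid_spread mw zC nzw wz zw.
Qed.

Lemma outside_complete : complete_on e (~: C).
Proof.
move=> a b; rewrite !in_setC => aC bC nab; have nba : b != a by rewrite eq_sym.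
by case: (mid_joined (outside_mid aC) bC nba).
Qed.

Lemma outside_card : r = g.
Proof.
have [w wC _] := bypass_mid byp; have wR : w \in ~: C by rewrite in_setC.
have [_ _ _ Rw _] := mid_exact (outside_mid wC) kin.
have RSw : RS w = 2 * #|~: C :\ w|.
  rewrite /RS (sum_setD1 _ wR) (adj_irr de) add0n mulnC -sum_nat_const.
  apply: eq_bigr => z /setD1P[nzw]; rewrite in_setC => zC.
  by rewrite /adj; have [-> ->] := mid_joined (outside_mid wC) zC nzw.
by have := cR; rewrite (cardsD1 w) wR; arith.
Qed.

Let g2 : 1 < g. Proof. by rewrite -outside_card /r; arith. Qed.

(** * Only two vertices of the cycle are kept *)

Definition skipped : {set T} := [set z in seg x k g].

Lemma skippedP z : reflect (exists2 j, k <= j < m & z = x j) (z \in skipped).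
Proof. by rewrite in_set mkg; apply: mem_seg. Qed.

Lemma card_skipped : #|skipped| = g.
Proof.
have us : uniq (seg x k g) by apply: (uniq_seg cx); arith.
by rewrite cardsE (card_uniqP us) seg_size.
Qed.

Lemma skipped_complete : complete_on e skipped.
Proof.
have [w wC _] := bypass_mid byp; have mw := outside_mid wC.
move=> a b /skippedP[i im ->] /skippedP[j jm ->] nab; apply: (y_complete mw im jm).
by apply: contraNneq nab => ->.
Qed.

(** The cycle runs along x_j .. x_(k-1), through R, along x_0 .. x_i and back to x_j through skipped
    vertices, dropping x_(i+1) .. x_(j-1). *)
Lemma double_cyc i j a s b t : i < j < k -> uniq (a :: s) -> {subset a :: s <= skipped} ->
  uniq (b :: t) -> all [predC C] (b :: t) ->
  e (x i) a -> path e a s -> e (last a s) (x j) ->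
  e (x k.-1) b -> path e b t -> e (last b t) (x 0) ->
  has_cyc e (k - j + i.+1 + (size s).+1 + (size t).+1).
Proof.
move=> ij us sY ut tC ia ps sj kb pt t0.
have jE : k - j = (k - j.+1).+1 by arith.
exists (seg x j (k - j.+1).+1 ++ (b :: t) ++ seg x 0 i.+1 ++ a :: s).
  by rewrite !size_cat !seg_size /=; arith.
apply/andP; split.
  rewrite [seg x j _]segS /= rcons_cat cat_path (path_seg cx) last_seg.
  have -> : j + (k - j.+1) = k.-1 by arith.
  rewrite /= kb rcons_cat cat_path pt /= t0 rcons_cat cat_path (path_seg cx) last_seg add0n /= ia.
  by rewrite rcons_path ps sj.
have disjY l c : l + c <= k -> ~~ has [in seg x l c] (a :: s).
  move=> lc; apply/hasPn => z /sY/skippedP[i' i'm ->]; apply/negP => /mem_seg[j' j'l E].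
  by have := cyc_lt_eq cx (esym E); arith.
have disjC l c : ~~ has [in seg x l c] (b :: t).
  by apply/hasPn => z /(allP tC) /= zC; apply: contra zC => /mem_seg[l' _ ->].
have disjYC : ~~ has [in b :: t] (a :: s).
  by apply/hasPn => z /sY/skippedP[i' _ ->]; apply/negP => /(allP tC) /=; rewrite xC.
rewrite -jE catA cat_uniq; apply/and3P; split.
- rewrite cat_uniq (uniq_seg cx) ?ut ?andbT /=; last by arith.
  exact: disjC.
- apply/hasPn => z; rewrite mem_cat => /orP[/mem_seg[l lE ->]|zs].
    rewrite /= mem_cat negb_or; apply/andP; split.
      by apply/negP => /mem_seg[l' l'E E]; have := cyc_lt_eq cx E; arith.
    by apply/negP => /(allP tC) /=; rewrite xC.
  rewrite /= mem_cat negb_or; apply/andP; split.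
    by apply: (hasPn (disjY j (k - j) _)) => //; arith.
  exact: (hasPn disjYC).
- rewrite cat_uniq (uniq_seg cx) ?us ?andbT /=; last by arith.
  by apply: disjY; arith.
Qed.

Lemma outside_word i j z t : z \notin C -> t \notin C -> i < j <= i + g -> e (x i) z -> ~~ e t (x j).
Proof.
move=> zC tC ij iz; apply/negP => tj; apply: (no_small_route ij (route_from1 zC iz)).
have [->|nzt] := eqVneq z t; first exact: route_to1.
have zt : e z t by apply: outside_complete; rewrite ?in_setC ?zC ?tC.
exact: route_toS zC zt (route_to1 tC tj).
Qed.

Let xY j : k <= j < m -> x j \in skipped. Proof. by move=> jm; apply/skippedP; exists j. Qed.

(** For distinct ends, [double_cyc] with j = i + 1, all skipped vertices and one vertex of R has
    length m + 1. *)
Lemma skipped_word1 i a b : i < k.-1 -> k <= a < m -> k <= b < m -> e (x i) (x a) -> ~~ e (x b) (x i.+1).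
Proof.
move=> ik am bm ia; have [w wC _] := bypass_mid byp; have mw := outside_mid wC.
have [Eab|nab] := eqVneq (x a) (x b).
  by have [_ _ ->] := y_ends mw bm; rewrite // -Eab ia.
apply/negP => bi; have [s [ps ls us Es]] := complete_path skipped_complete (xY am) (xY bm) nab.
have sz : (size s).+1 = g.
  by rewrite -card_skipped -[(size s).+1]/(size (x a :: s)) -(card_uniqP us); apply: eq_card.
have [w0 kw _] := mid_ends mw.
have := double_cyc (i := i) (j := i.+1) _ us _ (b := w) (t := [::]) _ _ ia ps _ kw _ w0.
rewrite ls => cyc1; apply: (mc_max mc (l := k - i.+1 + i.+1 + (size s).+1 + 1)); first by rewrite -/p; arith.
by apply: cyc1 => //=; [arith | move=> z; rewrite Es | rewrite wC].
Qed.

(** Two vertices of R compensate for dropping x_(i+1), again with length m + 1. The skipped part is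
    entered at another vertex x_b, which x_i reaches by [skipped_word1]. *)
Lemma skipped_word2 i a : i.+2 < k -> k <= a < m -> e (x i) (x a) -> ~~ e (x a) (x i.+2).
Proof.
move=> ik am ia; have [w wC _] := bypass_mid byp; have mw := outside_mid wC.
have wR : w \in ~: C by rewrite in_setC.
have [w' /setD1P[nww w'R]] : exists w', w' \in ~: C :\ w.
  by apply/card_gt0P; have := cardsD1 w (~: C); rewrite wR cR outside_card; arith.
have w'C : w' \notin C by rewrite -in_setC.
have [b bm nab] : exists2 b, k <= b < m & x b != x a.
  have [y /setD1P[nya /skippedP[b bm Eb]]] : exists y, y \in skipped :\ x a.
    by apply/card_gt0P; have := cardsD1 (x a) skipped; rewrite (xY am) card_skipped; arith.
  by exists b; rewrite // -Eb.
have ib : e (x i) (x b).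
  have ik1 : i < k.-1 by arith.
  have := skipped_word1 ik1 am bm ia; have [_ _ ->] := y_ends mw bm => //.
  by rewrite negbK.
apply/negP => ai; have [s [ps ls us Es]] := complete_path skipped_complete (xY bm) (xY am) nab.
have sz : (size s).+1 = g.
  by rewrite -card_skipped -[(size s).+1]/(size (x b :: s)) -(card_uniqP us); apply: eq_card.
have [w0 kw _] := mid_ends mw; have [w'0 _ _] := mid_ends (outside_mid w'C).
have ww' : e w w' by apply: outside_complete; rewrite // eq_sym.
have := double_cyc (i := i) (j := i.+2) _ us _ (b := w) (t := [:: w']) _ _ ib ps _ kw _ w'0.
rewrite ls => cyc1; apply: (mc_max mc (l := k - i.+2 + i.+1 + (size s).+1 + 2)); first by rewrite -/p; arith.
apply: cyc1 => //=; [arith | by move=> z; rewrite Es | by rewrite inE eq_sym nww | by rewrite wC w'C | by rewrite ww'].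
Qed.

(** The words have no blanks here, so if x_l -> u and not x_(l+1) -> u, then u -> x_(l+2). This is
    excluded by [outside_word], as g >= 2, and by [skipped_word2]. *)
Lemma word_mono u i j : u \notin C \/ u \in skipped -> i <= j < k -> e (x i) u -> e (x j) u.
Proof.
have [w wC _] := bypass_mid byp; have mw := outside_mid wC.
move=> uRY; have step l : l.+1 < k -> e (x l) u -> e (x l.+1) u.
  move=> lk lu; have [Ek|nk] := eqVneq l.+1 k.-1.
    by rewrite Ek; case: uRY => [uC|/skippedP[a am ->]];
      [case: (mid_ends (outside_mid uC)) | case: (y_ends mw am)].
  have lk1 : l.+1 < k.-1 by arith.
  case: uRY => [uC|/skippedP[a am E]].
    have [_ _ ex] := mid_ends (outside_mid uC).
    by apply/negPn; rewrite -ex //; apply: (outside_word uC uC _ lu); arith.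
  rewrite E in lu *; have [_ _ ex] := y_ends mw am.
  by apply/negPn; rewrite -ex //; apply: skipped_word2 => //; arith.
move=> /andP[ij jk] iu; elim: j ij jk => [|j IH]; first by rewrite leqn0 => /eqP<-.
rewrite leq_eqVlt => /orP[/eqP<-//|ij] jk; apply: step => //; apply: IH => //; arith.
Qed.

Lemma vertex_cases v : [\/ v \notin C, v \in skipped | exists2 i, i < k & v = x i].
Proof.
have [/(csetP cx _ 0)[i im ->]|vC] := boolP (v \in C); last by constructor 1.
have [ik|ki] := ltnP i k; first by constructor 3; exists i.
by constructor 2; apply: xY; arith.
Qed.

(** By [word_mono] all kept vertices would send arcs to u, whose out-neighbours would be x_0 and its
    own part at most. Then od(u) <= g, less than p/2 - 1 = g + k/2 - 1. *)
Lemma x0_out u : 2 < k -> u \notin C \/ u \in skipped -> ~~ e (x 0) u.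
Proof.
have [w wC _] := bypass_mid byp; have mw := outside_mid wC.
move=> k3 uRY; apply/negP => u0.
have [G [uG cG outG]] : exists G : {set T}, [/\ u \in G, #|G| = g &
    forall v, e u v -> v \in G \/ exists2 i, i < k & v = x i].
  case: uRY => [uC|uY].
    exists (~: C); rewrite cR outside_card; split; rewrite ?in_setC // => v uv.
    case: (vertex_cases v) => [vC|/skippedP[a am E]|]; [by left; rewrite in_setC | | by right].
    by have := mid_nonadj (outside_mid uC) am; rewrite /adj -E uv addn1.
  exists skipped; rewrite card_skipped; split=> // v uv.
  case: (vertex_cases v) => [vC|vY|]; [ | by left | by right].
  case/skippedP: uY => a am E.
  by have := mid_nonadj (outside_mid vC) am; rewrite /adj -E uv.
have ex i : i < k.-1 -> e u (x i.+1) = ~~ e (x i) u.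
  case: uRY => [uC|/skippedP[a am ->]]; first by case: (mid_ends (outside_mid uC)) => _ _; apply.
  by case: (y_ends mw am) => _ _; apply.
have sub v : e u v -> v \in x 0 |: (G :\ u).
  move=> uv; rewrite in_setU1 in_setD1; case: (outG v uv) => [vG|[[|i] ik E]].
  - by rewrite vG andbT; apply/orP; right; apply: contraTneq uv => ->; rewrite irr.
  - by rewrite E eqxx.
  - have ik1 : i < k.-1 by arith.
    have ik0 : 0 <= i < k by arith.
    by move: uv; rewrite E ex // (word_mono uRY ik0 u0).
have := odeg_subset sub; have := dense_out de u; have := cardsU1 (x 0) (G :\ u).
by have := leq_b1 (x 0 \notin G :\ u); have := cardsD1 u G; rewrite uG cG -/p; have := outside_card; rewrite /r; arith.
Qed.

(** For k > 2 let h be the first index with x_h -> w. Then od(w) >= h + g, and x_0 has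
    out-neighbours only among x_1 .. x_h. So p/2 - 1 <= h <= p/2 - g, against g >= 2. *)
Lemma k_eq2 : k = 2.
Proof.
apply/eqP; rewrite eqn_leq k2 andbT leqNgt; apply/negP => k3.
have [w wC _] := bypass_mid byp; have mw := outside_mid wC.
have wR : w \in ~: C by rewrite in_setC.
have [w0 kw exw] := mid_ends mw.
have exh : exists h, (h < k) && e (x h) w by exists k.-1; rewrite kw andbT; arith.
case: (ex_minnP exh) => h /andP[hk hw] hmin.
have h1 : 0 < h.
  by rewrite lt0n; apply: contraTneq hw => ->; apply: x0_out k3 (or_introl wC).
have lowh i : i < h -> e w (x i.+1).
  move=> ih; rewrite exw; last by arith.
  by apply/negP => iw; have := hmin i; rewrite iw andbT => /(_ _); arith.
have outw : h + g <= odeg e w.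
  rewrite (odeg_split mc) -/C (sum_setD1 _ wR) irr add0n.
  have -> : \sum_(z in ~: C :\ w) e w z = g.-1.
    rewrite (eq_bigr (fun=> 1)); last first.
      by move=> z /setD1P[nzw zR]; rewrite outside_complete // eq_sym.
    by rewrite sum1_card; have := cR; rewrite outside_card (cardsD1 w) wR; arith.
  have : h.+1 <= \sum_(0 <= i < m) e w (x i); last by arith.
  rewrite (@big_cat_nat _ _ _ h.+1) //=; last by arith.
  apply: leq_trans (leq_addr _ _); rewrite -[X in X <= _]muln1 -[X in X * _ <= _]subn0 -sum_nat_const_nat.
  rewrite big_nat [X in _ <= X]big_nat; apply: leq_sum => -[|i] ih; first by rewrite w0.
  by rewrite lowh //; arith.
have sub v : e (x 0) v -> v \in [set z in seg x 1 h].
  move=> v0; case: (vertex_cases v) => [vC|vY|[j jk E]].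
  - by rewrite (negPf (x0_out k3 (or_introl vC))) in v0.
  - by rewrite (negPf (x0_out k3 (or_intror vY))) in v0.
  rewrite in_set; apply/mem_seg; exists j => //.
  have j0 : j <> 0 by move=> j0; rewrite E j0 irr in v0.
  have [jh|hj] := leqP j h; first by arith.
  (* A chord x_0 -> x_j with j > h closes x_0, x_j .. x_(m-1), x_1 .. x_(j-1), w. *)
  exfalso; apply: (mc_max mc (l := m.+1)); first by rewrite -/p; arith.
  have mE : m - j = (m - j.+1).+1 by arith.
  have jE : j.-1 = (j - 2).+1 by arith.
  exists (x 0 :: seg x j (m - j) ++ seg x 1 j.-1 ++ [:: w]).
    by rewrite /= !size_cat !seg_size /=; arith.
  have lastm : k <= m.-1 < m by arith.
  have y1 : e (x m.-1) (x 1).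
    have [_ _ ->] := y_ends mw lastm; last by arith.
    by apply: x0_out k3 _; right; apply: xY.
  have j1w : e (x j.-1) w by apply: word_mono (or_introl wC) _ hw; arith.
  apply/andP; split.
    rewrite mE jE !segS /= -E v0 rcons_cat cat_path E (path_seg cx) last_seg.
    have -> : j + (m - j.+1) = m.-1 by arith.
    rewrite /= y1 rcons_cat cat_path (path_seg cx) last_seg /=.
    have -> : 1 + (j - 2) = j.-1 by arith.
    by rewrite j1w w0.
  have pc : perm_eq (x 0 :: seg x j (m - j) ++ seg x 1 j.-1 ++ [:: w]) (w :: seg x 0 m).
    have -> : seg x 0 m = x 0 :: seg x 1 j.-1 ++ seg x j (m - j).
      have {2}-> : j = 1 + j.-1 by arith.
      by rewrite seg_cat -segS; congr seg; arith.
    by apply/permP => q; rewrite /= !count_cat /=; arith.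
  rewrite (perm_uniq pc) /= (uniq_seg cx) // andbT.
  by apply: contra wC => /mem_seg[i _ ->].
have := odeg_subset sub; have := dense_out de (x 0); have := mid_deg mw; have := dense_in de w.
have uh : uniq (seg x 1 h) by apply: (uniq_seg cx); arith.
rewrite cardsE (card_uniqP uh) seg_size -/p; have := outside_card; rewrite /r; arith.
Qed.

(** Towards R, and likewise towards the skipped vertices, x_0 sends all arcs or none. None to either
    would leave x_0 with out-degree at most 1, all to both would leave x_1 with in-degree at most 1.
    The part that receives the arcs becomes F. *)
Lemma gap_structure : exists (F B : {set T}) (a b : T),
  [/\ [/\ nverts T = 2 * g.+1, 1 < g, #|F| = g & #|B| = g],
      [/\ F :|: B :|: [set a; b] = setT, [disjoint F & B], [disjoint F :|: B & [set a; b]] & a != b],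
      complete_on e F /\ complete_on e B,
      forall f c, f \in F -> c \in B -> ~~ e f c && ~~ e c f
    & [/\ e a b, forall f, f \in F -> [/\ e a f, e f a, e b f & ~~ e f b]
       & forall c, c \in B -> [/\ ~~ e a c, e c a, e b c & e c b]]].
Proof.
have [w wC _] := bypass_mid byp; have mw := outside_mid wC.
have kE := k_eq2; have pE : p = 2 * g.+1 by have := outside_card; rewrite /r; arith.
have exR z : z \notin C -> [/\ e z (x 0), e (x 1) z & e z (x 1) = ~~ e (x 0) z].
  move=> zC; have [z0 kz ex] := mid_ends (outside_mid zC).
  by split=> //; [rewrite -[1]/(2.-1) -kE | apply: ex; rewrite kE].
have exY z : z \in skipped -> [/\ e z (x 0), e (x 1) z & e z (x 1) = ~~ e (x 0) z].
  move=> /skippedP[j jm ->]; have [z0 kz ex] := y_ends mw jm.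
  by split=> //; [rewrite -[1]/(2.-1) -kE | apply: ex; rewrite kE].
have cst0 : k <= k < m by arith.
have ykY := xY cst0.
have uniR z : z \notin C -> e (x 0) z = e (x 0) w.
  move=> zC; have [_ _ Ez] := exR z zC; have [_ _ Ew] := exR w wC.
  have := @outside_word 0 1 z w zC wC; have := @outside_word 0 1 w z wC zC; rewrite add0n Ez Ew !negbK.
  by case: (e (x 0) z); case: (e (x 0) w) => // H1 H2; [symmetry; apply: H2 | apply: H1]; rewrite // ltnW.
have uniY z : z \in skipped -> e (x 0) z = e (x 0) (x k).
  move=> zY; have [_ _ Ez] := exY z zY; have [_ _ Ew] := exY _ ykY; case/skippedP: zY => j jm Ej.
  have k0 : 0 < k.-1 by rewrite kE.
  have := skipped_word1 k0 jm cst0; have := skipped_word1 k0 cst0 jm; rewrite -Ej Ez Ew !negbK.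
  by case: (e (x 0) z); case: (e (x 0) (x k)) => // H1 H2; [symmetry; apply: H2 | apply: H1].
have vcases v : [\/ v \notin C, v \in skipped, v = x 0 | v = x 1].
  case: (vertex_cases v) => [vC|vY|[[|[|i]] ik ->]]; [by constructor 1 | by constructor 2 | by constructor 3 | by constructor 4 |].
  by rewrite kE in ik.
have nout : e (x 0) w || e (x 0) (x k).
  apply/negPn/negP => /norP[nw ny].
  have : odeg e (x 0) <= #|[set x 1]|.
    apply: odeg_subset => v v0; rewrite in_set1; case: (vcases v) => [vC|vY|E|->//].
    - by rewrite uniR // (negPf nw) in v0.
    - by rewrite uniY // (negPf ny) in v0.
    - by rewrite E irr in v0.
  by have := dense_out de (x 0); have := dense_ge5 de; rewrite cards1; arith.
have nin : ~~ (e (x 0) w && e (x 0) (x k)).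
  apply/negP => /andP[nw ny].
  have : odeg (conv e) (x 1) <= #|[set x 0]|.
    apply: odeg_subset => v; rewrite /conv in_set1 => v1; case: (vcases v) => [vC|vY|->//|E].
    - by have [_ _ Ev] := exR v vC; rewrite Ev uniR // nw in v1.
    - by have [_ _ Ev] := exY v vY; rewrite Ev uniY // ny in v1.
    - by rewrite E irr in v1.
  by have := dense_in de (x 1); have := dense_ge5 de; rewrite cards1; arith.
have n01 : x 0 != x 1 by apply/eqP => E; have := cyc_lt_eq cx E; arith.
have nonadj z y : z \notin C -> y \in skipped -> ~~ e z y && ~~ e y z.
  move=> zC /skippedP[j jm ->]; have := mid_nonadj (outside_mid zC) jm; rewrite /adj.
  by case: (e z _); case: (e _ z).
have YC y : y \in skipped -> y \in C by case/skippedP=> j _ ->.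
have notY i : i < k -> x i \notin skipped.
  by move=> ik; apply/negP => /skippedP[j jm E]; have := cyc_lt_eq cx E; arith.
have cover : ~: C :|: skipped :|: [set x 0; x 1] = setT.
  apply/setP => v; rewrite !in_setU !in_set1 in_setC in_setT.
  by case: (vcases v) => [->|->|->|->] //; rewrite ?eqxx ?orbT.
have dis : [disjoint ~: C & skipped].
  by rewrite disjoint_sym disjoints_subset setCK; apply/subsetP => y /YC.
have dis2 : [disjoint ~: C :|: skipped & [set x 0; x 1]].
  rewrite disjoint_sym disjoints_subset; apply/subsetP => v; rewrite in_set2 in_setC in_setU in_setC negb_or negbK.
  by case/orP=> /eqP->; rewrite xC notY // kE.
have a01 : e (x 0) (x 1) := cyc_step cx 0.
case w0: (e (x 0) w) nout nin => /= nout nin.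
  exists (~: C), skipped, (x 0), (x 1); split.
  - by rewrite cR outside_card card_skipped.
  - by [].
  - by split; [exact: outside_complete | exact: skipped_complete].
  - by move=> f c; rewrite in_setC; apply: nonadj.
  split=> // [f|c cY].
    by rewrite in_setC => fC; have [f0 f1 Ef] := exR f fC; rewrite Ef uniR // w0.
  by have [f0 f1 Ef] := exY c cY; rewrite Ef uniY // nin.
exists skipped, (~: C), (x 0), (x 1); rewrite [skipped :|: _]setUC disjoint_sym; split.
- by rewrite cR outside_card card_skipped.
- by [].
- by split; [exact: skipped_complete | exact: outside_complete].
- by move=> f c fY; rewrite in_setC => cC; rewrite andbC; apply: nonadj.
split=> // [f fY|c].
  by have [f0 f1 Ef] := exY f fY; rewrite Ef uniY // nout.
by rewrite in_setC => fC; have [f0 f1 Ef] := exR c fC; rewrite Ef uniR // w0.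
Qed.

End Gap.

(** * The strong case and the isomorphisms *)

Section StrongCase.
Variables (T : finType) (e : rel T).
Hypotheses (de : dense e) (str : forall u v, connect e u v).
Hypothesis noC : ~ has_cyc e (nverts T).-1.
Let p := nverts T.
Let irr := dense_irr de.
Let p5 : 5 <= p. Proof. exact: dense_ge5 de. Qed.

Lemma has_cycP l : reflect (has_cyc e l) [exists t : l.-tuple T, ucycleb e t].
Proof.
apply: (iffP existsP) => [[t ut]|[c sc uc]]; first by exists t; rewrite ?size_tuple.
by move/eqP: sc => sc; exists (Tuple sc).
Qed.

Lemma cyc_card_le l : has_cyc e l -> l <= p.
Proof.
by move=> [c <- /andP[_ uc]]; rewrite -(card_uniqP uc); apply: max_card.
Qed.

(** If the cycle at hand is Hamiltonian, x_0 has an out-neighbour x_c other than x_1. As c = 2 would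
    give length p - 1, the chord closes a cycle of length p - c + 1 <= p - 2. *)
Lemma exists_short_cycle : exists2 l, 1 < l & (l.+2 <= p) /\ has_cyc e l.
Proof.
have /card_gt0P[u _] : 0 < #|T| by apply: leq_trans (dense_ge5 de).
have out1 w t : exists2 v, e w v & v != t.
  case: (pickP [pred v | e w v && (v != t)]) => [v /andP[? ?]|none]; first by exists v.
  have : odeg e w <= #|[set t]|.
    apply: odeg_subset => v wv; rewrite in_set1; apply/negPn/negP => nvt.
    by have := none v; rewrite /= wv nvt.
  by rewrite cards1; have := dense_out de w; rewrite -/p; move: p5; arith.
have [v uv _] := out1 u u.
have nuv : v != u by apply: contraTneq uv => ->; rewrite irr.
have [l l1 cl] : exists2 l, 1 < l & has_cyc e l.
  case/connectP: (str v u) => s ps Eu; case/shortenP: ps Eu => s' ps' us' _ Eu.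
  exists (size s').+1; first by case: s' {ps' us'} Eu => //= Eu; rewrite Eu eqxx in nuv.
  by exists (v :: s') => //; rewrite /ucycle /= rcons_path ps' -Eu uv.
have lp := cyc_card_le cl.
have [lt|ge] := ltnP l.+1 p; first by exists l.
have [lp1|nlp1] := eqVneq l p.-1; first by case: noC; rewrite -/p -lp1.
have Elp : l = p by arith.
rewrite {}Elp in cl; have p0 : 0 < p by move: p5; arith.
have [y cy] := has_cyc_cyc p0 cl.
have yT : cset p y = setT by apply/eqP; rewrite eqEcard subsetT cardsT (card_cset cy) leqnn.
have [t yt nt1] := out1 (y 0) (y 1).
have : t \in cset p y by rewrite yT inE.
case/(csetP cy _ 0) => c; rewrite add0n => /andP[_ cp] Et.
have c0 : c != 0 by apply: contraTneq yt => c0; rewrite Et c0 irr.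
have c1 : c != 1 by apply: contraNneq nt1 => c1; rewrite Et c1.
have cl' : has_cyc e (p - c).+1.
  by apply: (chord_cyc cy (i := 0)); [arith | rewrite add0n -Et].
have c2 : c != 2.
  apply/eqP => c2; apply: noC; rewrite -/p; have -> : p.-1 = (p - c).+1 by rewrite c2; move: p5; arith.
  exact: cl'.
by exists (p - c).+1; [arith | split=> //; arith].
Qed.

Lemma exists_maxcyc : exists m x, maxcyc e m x.
Proof.
have [l l1 [lp cl]] := exists_short_cycle.
pose P l := (1 < l) && (l.+2 <= p) && [exists t : l.-tuple T, ucycleb e t].
have exP : exists l, P l by exists l; rewrite /P l1 lp; apply/has_cycP.
have ubP i : P i -> i <= p by move=> /andP[/andP[_]]; arith.
case: (ex_maxnP exP ubP) => m /andP[/andP[m1 mp] /has_cycP cm] mmax.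
have [x cx] := has_cyc_cyc (ltnW m1) cm.
exists m, x; split=> // i im /has_cycP ci.
have [ip|ip] := eqVneq i p.-1; first by case: noC; rewrite -/p -ip; apply/has_cycP.
have := mmax i; rewrite /P ci andbT => /(_ _); rewrite -/p in im; arith.
Qed.

Lemma strong_structure :
  [\/ exists2 y, cyc e 5 y & p = 5 /\
        forall i j, e (y i) (y j) = (j == i.+1 %[mod 5]) || (i == j.+1 %[mod 5]),
      bipartite e /\ has_cyc e p,
      exists (z : T) (S1 S2 : {set T}),
        [/\ [/\ z |: S1 :|: S2 = setT, z \notin S1, z \notin S2 & [disjoint S1 & S2]],
            p = (2 * #|S1|).+1, p = (2 * #|S2|).+1,
            forall u v, u \in S1 -> v \in S2 -> ~~ e u v && ~~ e v u
          & forall u v, u != v -> (u \in z |: S1) && (v \in z |: S1) ||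
                            (u \in z |: S2) && (v \in z |: S2) -> e u v]
    | exists (g : nat) (F B : {set T}) (a b : T),
        [/\ [/\ p = 2 * g.+1, 1 < g, #|F| = g & #|B| = g],
            [/\ F :|: B :|: [set a; b] = setT, [disjoint F & B],
                [disjoint F :|: B & [set a; b]] & a != b],
            complete_on e F /\ complete_on e B,
            forall f c, f \in F -> c \in B -> ~~ e f c && ~~ e c f
          & [/\ e a b, forall f, f \in F -> [/\ e a f, e f a, e b f & ~~ e f b]
             & forall c, c \in B -> [/\ ~~ e a c, e c a, e b c & e c b]]]].
Proof.
have [m [x0 mc0]] := exists_maxcyc.
have m0 := cyc_gt0 (mc_cyc mc0); have m1 := mc_gt1 mc0; have mp := mc_le mc0; rewrite -/p in mp.
pose C := cset m x0; pose Q c := [exists i : 'I_m, bypassb e C (x0 i) (x0 (i + c))].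
have QP c i : bypass e C (x0 i) (x0 (i + c)) -> Q c.
  have lt : i %% m < m by rewrite ltn_mod.
  move=> by_; apply/existsP; exists (Ordinal lt); apply/bypassP => /=.
  rewrite (cyc_mod (mc_cyc mc0)).
  by rewrite (_ : x0 (i %% m + c) = x0 (i + c)) //; apply: (cyc_eq (mc_cyc mc0)); rewrite modnDml.
have shiftC s : cset m (fun i => x0 (s + i)) = C.
  apply/eqP; rewrite eqEcard (card_cset (cyc_shift (mc_cyc mc0) s)) (card_cset (mc_cyc mc0)) leqnn andbT.
  by apply/subsetP => z /(csetP (cyc_shift (mc_cyc mc0) s) z 0)[i _ ->]; exact: (in_cset (mc_cyc mc0)).
have [/existsP[i /bypassP by1]|n1] := boolP (Q 1).
  have mc := maxcyc_shift i mc0; set x := fun j => x0 (i + j) in mc.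
  have [v [s [al us ev ps sx]]] := bypass_uniq by1.
  have {}ev : e (x 0) v by rewrite /x addn0.
  have al' : all [predC cset m x] (v :: s) by rewrite /x shiftC.
  have [r3|r2] := leqP 3 (p - m).
    by have [T5 [y cy Ey]] := long_detour_structure de mc r3 us al' ev ps sx; constructor 1; exists y.
  constructor 2; have Tm : p = m.+2 by arith.
  have szs : (size s).+1 <= 2.
    have -> : 2 = #|~: C| by have := nvertsC C; rewrite (card_cset (mc_cyc mc0)) -/p; arith.
    rewrite -[(size s).+1]/(size (v :: s)) -(card_uniqP us); apply/subset_leq_card/subsetP.
    by move=> z /(allP al); rewrite in_setC.
  case: s => [|v2 [|//]] in us al al' ps sx szs *.
    exfalso; apply: (no_detour mc (i := 0) (c := 1) _ us al' ev ps); rewrite /= -?/p //; arith.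
  have o2 : outside2 e m x v v2.
    by split=> //; move: al' us => /= /and3P[vC v2C _]; rewrite inE // => /andP[].
  split; first exact: gap0_bipartite de Tm o2 ev sx.
  have := detour_cyc (mc_cyc mc) (i := 0) (c := 1) _ us _ ev ps sx.
  have -> : m - 1 + (size [:: v2]).+2 = p by rewrite /=; arith.
  by apply; [arith | apply/allP].
have [/existsP[c0 Qc0]|none] := boolP [exists c : 'I_m, (0 < c) && Q c].
  have exc : exists c, [&& 0 < c, c < m & Q c].
    by case/andP: Qc0 => c00 Qc; exists c0; rewrite c00 Qc ltn_ord.
  constructor 4; case: (ex_minnP exc) => c /and3P[c_gt0 cm /existsP[i /bypassP by1]] cmin.
  have c2 : 1 < c.
    rewrite ltn_neqAle c_gt0 andbT; apply: contraNneq n1 => ->.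
    by apply/existsP; exists i; apply/bypassP.
  (* The rotation by s puts the start of the bypass at x_(k-1) and its end at x_m; the summand m
     keeps the subtraction exact. *)
  pose k := m - c.-1; pose s := i + m - k.-1.
  exists c.-1; apply: (gap_structure (k := k) de (maxcyc_shift s mc0)).
  - by rewrite /k; arith.
  - by rewrite /k; arith.
  - by arith.
  - move=> i' c' c'lt; rewrite shiftC addnA => /QP Qc'.
    by have := cmin c'; rewrite Qc' andbT => /(_ _); arith.
  - rewrite shiftC; have -> : s + k.-1 = i + m by rewrite /s /k; arith.
    have -> : s + m = i + c + m by rewrite /s /k; arith.
    by rewrite !(cyc_per (mc_cyc mc0)).
constructor 3; apply: (no_bypass_structure de (C := C) str).
- by rewrite (card_cset (mc_cyc mc0)).
- apply: contraTneq mp => CT; have := card_cset (mc_cyc mc0).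
  by rewrite -/C CT cardsT -/(nverts T) -/p => ->; rewrite -leqNgt.
- move=> a b /(csetP (mc_cyc mc0) a 0)[i _ ->] /(csetP (mc_cyc mc0) b i)[j ij ->].
  have -> : j = i + (j - i) by arith.
  have [E|nE] := eqVneq (j - i) 0; first by rewrite E addn0.
  move/QP => Qji; case/negP: none.
  have lt : j - i < m by arith.
  by apply/existsP; exists (Ordinal lt); rewrite /= Qji lt0n nE.
Qed.

End StrongCase.

(** * Recognizing the extremal digraphs *)

Section Isomorphisms.

Lemma inj_diso (D E : digraph) (f : D -> E) : injective f -> #|E| <= #|D| ->
  (forall x y, arc (f x) (f y) = arc x y) -> diso D E.
Proof. by move=> fi le fa; exists f => //; apply: inj_card_bij. Qed.

Lemma index_on (T : finType) (A : {set T}) n : 0 < n -> #|A| <= n ->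
  exists f : T -> 'I_n, {in A &, injective f}.
Proof.
case: n => // n _ cA; exists (fun z => inord (index z (enum A))) => a b aA bA.
have lt z : z \in A -> index z (enum A) < n.+1.
  by move=> zA; rewrite (leq_trans _ cA) // cardE index_mem mem_enum.
move/(congr1 (@nat_of_ord _)); rewrite !inordK ?lt //.
move=> E; rewrite -(nth_index a (s := enum A) (x := a)) ?mem_enum // E nth_index ?mem_enum //.
Qed.

Lemma complete_induced (D : digraph) (A : {set D}) n : #|A| = n ->
  {in A &, forall u v, u != v -> arc u v} -> diso (induced A) (star (complete n)).
Proof.
move=> cA comp; have cS : #|{: {x : D | x \in A}}| = n by rewrite card_sig.
exists (fun u => cast_ord cS (enum_rank u)).
  exists (fun i => enum_val (cast_ord (esym cS) i)) => [u|i].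
    by rewrite cast_ordK enum_rankK.
  by rewrite enum_valK cast_ordKV.
move=> u v /=; rewrite /complete_edge /induced_arc (inj_eq (@cast_ord_inj _ _ _)) (inj_eq enum_rank_inj).
have [->|nuv] := eqVneq u v; first by rewrite arc_irr.
by rewrite comp ?(valP u) ?(valP v).
Qed.

(** A degree of 2n - 1 requires n vertices in the other class, so both classes have exactly n and D
    sits inside the complete bipartite digraph; M collects the missing arcs. *)
Lemma bipartite_in_B (D : digraph) n : nverts D = 2 * n -> 2 < n -> dense (@arc D) ->
  bipartite (@arc D) -> in_B n D.
Proof.
move=> Dn n3 de /existsP[f /forallP bip].
have {}bip a b : arc a b -> f a != f b by move=> ab; have /forallP/(_ b)/implyP := bip a; apply.
pose A := [set z | f z]; have inA z : (z \in A) = f z by rewrite inE.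
have big (X : {set D}) a : a \notin X -> (forall b, b \notin X -> f b = f a) -> n <= #|X|.
  move=> aX same; have := dense_deg de a.
  rewrite (sum_split X) [X in _ + X]big1 ?addn0; last first.
    move=> b; rewrite in_setC => bX; apply: adj0; apply/negP => /bip; by rewrite same ?eqxx.
  by have := leq_sum_card (fun v (_ : v \in X) => adj_le2 (@arc D) a v); rewrite Dn; arith.
have card2 : #|A| + #|~: A| = 2 * n by rewrite nvertsC.
have [a aA] : exists a, a \in A.
  have /card_gt0P[b _] : 0 < #|D| by apply: leq_trans (dense_ge5 de).
  apply/card_gt0P; have := big A b; rewrite inA; case: (boolP (f b)) => [fb _|/negPf fb /(_ isT) H].
    by apply/card_gt0P; exists b; rewrite inA.
  have : n <= #|A| by apply: H => c; rewrite inA => /negPf.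
  by arith.
have cAc : n <= #|~: A|.
  apply: (big _ a); rewrite ?in_setC ?negbK // => b; rewrite in_setC negbK !inA => ->.
  by rewrite -inA aA.
have [b bA] : exists b, b \in ~: A by apply/card_gt0P; arith.
have cA : n <= #|A|.
  rewrite in_setC in bA; apply: (big _ b) => // c; rewrite inA in bA *; rewrite inA => /negPf->.
  by rewrite (negPf bA).
have n0 : 0 < n by arith.
have [g1 g1i] : exists g : D -> 'I_n, {in A &, injective g} by apply: index_on => //; arith.
have [g2 g2i] : exists g : D -> 'I_n, {in ~: A &, injective g} by apply: index_on => //; arith.
pose K := star (complete_bipartite n n).
pose h (z : D) : K := if f z then inl (g1 z) else inr (g2 z).
have hi : injective h.
  move=> y z; rewrite /h; case fy: (f y); case fz: (f z) => //= -[E].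
    by apply: g1i; rewrite ?inA ?fy ?fz.
  by apply: g2i; rewrite ?in_setC ?inA ?fy ?fz.
have hb : bijective h.
  by apply: inj_card_bij => //; rewrite card_sum !card_ord -/(nverts D) Dn; arith.
have [h' hK h'K] := hb.
have Kh y z : arc (h y) (h z) = (f y != f z).
  by rewrite /h /= /bipartite_edge; case: (f y); case: (f z).
split; first by arith.
pose M : {set K * K} := [set w | arc w.1 w.2 && ~~ arc (h' w.1) (h' w.2)].
have degM y : #|D| <= (\sum_z adj (@arc D) y z).+1 := dense_deg de y.
(* Each vertex misses at most one of the 2n arcs joining it to the other class. *)
have miss y z z' (c1 c2 : bool) : (f y != f z) -> (f y != f z') ->
    ~~ (if c1 then arc y z else arc z y) -> ~~ (if c2 then arc y z' else arc z' y) ->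
    (z, c1) = (z', c2).
  move=> yz yz' nb nb'; apply/eqP/negPn/negP => neq.
  pose X := [set w | f y != f w]; have inX w : (w \in X) = (f y != f w) by rewrite inE.
  have cX : #|X| = n.
    have -> : X = if f y then ~: A else A.
      by apply/setP => w; rewrite inX; case: (f y); rewrite ?in_setC inA; case: (f w).
    by case: (f y); arith.
  have := degM y; rewrite -/(nverts D) (sum_split X) [X in _ + X]big1 ?addn0; last first.
    move=> w; rewrite in_setC inX negbK => /eqP yw; apply: adj0; apply/negP => /bip; by rewrite yw eqxx.
  have zX : z \in X by rewrite inX.
  have z'X : z' \in X by rewrite inX.
  have adj1 w c : ~~ (if c then arc y w else arc w y) -> adj (@arc D) y w <= 1.
    by rewrite /adj; case: c => /negPf->; rewrite ?addn0 leq_b1.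
  have [Ez|nz] := eqVneq z z'.
    have az : adj (@arc D) y z = 0.
      move: neq nb nb'; rewrite /adj -Ez; case: (c1); case: (c2); rewrite ?eqxx //= => _ /negPf-> /negPf-> //.
    rewrite (sum_setD1 _ zX) az.
    have := leq_sum_card (fun v (_ : v \in X :\ z) => adj_le2 (@arc D) y v).
    by have := cardsD1 z X; rewrite zX cX Dn; arith.
  have z'X' : z' \in X :\ z by rewrite in_setD1 eq_sym nz.
  rewrite (sum_setD1 _ zX) (sum_setD1 _ z'X').
  have := adj1 _ _ nb; have := adj1 _ _ nb'.
  have := leq_sum_card (fun v (_ : v \in X :\ z :\ z') => adj_le2 (@arc D) y v).
  by have := cardsD1 z X; have := cardsD1 z' (X :\ z); rewrite zX z'X' cX Dn; arith.
have MP w : w \in M -> [/\ f (h' w.1) != f (h' w.2) & ~~ arc (h' w.1) (h' w.2)].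
  rewrite inE => /andP[a1 na]; split=> //.
  by rewrite -Kh !h'K.
have disj w w' : w \in M -> w' \in M -> w != w' -> [disjoint [set w.1; w.2] & [set w'.1; w'.2]].
  move=> /MP[f1 n1] /MP[f2 n2]; apply: contraR => /pred0Pn[t /andP[]] /=.
  have h'i := can_inj h'K.
  have f1' : f (h' w.2) != f (h' w.1) by rewrite eq_sym.
  have f2' : f (h' w'.2) != f (h' w'.1) by rewrite eq_sym.
  rewrite !in_set2 => /orP[]/eqP Et /orP[]/eqP Et'; case: w w' f1 f2 f1' f2' n1 n2 Et Et' => w1 w2 [w1' w2'] /= f1 f2 f1' f2' n1 n2 E1 E2.
  - rewrite -E1 -E2 in f1 n1 f2 n2 *.
    by have [/h'i->] := miss _ _ _ true true f1 f2 n1 n2.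
  - rewrite -E1 -E2 in f1 n1 f2' n2.
    by have [] := miss _ _ _ true false f1 f2' n1 n2.
  - rewrite -E1 -E2 in f1' n1 f2 n2.
    by have [] := miss _ _ _ false true f1' f2 n1 n2.
  - rewrite -E1 -E2 in f1' n1 f2' n2 *.
    by have [/h'i->] := miss _ _ _ false false f1' f2' n1 n2.
exists M; split=> //.
- by move=> w; rewrite inE => /andP[].
(* Disjoint arcs have different ends in the first class, which bounds |M| by n. [Ordinal n0] is a
   default for pairs inside the second class, which are not arcs. *)
- pose l (w : K * K) : 'I_n := match w.1, w.2 with inl i, _ => i | inr _, inl i => i | _, _ => Ordinal n0 end.
  rewrite -[X in _ <= X](card_ord n); rewrite -(card_in_imset (f := l)); first exact: max_card.
  move=> w w' wM w'M El; apply/eqP; apply: contraT => nw.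
  have := disj w w' wM w'M nw; move: wM w'M; rewrite !inE => /andP[aw _] /andP[aw' _].
  case: w w' aw aw' El {nw} => [[i|i] [j|j]] [[i'|i'] [j'|j']] //= _ _; rewrite /l /= => <- /pred0P.
  - by move/(_ (inl i)); rewrite /= !in_set2 eqxx.
  - by move/(_ (inl i)); rewrite /= !in_set2 eqxx orbT.
  - by move/(_ (inl j)); rewrite /= !in_set2 eqxx orbT.
  - by move/(_ (inl j)); rewrite /= !in_set2 eqxx !orbT.
- exists h => // y z; change (@arc K (h y) (h z) && ((h y, h z) \notin M) = arc y z).
  have -> : ((h y, h z) \in M) = (f y != f z) && ~~ arc y z by rewrite in_set /= !hK -Kh.
  rewrite Kh; have [fyz|nfyz] := eqVneq (f y) (f z); last by rewrite negbK.
  by apply/esym/negP => /bip; rewrite fyz eqxx.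
Qed.

Lemma structure_H (D : digraph) n (F : {set D}) : nverts D = 2 * n -> nverts D = 2 * #|F| ->
  #|~: F| = #|F| ->
  {in F &, forall u v, u != v -> arc u v} -> {in ~: F &, forall u v, u != v -> arc u v} ->
  (forall b f, b \notin F -> f \in F -> ~~ arc b f) ->
  (forall f, f \in F -> exists2 b, b \notin F & arc f b) ->
  (forall b, b \notin F -> exists2 f, f \in F & arc f b) -> in_H n D.
Proof.
move=> Dn DF FC cF cB nBF FB BF; have Fn : #|F| = n by arith.
split; first exact: Dn.
exists F, (~: F); split.
- by split; [rewrite setUCr | split; [|rewrite FC]].
- by split; apply: complete_induced; rewrite ?FC.
- by move=> b f; rewrite in_setC; apply: nBF.
- by move=> f /FB[b nb fb]; exists b; rewrite // in_setC.
- by move=> b; rewrite in_setC; apply: BF.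
Qed.

Lemma structure_H2n (D : digraph) g (F B : {set D}) (a b : D) :
  nverts D = 2 * g.+1 -> #|F| = g -> #|B| = g ->
  F :|: B :|: [set a; b] = setT -> [disjoint F & B] -> [disjoint F :|: B & [set a; b]] -> a != b ->
  complete_on (@arc D) F -> complete_on (@arc D) B ->
  (forall f c, f \in F -> c \in B -> ~~ arc f c && ~~ arc c f) ->
  arc a b -> ~~ arc b a ->
  (forall f, f \in F -> [/\ arc a f, arc f a, arc b f & ~~ arc f b]) ->
  (forall c, c \in B -> [/\ ~~ arc a c, arc c a, arc b c & arc c b]) ->
  H2n_with g.+1 F B a b.
Proof.
move=> Dn cF cB cover dFB dab nab kF kB nFB ab nba aF aB.
have irr := @arc_irr D.
have [aFB bFB] : a \notin F :|: B /\ b \notin F :|: B.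
  by split; rewrite (disjointFl dab) // in_set2 eqxx ?orbT.
move: aFB bFB; rewrite !in_setU !negb_or => /andP[aF' aB'] /andP[bF' bB'].
have cases v : [\/ v \in F, v \in B, v = a | v = b].
  have : v \in F :|: B :|: [set a; b] by rewrite cover in_setT.
  rewrite !in_setU !in_set1 => /orP[/orP[]|/orP[/eqP|/eqP]] H.
  - by constructor 1.
  - by constructor 2.
  - by constructor 3.
  - by constructor 4.
have notFB v : v \in F -> v \notin B by move=> vF; rewrite (disjointFr dFB vF).
have notBF v : v \in B -> v \notin F by move=> vB; rewrite (disjointFl dFB vB).
have neF v w : v \in F -> w \notin F -> (v == w) = false.
  by move=> vF; apply: contraNF => /eqP<-.
have neB v w : v \in B -> w \notin B -> (v == w) = false.
  by move=> vB; apply: contraNF => /eqP<-.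
split=> //.
- split; apply: complete_induced.
  + by rewrite cardsU1 aF' cF.
  + move=> u v; rewrite !in_setU1 => /orP[/eqP->|uF] /orP[/eqP->|vF] nuv.
    * by rewrite eqxx in nuv.
    * by case: (aF _ vF).
    * by case: (aF _ uF).
    * exact: kF.
  + by rewrite cardsU1 bB' cB.
  + move=> u v; rewrite !in_setU1 => /orP[/eqP->|uB] /orP[/eqP->|vB] nuv.
    * by rewrite eqxx in nuv.
    * by case: (aB _ vB).
    * by case: (aB _ uB).
    * exact: kB.
- split; apply/setP => v; rewrite !inE; case: (cases v) => [vF|vB|->|->].
  + by case: (aF _ vF) => ->; rewrite vF orbT.
  + by case: (aB _ vB) => /negPf->; rewrite (negPf (notBF _ vB)) (neB _ _ vB bB').
  + by rewrite irr (negPf nab) (negPf aF').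
  + by rewrite ab eqxx.
  + by case: (aF _ vF) => _ _ _ /negPf->; rewrite (negPf (notFB _ vF)) (neF _ _ vF aF').
  + by case: (aB _ vB) => _ _ _ ->; rewrite vB orbT.
  + by rewrite ab eqxx.
  + by rewrite irr eq_sym (negPf nab) (negPf bB').
  + by case: (aF _ vF) => _ -> _ _; rewrite vF.
  + by case: (aB _ vB) => _ -> _ _; rewrite vB orbT.
  + by rewrite irr (negPf aF') (negPf aB').
  + by rewrite (negPf nba) (negPf bF') (negPf bB').
  + by case: (aF _ vF) => _ _ -> _; rewrite vF.
  + by case: (aB _ vB) => _ _ -> _; rewrite vB orbT.
  + by rewrite (negPf nba) (negPf aF') (negPf aB').
  + by rewrite irr (negPf bF') (negPf bB').
Qed.

(** Only the arc b -> a is left open by the structure. If present, it is deleted to reach H_2n and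
    then added back. *)
Lemma structure_H2n' (D : digraph) g (F B : {set D}) (a b : D) : 1 < g ->
  nverts D = 2 * g.+1 -> #|F| = g -> #|B| = g ->
  F :|: B :|: [set a; b] = setT -> [disjoint F & B] -> [disjoint F :|: B & [set a; b]] -> a != b ->
  complete_on (@arc D) F -> complete_on (@arc D) B ->
  (forall f c, f \in F -> c \in B -> ~~ arc f c && ~~ arc c f) ->
  arc a b ->
  (forall f, f \in F -> [/\ arc a f, arc f a, arc b f & ~~ arc f b]) ->
  (forall c, c \in B -> [/\ ~~ arc a c, arc c a, arc b c & arc c b]) ->
  is_H2n g.+1 D \/ is_H2n' g.+1 D.
Proof.
move=> g1 Dn cF cB cover dFB dab nab kF kB nFB ab aF aB.
have [ba|nba] := boolP (arc b a); last first.
  by left; split; [arith | exists F, B, a, b; apply: structure_H2n].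
right; split; first by arith.
pose D0 := del_arcs [set (b, a)].
have [aFB bFB] : a \notin F :|: B /\ b \notin F :|: B.
  by split; rewrite (disjointFl dab) // in_set2 eqxx ?orbT.
move: aFB bFB; rewrite !in_setU !negb_or => /andP[aF' aB'] /andP[bF' bB'].
have D0E (u v : D) : @arc D0 u v = @arc D u v && ~~ ((u == b) && (v == a)).
  by rewrite -xpair_eqE -in_set1.
have neF v w : v \in F -> w \notin F -> (v == w) = false.
  by move=> vF; apply: contraNF => /eqP<-.
have neB v w : v \in B -> w \notin B -> (v == w) = false.
  by move=> vB; apply: contraNF => /eqP<-.
exists D0, F, B, a, b; split.
  apply: (@structure_H2n D0) => //.
  - by move=> u v uF vF nuv; rewrite D0E (neF _ _ uF bF') andbT; apply: kF.
  - by move=> u v uB vB nuv; rewrite D0E (neB _ _ uB bB') andbT; apply: kB.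
  - by move=> f c fF cB'; case/andP: (nFB f c fF cB') => /negPf n1 /negPf n2; rewrite !D0E n1 n2.
  - by rewrite D0E ab (negPf nab).
  - by rewrite D0E !eqxx andbF.
  - move=> f fF; have [h1 h2 h3 h4] := aF f fF.
    by rewrite !D0E h1 h2 h3 (negPf h4) (negPf nab) !(neF _ _ fF) ?andbF.
  - move=> c cB'; have [h1 h2 h3 h4] := aB c cB'.
    by rewrite !D0E (negPf h1) h2 h3 h4 !(neB _ _ cB') ?andbF.
exists id; first by exists id.
move=> u v; rewrite /= /add_arc_rel -/(@arc D0 u v) D0E.
have [->|nub] := eqVneq u b; last by rewrite andbT orbF.
have [->|nva] := eqVneq v a; last by rewrite andbT orbF.
by rewrite ba eq_sym nab.
Qed.

Lemma structure_join (D : digraph) n (z : D) (S1 S2 : {set D}) :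
  z |: S1 :|: S2 = setT -> z \notin S1 -> z \notin S2 -> [disjoint S1 & S2] ->
  nverts D = (2 * #|S1|).+1 -> #|S1| = n -> #|S2| = n -> 0 < n ->
  (forall u v, u \in S1 -> v \in S2 -> ~~ arc u v && ~~ arc v u) ->
  (forall u v, u != v -> (u \in z |: S1) && (v \in z |: S1) ||
                         (u \in z |: S2) && (v \in z |: S2) -> arc u v) ->
  diso D (star (gjoin (gunion (complete n) (complete n)) (complete 1))).
Proof.
move=> cover z1 z2 dS DS c1 c2 n0 nS comp.
have [g1 g1i] : exists g : D -> 'I_n, {in S1 &, injective g} by apply: index_on => //; rewrite c1.
have [g2 g2i] : exists g : D -> 'I_n, {in S2 &, injective g} by apply: index_on => //; rewrite c2.
have cases v : [\/ v = z, v \in S1 | v \in S2].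
  have : v \in z |: S1 :|: S2 by rewrite cover in_setT.
  by rewrite !in_setU in_set1 => /orP[/orP[/eqP|]|]; [constructor 1|constructor 2|constructor 3].
have ne1 v : v \in S1 -> (v == z) = false by move=> vS; apply: contraNF z1 => /eqP<-.
have ne2 v : v \in S2 -> (v == z) = false by move=> vS; apply: contraNF z2 => /eqP<-.
have not1 v : v \in S2 -> (v \in S1) = false by move=> vS; apply: (disjointFl dS).
have not2 v : v \in S1 -> (v \in S2) = false by move=> vS; apply: (disjointFr dS).
pose f (v : D) : star (gjoin (gunion (complete n) (complete n)) (complete 1)) :=
  if v == z then inr ord0 else if v \in S1 then inl (inl (g1 v)) else inl (inr (g2 v)).
have fz : f z = inr ord0 by rewrite /f eqxx.
have f1 v : v \in S1 -> f v = inl (inl (g1 v)) by move=> vS; rewrite /f ne1 // vS.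
have f2 v : v \in S2 -> f v = inl (inr (g2 v)) by move=> vS; rewrite /f ne2 // not1.
have irr := @arc_irr D.
have zv v : v != z -> arc z v /\ arc v z.
  move=> nvz; have vz : (v \in z |: S1) || (v \in z |: S2).
    by case: (cases v) nvz => [->|vS|vS]; rewrite ?eqxx // !in_setU1 vS ?orbT.
  by split; apply: comp; rewrite ?[z == v]eq_sym // !setU11 ?andbT.
apply: (@inj_diso _ _ f).
- move=> u v; case: (cases u) => [->|uS|uS]; [rewrite fz | rewrite (f1 u uS) | rewrite (f2 u uS)];
    (case: (cases v) => [->|vS|vS]; [rewrite fz | rewrite (f1 v vS) | rewrite (f2 v vS)]) => // => -[] E; [exact: g1i | exact: g2i].
- by rewrite !card_sum !card_ord -/(nverts D) DS c1; arith.
move=> u v; case: (cases u) => [->|uS|uS]; [rewrite fz | rewrite (f1 u uS) | rewrite (f2 u uS)];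
  (case: (cases v) => [->|vS|vS]; [rewrite fz | rewrite (f1 v vS) | rewrite (f2 v vS)]);
  rewrite /= ?irr //.
- by case: (zv v); rewrite ?ne1.
- by case: (zv v); rewrite ?ne2.
- by case: (zv u); rewrite ?ne1.
- rewrite /complete_edge; have [->|nuv] := eqVneq u v; first by rewrite eqxx irr.
  rewrite comp ?in_setU1 ?uS ?vS ?orbT //.
  by apply: contraNneq nuv => /g1i->.
- by apply/esym/negbTE; case/andP: (nS u v uS vS).
- by case: (zv u); rewrite ?ne2.
- by apply/esym/negbTE; case/andP: (nS v u vS uS).
- rewrite /complete_edge; have [->|nuv] := eqVneq u v; first by rewrite eqxx irr.
  rewrite comp ?in_setU1 ?uS ?vS ?orbT //.
  by apply: contraNneq nuv => /g2i->.
Qed.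

Lemma structure_Q5 (D : digraph) y : nverts D = 5 -> cyc (@arc D) 5 y ->
  (forall i j, arc (y i) (y j) = (j == i.+1 %[mod 5]) || (i == j.+1 %[mod 5])) ->
  diso D (star Q5).
Proof.
move=> D5 cy Ey; pose h (i : 'I_5) : D := y i.
have hi : injective h.
  by move=> i j /(cyc_inj cy); rewrite !modn_small // => /val_inj.
have [f hK fK] : bijective h by apply: inj_card_bij; rewrite // card_ord -D5.
exists f; first by exists h.
move=> u v; rewrite -{2}(fK u) -{2}(fK v) /h Ey /= /Q5_edge -!val_eqE /=.
by rewrite (modn_small (ltn_ord (f v))) (modn_small (ltn_ord (f u))).
Qed.

End Isomorphisms.

Theorem theorem5p1 (D : digraph) (p n : nat)
    (order_p : #|D| = p) (p_ge5 : 5 <= p)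
    (deg_ge : forall x : D, p - 1 <= deg x)
    (* min (indeg x) (outdeg x) >= p / 2 - 1, with denominators cleared *)
    (semideg_ge : forall x : D, p <= 2 * (minn (indeg x) (outdeg x) + 1))
    (def_n : n = p./2) :
  has_dicycle D (p - 1) \/
  [\/ in_H n D,
      in_B n D,
      diso D (star (gjoin (gunion (complete n) (complete n)) (complete 1)))
    | [\/ is_H2n n D, is_H2n' n D | diso D (star Q5)]].
Proof.
have Dp : nverts D = p by exact: order_p.
have de : dense (@arc D).
  split; rewrite ?Dp //; first exact: (@arc_irr D).
  - move=> u; have -> : \sum_v adj (@arc D) u v = deg u.
      rewrite /deg addnC -[indeg u]/(odeg (conv (@arc D)) u) -[outdeg u]/(odeg (@arc D) u).
      by rewrite !odeg_sum -big_split.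
    by have := deg_ge u; arith.
  - by move=> u; have := semideg_ge u; rewrite -[odeg _ _]/(outdeg u); set i := indeg u; set o := outdeg u; have := geq_minr i o; arith.
  - by move=> u; have := semideg_ge u; rewrite -[odeg _ _]/(indeg u); set i := indeg u; set o := outdeg u; have := geq_minl i o; arith.
have [cp|ncp] := has_cycP (@arc D) p.-1; first by left; rewrite subn1.
right.
case: (boolP [forall u : D, forall v : D, connect (@arc D) u v]) => [/forallP str|nstr]; last first.
  move: nstr; rewrite negb_forall => /existsP[u]; rewrite negb_forall => /existsP[v nc].
  have [F [[DF FC] cF cB nBF [FB BF]]] := not_strong_structure de nc.
  by constructor 1; apply: (structure_H (F := F)) => //; arith.
have {}str u v : connect (@arc D) u v by have /forallP := str u; apply.
rewrite -Dp in ncp; have [[y cy [T5 Ey]]|[bip hc]|[z [S1 [S2 [[cov z1 z2 dS] d1 d2 nS comp]]]]|] := strong_structure de str ncp.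
- by constructor 4; constructor 3; apply: structure_Q5 cy Ey.
(* A Hamiltonian cycle alternates between the two colours, so p is even. *)
- constructor 2; have op : ~~ odd p.
    have [|x cx] := has_cyc_cyc _ hc; first by arith.
    case/existsP: bip => f /forallP bip.
    have step i : f (x i.+1) = ~~ f (x i).
      have /forallP/(_ (x i.+1)) := bip (x i); rewrite (cyc_step cx) /=.
      by case: (f (x i)); case: (f (x i.+1)).
    have par i : f (x i) = odd i (+) f (x 0) by elim: i => //= i IH; rewrite step IH addNb.
    have := par p; rewrite -Dp -{1}[nverts D]add0n (cyc_per cx).
    by case: (odd _); case: (f (x 0)).
  by apply: bipartite_in_B => //; arith.
- by constructor 3; apply: (structure_join cov z1 z2 dS d1) => //; arith.
case=> g [F [B [a [b [[Dg g1 cF cB] [cov dFB dab nab] [kF kB] nFB [ab aF aB]]]]]].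
have -> : n = g.+1 by arith.
constructor 4.
by have [|] := structure_H2n' g1 Dg cF cB cov dFB dab nab kF kB nFB ab aF aB; [constructor 1 | constructor 2].
Qed.
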